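(* Let $D=\frac{p(s)}{q(s)}\frac{d}{ds}$ be a non-zero derivation of the field $\mathbb{C}(s)$ of rational functions, where $p(s)=\sum_{i=L_p}^{N_p}p_is^i$ and $q(s)=\sum_{i=L_q}^{N_q}q_is^i$ are non-zero coprime elements of $\mathbb{C}[s]$ with $p_{L_p},p_{N_p},q_{L_q},q_{N_q}$ all non-zero. For a finite-dimensional indecomposable vertex algebra $(\mathbb{C}(s),D)$-module $(M,Y_M)$ write $S(x)=Y_M(s,x)$. Let $\alpha$ be a non-zero complex number. Then: (1) There exists a non-zero finite-dimensional indecomposable vertex algebra $(\mathbb{C}(s),D)$-module $M$ with $\operatorname{ld}(S(x)^{[0]})>0$ and $\operatorname{lc}(S(x)^{[0]})=\alpha$ if and only if $p(0)q(0)\neq0$ and $\alpha=p(0)/q(0)$. Moreover, in this case $\operatorname{ld}(S(x)^{[0]})=1$ and $S(x)\in(\operatorname{End}_{\mathbb{C}}M)[[x]]$. (2) There exists a non-zero finite-dimensional indecomposable vertex algebra $(\mathbb{C}(s),D)$-module $M$ with $\operatorname{ld}(S(x)^{[0]})=0$ and $\operatorname{lc}(S(x)^{[0]})=\alpha$ if and only if $p(\alpha)q(\alpha)\neq0$. Moreover, in this case $S(x)\in(\operatorname{End}_{\mathbb{C}}M)[[x]]$ and $S^{[0]}_{(1)}=p(\alpha)/q(\alpha)$. (3) There exists a non-zero finite-dimensional indecomposable vertex algebra $(\mathbb{C}(s),D)$-module $M$ with $\operatorname{ld}(S(x)^{[0]})<0$ and $\operatorname{lc}(S(x)^{[0]})=\alpha$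 if and only if $\deg p=\deg q+2$ and $\alpha=-q_{N_q}/p_{N_p}$. Moreover, in this case $\operatorname{ld}(S(x)^{[0]})=-1$. In each case, for every positive integer $n$ there exists a unique, up to isomorphism, $n$-dimensional indecomposable vertex algebra $(\mathbb{C}(s),D)$-module which satisfies the conditions.
   Context: Let $A$ be a commutative associative unital $\mathbb{C}$-algebra with a derivation $D$. It is a vertex algebra with vacuum $1$ and $Y(a,x)b=\sum_{i\ge 0}\frac{1}{i!}(D^ia)b\,x^i=\sum_{j\in\mathbb{Z}}(a_jb)x^{-j-1}$; thus $a_{-1-i}b=\frac1{i!}(D^ia)b$ for $i\ge0$ and $a_jb=0$ for $j\ge 0$. A vertex algebra $(A,D)$-module is a module over this vertex algebra: a $\mathbb{C}$-vector space $M$ with a linear map $Y_M(\cdot,x):A\to(\operatorname{End}_{\mathbb{C}}M)[[x,x^{-1}]]$, $Y_M(a,x)=\sum_{i\in\mathbb{Z}}a_ix^{-i-1}$, such that $Y_M(u,x)w\in M((x))$ for $u\in A$, $w\in M$; $Y_M(1,x)=\mathrm{id}_M$; and for $u,v\in A$, $l,m,n\in\mathbb{Z}$, $$\sum_{i\ge0}\binom{m}{i}(u_{l+i}v)_{m+n-i}=\sum_{i\ge0}\binom{l}{i}(-1)^i\big(u_{l+m-i}v_{n+i}+(-1)^{l+1}v_{l+n-i}u_{m+i}\big).$$ Isomorphisms are linear isomorphisms intertwining the maps $Y(\cdot,x)$; a module is indecomposable if it is not a direct sum of two non-zero submodules. For a finite-dimensional $M$ and $X\in\operatorname{End}_{\mathbb{C}}M$,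 $X^{[0]}$ denotes the semisimple part of $X$ (Jordan decomposition). For $H(x)=\sum_{i\in\mathbb{Z}}H_{(i)}x^i\in(\operatorname{End}_{\mathbb{C}}M)[[x,x^{-1}]]$, $H(x)^{[0]}=\sum_iH^{[0]}_{(i)}x^i$, where $H^{[0]}_{(i)}=(H_{(i)})^{[0]}$. For $H(x)=\sum_{i\ge L}H_{(i)}x^i\in(\operatorname{End}_{\mathbb{C}}M)((x))$ with $H_{(L)}\ne0$, $\operatorname{ld}(H(x))=L$ and $\operatorname{lc}(H(x))=H_{(L)}$. For a non-zero finite-dimensional indecomposable $M$, $S(x)^{[0]}$ is a non-zero element of $\mathbb{C}((x))\,\mathrm{id}_M$, and scalars are identified with scalar multiples of $\mathrm{id}_M$ (so $\operatorname{lc}(S(x)^{[0]})=\alpha$ means $\alpha\,\mathrm{id}_M$, and similarly for $S^{[0]}_{(1)}$). *)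

(* Defs.v *)
From HB Require Import structures.
From mathcomp Require Import all_boot all_order all_algebra.
From mathcomp Require Import ring.
From mathcomp Require Import boolp classical_sets fsbigop reals.
From mathcomp Require Import complex.

Set Implicit Arguments.
Unset Strict Implicit.
Unset Printing Implicit Defensive.

Import Order.TTheory GRing.Theory Num.Theory.

Local Open Scope ring_scope.

Notation "x %:F" := (@FracField.tofrac _ x) : ring_scope.

(* The field K(s) of rational functions is {fraction {poly K}}, with s = 'X%:F;
   the library does not equip it with its K-algebra structure. *)
Section RationalFunctions.
Variable K : fieldType.
Implicit Types (f g : {fraction {poly K}}) (c : K).

Definition fracpoly_scale c f : {fraction {poly K}} := (c%:P)%:F * f.

Lemma fracpoly_scaleA a b f :
  fracpoly_scale a (fracpoly_scale b f) = fracpoly_scale (a * b) f.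
Proof. by rewrite /fracpoly_scale mulrA -rmorphM -polyCM. Qed.

Lemma fracpoly_scale1 : left_id 1 fracpoly_scale.
Proof. by move=> f; rewrite /fracpoly_scale polyC1 rmorph1 mul1r. Qed.

Lemma fracpoly_scaleDr : right_distributive fracpoly_scale +%R.
Proof. by move=> c f g; rewrite /fracpoly_scale mulrDr. Qed.

Lemma fracpoly_scaleDl f : {morph fracpoly_scale^~ f : a b / a + b}.
Proof. by move=> a b; rewrite /fracpoly_scale polyCD rmorphD mulrDl. Qed.

HB.instance Definition _ := GRing.Zmodule_isLmodule.Build K
  {fraction {poly K}}
  fracpoly_scaleA fracpoly_scale1 fracpoly_scaleDr fracpoly_scaleDl.

Lemma fracpoly_scaleE c f : c *: f = (c%:P)%:F * f.
Proof. by []. Qed.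

Lemma fracpoly_scaleAl c f g : c *: (f * g) = c *: f * g.
Proof. exact: mulrA. Qed.

HB.instance Definition _ := GRing.Lmodule_isLalgebra.Build K
  {fraction {poly K}} fracpoly_scaleAl.
HB.instance Definition _ := GRing.Lalgebra_isComAlgebra.Build K
  {fraction {poly K}}.

Lemma fracpoly_repr f :
  let r := repr f in \d_r != 0 /\ f = (\n_r)%:F / (\d_r)%:F.
Proof.
set r := repr f; have dr0 : \d_r != 0 by apply: denom_ratioP.
split=> //; apply: (canRL (mulfK _)); first by rewrite tofrac_eq0.
have -> : f = (\pi_{fraction {poly K}} r)%qT by rewrite reprK.
have tofracE (x : {poly K}) : x%:F = (\pi_{fraction {poly K}} (Ratio x 1))%qT.
  by unlock FracField.tofrac.
rewrite !tofracE.
transitivity (\pi_{fraction {poly K}} (FracField.mulf r (Ratio \d_r 1)))%qT.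
  by symmetry; exact: FracField.pi_mul.
apply/eqP; rewrite FracField.equivf_def /FracField.equivf /FracField.mulf.
by rewrite !numden_Ratio ?mulr1 ?oner_neq0 // mulrC.
Qed.

Lemma fracpolyP f : exists n d : {poly K}, d != 0 /\ f = n%:F / d%:F.
Proof. by have := fracpoly_repr f; do 2![eexists]; eassumption. Qed.

(* The derivation d/ds: the quotient rule applied to a chosen representative.
   By [ddsE] the result does not depend on the representative. *)
Definition dds f : {fraction {poly K}} :=
  let r := repr f in
  ((\n_r)^`() * \d_r - \n_r * (\d_r)^`())%:F / (\d_r ^+ 2)%:F.

Lemma ddsE (n d : {poly K}) : d != 0 ->
  dds (n%:F / d%:F) = (n^`() * d - n * d^`())%:F / (d ^+ 2)%:F.
Proof.
move=> d0; rewrite /dds; case: (fracpoly_repr (n%:F / d%:F)).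
move: (\n_(_)) (\d_(_)) => a b b0 /eqP.
rewrite eqr_div ?tofrac_eq0 // -!tofracM tofrac_eq => /eqP e.
apply/eqP; rewrite eqr_div ?tofrac_eq0 ?expf_neq0 // -!tofracM tofrac_eq.
have e' : n^`() * b + n * b^`() = a^`() * d + a * d^`().
  by rewrite -!derivM e.
rewrite -subr_eq0; apply/eqP.
have -> : (a^`() * b - a * b^`()) * d ^+ 2 - (n^`() * d - n * d^`()) * b ^+ 2 =
  b * d * (a^`() * d + a * d^`() - (n^`() * b + n * b^`()))
  + (n * b - a * d) * (b * d^`() + b^`() * d) by ring.
by rewrite e' e !subrr mulr0 mul0r addr0.
Qed.

Lemma ddsZD c f g : dds (c *: f + g) = c *: dds f + dds g.
Proof.
have [m [d [d0 ->]]] := fracpolyP f; have [n [e [e0 ->]]] := fracpolyP g.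
have -> : c *: (m%:F / d%:F) + n%:F / e%:F =
    (c%:P * m * e + n * d)%:F / (d * e)%:F.
  rewrite fracpoly_scaleE mulrA -tofracM.
  by rewrite addf_div ?tofrac_eq0 // !(tofracM, tofracD).
rewrite !ddsE ?mulf_neq0 // fracpoly_scaleE [in RHS]mulrA -tofracM.
rewrite addf_div ?tofrac_eq0 ?expf_neq0 //.
apply/eqP; rewrite eqr_div ?mulf_neq0 ?tofrac_eq0 ?expf_neq0 ?mulf_neq0 //.
rewrite -!(tofracM, tofracD) tofrac_eq !(derivM, derivD, derivC); apply/eqP.
ring.
Qed.

Lemma ddsM f g : dds (f * g) = dds f * g + f * dds g.
Proof.
have [m [d [d0 ->]]] := fracpolyP f; have [n [e [e0 ->]]] := fracpolyP g.
rewrite mulf_div -!tofracM !ddsE ?mulf_neq0 //.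
rewrite !mulf_div addf_div ?mulf_neq0 ?tofrac_eq0 ?expf_neq0 //.
apply/eqP; rewrite eqr_div ?mulf_neq0 ?tofrac_eq0 ?expf_neq0 ?mulf_neq0 //.
rewrite -!(tofracM, tofracD) tofrac_eq !(derivM, derivD, derivC); apply/eqP.
ring.
Qed.

Lemma dds_s : dds ('X%:F) = 1.
Proof.
have -> : ('X%:F : {fraction {poly K}}) = 'X%:F / 1%:F by rewrite rmorph1 divr1.
by rewrite ddsE ?oner_neq0 // derivX derivC mulr0 subr0 mulr1 expr1n rmorph1 divr1.
Qed.

Definition ratder (p q : {poly K}) f : {fraction {poly K}} :=
  p%:F / q%:F * dds f.

Lemma ratderZD p q c f g :
  ratder p q (c *: f + g) = c *: ratder p q f + ratder p q g.
Proof. by rewrite /ratder ddsZD mulrDr !fracpoly_scaleE mulrCA. Qed.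

Lemma ratderM p q f g :
  ratder p q (f * g) = ratder p q f * g + f * ratder p q g.
Proof. by rewrite /ratder ddsM mulrDr mulrA [in X in _ + X]mulrCA. Qed.

Lemma ratder_s p q : ratder p q ('X%:F) = p%:F / q%:F.
Proof. by rewrite /ratder dds_s mulr1. Qed.

End RationalFunctions.

Section EndomorphismSeries.
Variables (K : fieldType) (V : vectType K).
Implicit Types X S N : 'End(V).

Definition invariant X (U : {vspace V}) : Prop := (X @: U <= U)%VS.

Definition semisimple_end S : Prop := forall U : {vspace V}, invariant S U ->
  exists W : {vspace V},
    [/\ invariant S W, (U + W = fullv)%VS & (U :&: W = 0)%VS].

Definition nilpotent_end N : Prop :=
  exists k : nat, forall v, iter k N v = 0.

Definition jordan_decomposition X S N : Prop :=
  [/\ X = S + N, semisimple_end S, nilpotent_end N & (S \o N = N \o S)%VF].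

(* The default value 0 of [xget] is never used when K is algebraically closed,
   since then every X has exactly one Jordan decomposition. *)
Definition ss_part X : 'End(V) :=
  xget 0 [set S | exists N, jordan_decomposition X S N]%classic.

(* (End V)[[x, x^-1]] is int -> 'End(V), H i being the coefficient of x^i. *)
Implicit Type H : int -> 'End(V).

Definition ss_series H : int -> 'End(V) := fun i => ss_part (H i).

(* H is a non-zero element of (End V)((x)) with ld(H) = L; lc(H) is then H L. *)
Definition is_ld H (L : int) : Prop :=
  H L != 0 /\ forall i, i < L -> H i = 0.

Definition is_power_series H : Prop := forall i, i < 0 -> H i = 0.

End EndomorphismSeries.

Section VertexModules.
Variables (K : fieldType) (A : comAlgType K) (D : A -> A).

(* u_j v in the vertex algebra (A, D). As [Negz i] is -1 - i, this reads
   u_{-1-i} v = (1/i!) D^i(u) v for i >= 0. *)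
Definition va_mul (u : A) (j : int) (v : A) : A :=
  match j with
  | Posz _ => 0
  | Negz i => (i`!%:R^-1 : K) *: (iter i D u * v)
  end.

Definition binomz (m : int) (i : nat) : K :=
  (\prod_(j < i) (m - j%:Z)%:~R) / i`!%:R.

(* [Ycoef u i] is the coefficient of x^i in Y_M(u, x), whereas [mode Y u n] is
   u_n, the coefficient of x^(-n-1). *)
Definition mode (M : vectType K) (Y : A -> int -> 'End(M)) (u : A) (n : int) :
  'End(M) := Y u (- n - 1).

(* Finite-dimensional modules over the vertex algebra (A, D). The sums over all
   i : nat are finitely supported, by the definition of [va_mul] on the left
   and by [Ycoef_trunc] on the right. *)
Record vamodule := VAModule {
  vacarrier :> vectType K;
  Ycoef : A -> int -> 'End(vacarrier);
  Ycoef_linear : forall (c : K) (u v : A) (i : int),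
    Ycoef (c *: u + v) i = c *: Ycoef u i + Ycoef v i;
  Ycoef_trunc : forall (u : A) (w : vacarrier),
    exists L : int, forall i, i < L -> Ycoef u i w = 0;
  Ycoef_vacuum : forall i : int, Ycoef 1 i = if i == 0 then \1%VF else 0;
  Ycoef_borcherds : forall (u v : A) (l m n : int) (w : vacarrier),
    \sum_(i \in [set: nat]%classic)
      binomz m i *: mode Ycoef (va_mul u (l + i%:Z) v) (m + n - i%:Z) w =
    \sum_(i \in [set: nat]%classic)
      (binomz l i * (-1) ^+ i) *:
        (mode Ycoef u (l + m - i%:Z) (mode Ycoef v (n + i%:Z) w) +
         (-1) ^ (l + 1) *:
           mode Ycoef v (l + n - i%:Z) (mode Ycoef u (m + i%:Z) w))
}.

Definition vadim (M : vamodule) : nat := \dim (fullv : {vspace M}).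

Definition is_submodule (M : vamodule) (U : {vspace M}) : Prop :=
  forall (a : A) (i : int), invariant (Ycoef M a i) U.

Definition indecomposable (M : vamodule) : Prop :=
  forall U W : {vspace M}, is_submodule U -> is_submodule W ->
    (U + W = fullv)%VS -> (U :&: W = 0)%VS -> U = 0%VS \/ W = 0%VS.

Definition vaiso (M N : vamodule) : Prop :=
  exists f : 'Hom(M, N), bijective f /\
    forall (a : A) (i : int), (f \o Ycoef M a i = Ycoef N a i \o f)%VF.

Definition unique_in_each_dim (P : vamodule -> Prop) : Prop :=
  forall n : nat, (0 < n)%N ->
    (exists M : vamodule, vadim M = n /\ P M) /\
    (forall M N : vamodule,
       vadim M = n -> P M -> vadim N = n -> P N -> vaiso M N).

End VertexModules.

Section RationalModules.
Variables (K : fieldType) (p q : {poly K}).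

Definition ratmodule : Type := vamodule (ratder p q).

(* S(x) = Y_M(s, x) *)
Definition Sser (M : ratmodule) : int -> 'End(M) := Ycoef M ('X%:F).

(* M is non-zero and indecomposable, ld(S(x)^[0]) satisfies P, and
   lc(S(x)^[0]) = alpha. *)
Definition leading_case (P : int -> Prop) (alpha : K) (M : ratmodule) : Prop :=
  [/\ (0 < vadim M)%N, indecomposable M &
    exists L : int, [/\ is_ld (ss_series (Sser M)) L, P L &
      ss_series (Sser M) L = alpha *: \1%VF]].

End RationalModules.

(* Main.v *)
(* A module is the same thing as a ring morphism Y from C(s) into commuting
   (End M)-valued Laurent series with Y(Df) = d/dx Y(f): the Borcherds identity
   follows from its instance l = -1, m = 0 (the product rule) by recurrences in
   (l, m, n). When M is indecomposable each coefficient has one eigenvalue, so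
   Y(f) = chi(f) + nilpotent, where chi : C(s) -> C((x)) is a ring morphism
   again intertwining D and d/dx, and S(x)^[0] = chi(s).

   The three cases become one for the generator t = s, s - alpha or 1/s of
   C(s), for which ld chi(t) > 0. Writing Dt = P(t)/Q(t), a comparison of
   orders in Q(chi(t)) chi(t)' = P(chi(t)) forces ld chi(t) = 1 and
   P(0) Q(0) <> 0, and then Y(t) has no negative powers of x. The same equation
   determines Y(t), hence Y, from its constant term T, so M is indecomposable
   exactly when the nilpotent T is a single Jordan block: M is determined by
   its dimension.

   Conversely, if P(0) Q(0) <> 0 then chi(f) = exp(xD) f at t = 0 defines the
   required morphism on the local ring of C(s) at t = 0, and it extends to C(s)
   since chi(t) is x times a unit. The n-dimensional module is
   Y(f) = exp(nu d/dx) chi(f), nu being a nilpotent Jordan block of size n. *)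
From HB Require Import structures.
Require Import Defs.
From mathcomp Require Import all_boot all_order all_algebra.
From mathcomp Require Import ring zify.
From mathcomp Require Import boolp classical_sets fsbigop reals.
From mathcomp Require Import complex.

Set Implicit Arguments.
Unset Strict Implicit.
Unset Printing Implicit Defensive.

Import Order.TTheory GRing.Theory Num.Theory.

Local Open Scope ring_scope.

(* [eqtype] exports another [invariant]. *)
Local Notation invariant := Defs.invariant.

(** * Linear algebra *)

(** Indecomposability speaks of all coefficients of all Y(f), while the classification needs it for
    the single operator T. The bridge is that a linear map commuting with T commutes with every
    Y(f): the recursion for Y(t) can be solved because the constant term of Q(Y(t)) is Q(0) plus a
    nilpotent, hence cancellable. Applied to the projections of a T-stable splitting this makes the
    summands submodules; applied to a map between two modules it gives the isomorphism. The absence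
    of poles cannot be read off from chi, since a nilpotent part of Y(t) might have a pole that chi
    does not see; it needs an induction over submodules. The operator exp(nu d/dx) is the
    substitution x -> x + nu, which is why it respects products and d/dx. It gives T = chi(t)(nu),
    and ld chi(t) = 1 makes the coefficient at nu non-zero, so T is again a single block. Laurent
    series are functions on the integers, not elements of a ring; their products are sums over
    finite windows, widened or narrowed as the bounds at hand require. *)

Definition lfunsE :=
  (zero_lfunE, add_lfunE, opp_lfunE, scale_lfunE, id_lfunE, comp_lfunE).

Section LfunLinear.
Variables (K : fieldType) (V W : vectType K) (f : 'Hom(V, W)).

Lemma lfun_at0 : f 0 = 0. Proof. exact: linear0. Qed.
Lemma lfunN u : f (- u) = - f u. Proof. exact: linearN. Qed.
Lemma lfunD u v : f (u + v) = f u + f v. Proof. exact: linearD. Qed.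
Lemma lfunB u v : f (u - v) = f u - f v. Proof. exact: linearB. Qed.
Lemma lfunZ c u : f (c *: u) = c *: f u. Proof. exact: linearZ_LR. Qed.
Lemma lfun_sum I (r : seq I) (P : pred I) F :
  f (\sum_(i <- r | P i) F i) = \sum_(i <- r | P i) f (F i).
Proof. exact: linear_sum. Qed.

End LfunLinear.

(** * Nilpotent endomorphisms, and the semisimple part of a scalar plus a nilpotent *)

Section Nilpotent.
Variables (K : fieldType) (V : vectType K).
Implicit Types (X Y N : 'End(V)) (U W : {vspace V}).

Lemma iter_invariant X U k u : invariant X U -> u \in U -> iter k X u \in U.
Proof.
by move=> /subvP XU uU; elim: k => //= k IH; apply/XU/memv_img.
Qed.

Lemma invariantP X U : invariant X U <-> forall u, u \in U -> X u \in U.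
Proof.
split=> [/subvP XU u uU|XU]; first exact/XU/memv_img.
by apply/subvP => _ /memv_imgP[u uU ->]; exact: XU.
Qed.

Lemma lfun_iter0 X k : iter k X 0 = 0.
Proof. by elim: k => //= k ->; rewrite lfun_at0. Qed.

Lemma nilpotent_ker X U : nilpotent_end X -> invariant X U -> U != 0%VS ->
  exists u, [/\ u \in U, u != 0 & X u = 0].
Proof.
move=> [k Xk] XU U0.
have [u uU u0] : exists2 u, u \in U & u != 0.
  by exists (vpick U); rewrite ?memv_pick ?vpick0.
have ex : exists j, iter j X u == 0 by exists k; apply/eqP/Xk.
case: (ex_minnP ex) => -[|j] /eqP j0 jmin; first by case/eqP: u0.
exists (iter j X u); split => //; first exact: iter_invariant.
by apply/negP => /jmin; rewrite ltnn.
Qed.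

Lemma nilpotent_img_dim X U : nilpotent_end X -> invariant X U -> U != 0%VS ->
  (\dim (X @: U) < \dim U)%N.
Proof.
move=> nX XU U0; have [u [uU u0 Xu]] := nilpotent_ker nX XU U0.
rewrite -(limg_ker_dim X U) -[X in (X < _)%N]add0n ltn_add2r lt0n dimv_eq0.
apply: contraNneq u0 => e0; rewrite -memv0 -e0 memv_cap uU memv_ker.
exact/eqP.
Qed.

(** On the kernel of X the map N acts as - c, so this kernel is N-stable and, if non-zero, contains
    a vector killed by N; there X acts as c, which is non-zero. *)
Lemma nilpotent_add_injective X N c : c != 0 ->
  (forall v, X v = c *: v + N v) -> nilpotent_end N -> injective X.
Proof.
move=> c0 XE nN.
apply/lker0P; apply/negPn/negP => U0.
have NU : invariant N (lker X).
  apply/invariantP => u; rewrite !memv_ker => /eqP Xu.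
  have Nu : N u = - (c *: u) by apply/eqP; rewrite -addr_eq0 addrC -XE Xu.
  by rewrite Nu lfunN lfunZ Xu scaler0 oppr0.
have [u [uU u0 Nu]] := nilpotent_ker nN NU U0.
move: uU; rewrite memv_ker XE Nu addr0 scaler_eq0 (negPf c0) /=.
by apply/negP.
Qed.

(** For Z = S - lambda, the S-stable complement W of ker Z contains the image of Z. If that image is
    non-zero, N kills some non-zero u in it; along the Z-orbit of u the nilpotent X - lambda acts as
    Z, so the last non-zero iterate lies in ker Z and in W, a contradiction. *)
Lemma jordan_scalar X S N lambda : nilpotent_end (X - lambda *: \1%VF) ->
  jordan_decomposition X S N -> S = lambda *: \1%VF.
Proof.
move=> nX [XE ssS nN SN].
pose Z := S - lambda *: \1%VF.
have ZE v : Z v = S v - lambda *: v by rewrite !lfunsE.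
have SNv v : S (N v) = N (S v) by have /lfunP/(_ v) := SN; rewrite !comp_lfunE.
have ZS v : Z (S v) = S (Z v) by rewrite !ZE lfunB lfunZ.
have ZN v : Z (N v) = N (Z v) by rewrite !ZE lfunB lfunZ SNv.
have [|W [SW kW kW0]] := ssS (lker Z).
  apply/invariantP => u; rewrite !memv_ker => /eqP Zu.
  by rewrite ZS Zu lfun_at0.
have sub : (limg Z <= W)%VS.
  apply/subvP => _ /memv_imgP[v _ ->].
  have : v \in (lker Z + W)%VS by rewrite kW memvf.
  case/memv_addP => k; rewrite memv_ker => /eqP Zk [w wW ->].
  rewrite lfunD Zk add0r ZE; apply: memvB; last exact: memvZ.
  by move/invariantP: SW; apply.
have [/eqP U0|U0] := boolP (limg Z == 0%VS).
  apply/subr0_eq/lfunP => v; rewrite zero_lfunE; apply/eqP.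
  by rewrite -memv0 -U0 memv_img ?memvf.
have NU : invariant N (limg Z).
  by apply/invariantP => _ /memv_imgP[v _ ->]; rewrite -ZN memv_img ?memvf.
have [u [uU u0 Nu]] := nilpotent_ker nN NU U0.
have [k Xk] := nX.
have iterE j : iter j (X - lambda *: \1%VF)%R u = iter j Z u /\ N (iter j Z u) = 0.
  elim: j => [//|j [IH1 IH2]] /=; rewrite IH1 -ZN IH2 lfun_at0; split => //.
  by rewrite XE ZE !lfunsE IH2 addr0.
have ex : exists j, iter j Z u == 0 by exists k; rewrite -(iterE k).1; exact/eqP.
case: (ex_minnP ex) => -[|j] /eqP j0 jmin; first by case/eqP: u0.
have : iter j Z u \in (lker Z :&: W)%VS.
  rewrite memv_cap memv_ker; apply/andP; split; first exact/eqP.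
  apply: (subvP sub); case: (j) => [//|i] /=.
  by rewrite memv_img ?memvf.
by rewrite kW0 memv0 => /jmin; rewrite ltnn.
Qed.

Lemma ss_part_scalar X lambda :
  nilpotent_end (X - lambda *: \1%VF) -> ss_part X = lambda *: \1%VF.
Proof.
move=> nX; rewrite /ss_part; case: xgetP => [S _ [N]|/(_ (lambda *: \1%VF))].
  exact: jordan_scalar.
case; exists (X - lambda *: \1%VF); split => //.
- by rewrite addrC subrK.
- move=> U _; exists U^C%VS; split; rewrite ?addv_complf ?capv_compl //.
  by apply/invariantP => u uU; rewrite !lfunsE memvZ.
- by apply/lfunP => v; rewrite !lfunsE lfunZ scalerBr.
Qed.

End Nilpotent.

(** * Fitting decomposition and eigenvectors *)

Section Fitting.
Variables (K : fieldType) (V : vectType K).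
Implicit Types (X Y N : 'End(V)) (U W : {vspace V}).

Definition iter_lfun X k : 'End(V) := iter k (fun Y => X \o Y)%VF \1%VF.

Lemma iter_lfunE X k v : iter_lfun X k v = iter k X v.
Proof.
rewrite /iter_lfun; elim: k => [|k IH] /=; first by rewrite id_lfunE.
by rewrite comp_lfunE IH.
Qed.

(** The kernels of the powers of X grow and their dimensions are bounded; m is an exponent where the
    maximal dimension is reached. *)
Lemma ker_iter_stable X : exists m,
  forall j v, iter (m + j) X v = 0 -> iter m X v = 0.
Proof.
pose d k := \dim (lker (iter_lfun X k)).
have sub i j : (i <= j)%N ->
    (lker (iter_lfun X i) <= lker (iter_lfun X j))%VS.
  move=> ij; apply/subvP => v; rewrite !memv_ker !iter_lfunE => /eqP e.
  by rewrite -(subnK ij) iterD e lfun_iter0.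
have exd : exists n, `[< exists k, d k = n >] by exists (d 0%N); apply/asboolP; exists 0%N.
have bd n : `[< exists k, d k = n >] -> (n <= \dim {:V})%N.
  by move=> /asboolP[k <-]; apply: dimvS; exact: subvf.
have [n /asboolP[m dm] nmax] := ex_maxnP exd bd.
exists m => j v; rewrite -!iter_lfunE => e.
apply/eqP; rewrite -memv_ker.
suff /eqP -> : lker (iter_lfun X m) == lker (iter_lfun X (m + j)).
  by rewrite memv_ker e.
rewrite eqEdim sub ?leq_addr //= -/(d m) dm; apply: nmax.
by apply/asboolP; exists (m + j)%N.
Qed.

(** The exponent [m.+1] is positive, so the first summand contains every vector killed by X;
    [indecomposable_eigenvalue] relies on this. *)
Lemma fitting X : exists m,
  (lker (iter_lfun X m.+1) + limg (iter_lfun X m.+1) = fullv)%VS /\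
  (lker (iter_lfun X m.+1) :&: limg (iter_lfun X m.+1) = 0)%VS.
Proof.
have [m mP] := ker_iter_stable X; exists m.
have c0 : (lker (iter_lfun X m.+1) :&: limg (iter_lfun X m.+1) = 0)%VS.
  apply/eqP; rewrite -subv0; apply/subvP => v.
  rewrite memv_cap memv_ker => /andP[/eqP vk /memv_imgP[u _ uE]].
  move: vk; rewrite uE !iter_lfunE -iterD addSn -addnS => /mP e.
  by rewrite /= e lfun_at0 mem0v.
split => //; apply/eqP; rewrite eqEdim subvf /= dimv_disjoint_sum //.
by rewrite -[X in (X <= _)%N](limg_ker_dim (iter_lfun X m.+1)) capfv.
Qed.

End Fitting.

Lemma exists_eigenvector (K : numClosedFieldType) (V : vectType K) (X : 'End(V)) :
  (0 < \dim {:V})%N -> exists a v, v != 0 /\ X v = a *: v.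
Proof.
move=> V0; pose e := vbasis {:V}.
have eb : basis_of fullv e by exact: vbasisP.
pose vec (u : 'rV[K]_(\dim {:V})) := \sum_i u 0 i *: e`_i.
(* Row vectors are multiplied on the left of the matrix, so row i holds the coordinates of the image
   of the i-th basis vector, and [vec] turns a row eigenvector into an eigenvector of X. *)
have [a /eigenvalueP[u ue u0]] :=
  eigenvalue_closed (\matrix_(i, j) coord e j (X e`_i)) V0.
exists a, (vec u); split.
  apply: contra_neq u0; move/freeP: (basis_free eb) => fe /fe h.
  by apply/rowP => j; rewrite h mxE.
have XE i : X e`_i = \sum_j coord e j (X e`_i) *: e`_j.
  by rewrite -coord_vbasis ?memvf.
transitivity (vec (a *: u)); last first.
  by rewrite /vec scaler_sumr; apply: eq_bigr => i _; rewrite mxE scalerA.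
rewrite -ue /vec lfun_sum.
under eq_bigr => i _ do rewrite lfunZ XE scaler_sumr.
rewrite exchange_big; apply: eq_bigr => j _ /=.
rewrite mxE scaler_suml; apply: eq_bigr => i _.
by rewrite scalerA mxE.
Qed.

(** * Sums over the integers, generalized binomial coefficients *)

Section WindowSums.
Variable V : zmodType.
Implicit Type F : int -> V.

Lemma sum_int_widen F (a a' : int) (n n' : nat) :
  (forall i, i < a -> F i = 0) -> (forall i, a + n%:Z <= i -> F i = 0) ->
  a' <= a -> a + n%:Z <= a' + n'%:Z ->
  \sum_(i < n') F (a' + i%:Z) = \sum_(i < n) F (a + i%:Z).
Proof.
move=> Flo Fhi aa' hn.
have [d ad] : exists d : nat, a = a' + d%:Z by exists (absz (a - a')); lia.
have [e n'E] : exists e, n' = (d + n + e)%N by exists (n' - (d + n))%N; lia.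
rewrite n'E !big_split_ord /= big1 ?add0r => [|i _]; last by apply: Flo; have := ltn_ord i; lia.
rewrite [X in _ + X]big1 ?addr0 => [|i _]; last by apply: Fhi; lia.
by apply: eq_bigr => i _; rewrite ad PoszD addrA.
Qed.

(** The indices i and -1 - i for i < N together run over -N, ..., N - 1. This is the form in which
    the Borcherds identity at l = -1, m = 0 delivers a convolution. *)
Lemma sum_int_window F (a : int) (n N : nat) :
  (forall i, i < a -> F i = 0) -> (forall i, a + n%:Z <= i -> F i = 0) ->
  - N%:Z <= a -> a + n%:Z <= N%:Z ->
  \sum_(i < N) (F i%:Z + F (- 1 - i%:Z)) = \sum_(i < n) F (a + i%:Z).
Proof.
move=> Flo Fhi Na an.
rewrite -(@sum_int_widen F a (- N%:Z) n (N + N)%N) //; last by lia.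
rewrite big_split_ord /= big_split /= addrC; congr +%R.
  rewrite (reindex_inj rev_ord_inj); apply: eq_bigr => i _; congr F => /=.
  by have := ltn_ord i; lia.
by apply: eq_bigr => i _; congr F; lia.
Qed.

Lemma fsbig_nat_bound (F : nat -> V) N : (forall i, (N <= i)%N -> F i = 0) ->
  \sum_(i \in [set: nat]%classic) F i = \sum_(i < N) F i.
Proof.
move=> F0; rewrite fsbig_ord; apply/esym/fsbig_widen => // i [_ /= Ni].
by apply: F0; rewrite leqNgt; apply/negP.
Qed.

Lemma sum_pick (n : nat) (F : nat -> V) (j : nat) : (j < n)%N ->
  (forall i, (i < n)%N -> i != j -> F i = 0) -> \sum_(i < n) F i = F j.
Proof.
move=> jn F0; rewrite (bigD1 (Ordinal jn)) //= big1 ?addr0 // => i ij.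
exact: F0.
Qed.

Lemma sum_ord_trunc (F : nat -> V) m n : (m <= n)%N ->
  (forall i, (m <= i)%N -> F i = 0) -> \sum_(i < n) F i = \sum_(i < m) F i.
Proof.
move=> /subnKC <- F0; rewrite big_split_ord /= [X in _ + X]big1 ?addr0 // => i _.
by apply: F0; exact: leq_addr.
Qed.

End WindowSums.

Section Binomial.
Variable K : numFieldType.
Implicit Types (m l : int).
Local Notation binomz := (@binomz K).

Lemma natS_neq0 n : n.+1%:R != 0 :> K. Proof. by rewrite pnatr_eq0. Qed.
Lemma fact_neq0 n : n`!%:R != 0 :> K. Proof. by rewrite pnatr_eq0 -lt0n fact_gt0. Qed.

Lemma mulf_div_cancel (a x c f : K) : c != 0 -> a * x / (c * f) * c = a / f * x.
Proof.
move=> c0; rewrite invfM.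
transitivity (a * x * f^-1 * (c^-1 * c)); first by ring.
by rewrite mulVf //; ring.
Qed.

Lemma binomz0 m : binomz m 0 = 1.
Proof. by rewrite /Defs.binomz big_ord0 fact0 divr1. Qed.

Lemma binomz_recr m i : binomz m i.+1 * i.+1%:R = binomz m i * (m - i%:Z)%:~R.
Proof.
rewrite /Defs.binomz big_ord_recr /= factS natrM.
exact/mulf_div_cancel/natS_neq0.
Qed.

(** This and [binomz_shift] are two ways of trading the upper index for a linear factor;
    [borch_deriv] uses one for each of the two families of terms on the right of the Borcherds
    identity. *)
Lemma binomz_absorb m i :
  binomz (m + 1) i.+1 * i.+1%:R = (m + 1)%:~R * binomz m i.
Proof.
rewrite /Defs.binomz big_ord_recl subr0 factS natrM.
rewrite (eq_bigr (fun j : 'I_i => (m - j%:Z)%:~R)) => [|j _]; last first.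
  by congr (_%:~R); rewrite /= /bump /=; lia.
by rewrite [(m + 1)%:~R * \prod_(_ < _) _]mulrC mulf_div_cancel ?natS_neq0 // mulrC.
Qed.

Lemma binomz_pascal m i : binomz (m + 1) i.+1 = binomz m i.+1 + binomz m i.
Proof.
apply: (mulIf (natS_neq0 i)); rewrite binomz_absorb mulrDl binomz_recr.
by rewrite rmorphB rmorphD /= -!pmulrn -natr1; ring.
Qed.

Lemma binomz_shift m i :
  binomz (m + 1) i * (m + 1 - i%:Z)%:~R = (m + 1)%:~R * binomz m i.
Proof. by rewrite -binomz_recr binomz_absorb. Qed.

Lemma binomz_0S i : binomz 0 i.+1 = 0.
Proof. by rewrite /Defs.binomz big_ord_recl /= mul0r mul0r. Qed.

Lemma binomz_N1 i : binomz (-1) i * (-1) ^+ i = 1.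
Proof.
elim: i => [|i IH]; first by rewrite binomz0 mulr1.
apply: (mulIf (natS_neq0 i)); rewrite mulrAC binomz_recr mul1r exprS.
rewrite (_ : -1 - i%:Z = - i.+1%:Z); last by lia.
rewrite mulrNz -pmulrn.
transitivity (binomz (-1) i * (-1) ^+ i * i.+1%:R); first by ring.
by rewrite IH mul1r.
Qed.

Lemma binomz_N2 i : binomz (-2) i * (-1) ^+ i = i.+1%:R.
Proof.
have := binomz_shift (-2) i; rewrite (_ : -2 + 1 = -1) // => e.
have := binomz_N1 i; move: e.
rewrite (_ : -1 - i%:Z = - i.+1%:Z); last by lia.
rewrite !mulrNz -pmulrn mulrN mulNr mul1r => /oppr_inj <- e.
by rewrite mulrAC e mul1r.
Qed.

End Binomial.

(** * Modules as series-valued ring morphisms *)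

Section ModuleFacts.
Variables (K : numFieldType) (A : comAlgType K) (D : A -> A).
Variable M : vamodule D.
Local Notation Y := (Ycoef M).

(** The truncation axiom gives a bound for each vector; a finite basis makes it uniform. *)
Lemma Ycoef_bound u : exists n : nat, forall i, i < - n%:Z -> Y u i = 0.
Proof.
pose e := vbasis {:M}.
have /choice[L LP] : forall k : 'I_(\dim {:M}), exists L : int,
    forall i, i < L -> Y u i e`_k = 0.
  by move=> k; exact: Ycoef_trunc.
exists (\max_k absz (L k))%N => i iL; apply/lfunP => w.
have /coord_vbasis -> := memvf w.
rewrite zero_lfunE lfun_sum big1 // => k _; rewrite lfunZ LP ?scaler0 //.
have := @leq_bigmax _ (fun k => absz (L k)) k; move: iL.
by set m := (\max_k _)%N; lia.
Qed.

Lemma YcoefD u v i : Y (u + v) i = Y u i + Y v i.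
Proof. by have := Ycoef_linear M 1 u v i; rewrite !scale1r. Qed.

Lemma Ycoef0 i : Y 0 i = 0.
Proof. by apply: (@addIr _ (Y 0 i)); rewrite -YcoefD !add0r. Qed.

(** Borcherds identity at l = 0: the left side vanishes because u_i v = 0 for i >= 0, and only i = 0
    survives on the right, leaving a commutator. *)
Lemma Ycoef_comm u v i j w : Y u i (Y v j w) = Y v j (Y u i w).
Proof.
have := Ycoef_borcherds u v 0 (- i - 1) (- j - 1) w.
rewrite (@fsbig_nat_bound _ _ 0%N) => [|k _]; last first.
  by rewrite /= /mode Ycoef0 zero_lfunE scaler0.
rewrite (@fsbig_nat_bound _ _ 1%N) => [|[//|k] _]; last first.
  by rewrite binomz_0S mul0r scale0r.
rewrite big_ord0 big_ord1 binomz0 mulr1 scale1r /mode !add0r expr1z.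
rewrite !subr0 scaleN1r ?addr0.
rewrite (_ : - (- i - 1) - 1 = i); last by lia.
rewrite (_ : - (- j - 1) - 1 = j); last by lia.
by move/eqP; rewrite eq_sym subr_eq0 => /eqP.
Qed.

(** Borcherds identity at l = -1, m = 0, whose left side is a mode of u_{-1} v = uv. The right side
    is the convolution split into non-negative and negative exponents for u, with the operators of
    the second half in the opposite order, which [Ycoef_comm] repairs. *)
Lemma YcoefM u v (a b : int) (n : nat) k w :
  (forall i, i < a -> Y u i = 0) -> (forall i, i < b -> Y v i = 0) ->
  k < a + b + n%:Z ->
  Y (u * v) k w = \sum_(i < n) Y u (a + i%:Z) (Y v (k - a - i%:Z) w).
Proof.
move=> ua vb kn.
pose F i := Y u i (Y v (k - i) w).
have Flo i : i < a -> F i = 0 by move=> /ua; rewrite /F => ->; rewrite lfunsE.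
have Fhi i : a + n%:Z <= i -> F i = 0.
  by move=> ai; rewrite /F (vb (k - i)) ?lfunsE ?lfun_at0 //; lia.
pose N := addn (absz a) (absz (a + n%:Z)%R).
have := Ycoef_borcherds u v (-1) 0 (- k - 1) w.
rewrite (@fsbig_nat_bound _ _ 1%N) => [|[//|j] _]; last first.
  by rewrite binomz_0S scale0r.
rewrite big_ord1 binomz0 scale1r /= /mode add0r.
rewrite fact0 invr1 scale1r (_ : - _ - 1 = k); last by lia.
move=> ->; set G := (fun i : nat => _ *: (_ + _)).
have GE j : G j = F j%:Z + F (- 1 - j%:Z).
  rewrite /G binomz_N1 scale1r addNr expr0z scale1r.
  rewrite (_ : - (-1 + 0 - j%:Z) - 1 = j%:Z); last by lia.
  rewrite (_ : - (- k - 1 + j%:Z) - 1 = k - j%:Z); last by lia.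
  rewrite [X in _ + X]Ycoef_comm.
  rewrite (_ : - (-1 + (- k - 1) - j%:Z) - 1 = k - (- 1 - j%:Z)); last by lia.
  by rewrite (_ : - (0 + j%:Z) - 1 = - 1 - j%:Z); last by lia.
rewrite (@fsbig_nat_bound _ G N) => [|j Nj]; last first.
  by rewrite GE Fhi ?Flo ?addr0 //; lia.
rewrite (eq_bigr _ (fun (j : 'I_N) _ => GE j)).
rewrite (@sum_int_window _ F a n N) //; try lia.
by apply: eq_bigr => i _; rewrite /F opprD addrA.
Qed.

(** Borcherds identity at l = -2, m = 0, v = 1: the left side is a mode of u_{-2} 1 = D u, and on
    the right the series of the vacuum has a single non-zero coefficient, so at most one i
    contributes. *)
Lemma Ycoef_deriv u k : Y (D u) k = (k + 1)%:~R *: Y u (k + 1).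
Proof.
apply/lfunP => w; rewrite lfunsE.
have := @Ycoef_borcherds _ _ _ M u 1 (-2) 0 (- k - 1) w.
rewrite (@fsbig_nat_bound _ _ 1%N) => [|[//|j] _]; last first.
  by rewrite binomz_0S scale0r.
rewrite big_ord1 binomz0 scale1r /= /mode add0r (_ : 1`!%:R = 1 :> K) // invr1 scale1r mulr1.
rewrite (_ : - _ - 1 = k); last by lia.
move=> ->.
set F := (fun i : nat => _ *: (_ + _)).
(* The first value comes from the terms u_{-2-i} v_{n+i}, the second from v_{n-2-i} u_i, whose sign
   is (-1)^(l+1) = -1. For k >= 0 only the first occurs, for k <= -2 only the second, and for k = -1
   neither. *)
pose c (i : nat) : K :=
  if i%:Z == k then i.+1%:R else if i%:Z == - k - 2 then - i.+1%:R else 0.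
have FE i : F i = c i *: Y u (k + 1) w.
  rewrite /F /c binomz_N2 !Ycoef_vacuum.
  rewrite (_ : - (-2 + 0 - i%:Z) - 1 = i%:Z + 1); last by lia.
  rewrite (_ : - (- k - 1 + i%:Z) - 1 = k - i%:Z); last by lia.
  rewrite (_ : - (-2 + (- k - 1) - i%:Z) - 1 = k + 2 + i%:Z); last by lia.
  rewrite (_ : - (0 + i%:Z) - 1 = - i%:Z - 1); last by lia.
  have [ik|ik] := eqVneq i%:Z k.
    rewrite ik subrr eqxx lfunsE ifF; last by apply/eqP; lia.
    by rewrite lfunsE scaler0 addr0.
  rewrite [in X in X + _]ifF; last by apply/eqP; lia.
  rewrite lfunsE lfun_at0 add0r.
  have [ik'|ik'] := eqVneq i%:Z (- k - 2).
    rewrite ik' ifT; last by apply/eqP; lia.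
    rewrite lfunsE (_ : - (- k - 2) - 1 = k + 1); last by lia.
    by rewrite (_ : -2 + 1 = -1) // exprN1 invrN1 scaleN1r scalerN scaleNr.
  rewrite ifF; last by apply/eqP; lia.
  by rewrite lfunsE !scaler0 scale0r.
rewrite (@fsbig_nat_bound _ F (absz k + 2)) => [|i ki]; last first.
  rewrite FE /c ifF; last by apply/eqP; lia.
  by rewrite ifF ?scale0r //; apply/eqP; lia.
rewrite (eq_bigr _ (fun (j : 'I__) _ => FE j)).
rewrite -scaler_suml; congr (_ *: _).
have [k0|[k1|k1]] : 0 <= k \/ k = -1 \/ k <= -2 by lia.
- rewrite (@sum_pick _ _ c (absz k)) //; first 1 last.
  + by lia.
  + move=> i _ ik; rewrite /c ifF; last by apply/eqP; lia.
    by rewrite ifF //; apply/eqP; lia.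
  + rewrite /c ifT; last by apply/eqP; lia.
    by rewrite pmulrn; congr (_%:~R); lia.
- rewrite [in RHS]k1 big1 // => i _; rewrite /c ifF; last by apply/eqP; lia.
  by rewrite ifF //; apply/eqP; lia.
- rewrite (@sum_pick _ _ c (absz (- k - 2))) //; first 1 last.
  + by lia.
  + move=> i _ ik; rewrite /c ifF; last by apply/eqP; lia.
    by rewrite ifF //; apply/eqP; lia.
  + rewrite /c ifF; last by apply/eqP; lia.
    rewrite ifT; last by apply/eqP; lia.
    by rewrite pmulrn -mulrNz; congr (_%:~R); lia.
Qed.

End ModuleFacts.

(** * The Borcherds identity for a multiplicative family of commuting series *)

Section ModuleOfSeries.
Variables (K : numFieldType) (A : comAlgType K) (D : A -> A) (V : vectType K).
Variable Phi : A -> int -> 'End(V).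
Hypothesis PhiL : forall c u v i, Phi (c *: u + v) i = c *: Phi u i + Phi v i.
Hypothesis PhiC : forall u v i j w, Phi u i (Phi v j w) = Phi v j (Phi u i w).
Hypothesis PhiD : forall u k, Phi (D u) k = (k + 1)%:~R *: Phi u (k + 1).
Hypothesis PhiM : forall u v, exists m : nat,
  [/\ forall i, i < - m%:Z -> Phi u i = 0, forall i, i < - m%:Z -> Phi v i = 0 &
      forall k w (n : nat), k + m%:Z + m%:Z < n%:Z ->
      Phi (u * v) k w =
        \sum_(i < n) Phi u (i%:Z - m%:Z) (Phi v (k + m%:Z - i%:Z) w)].

Lemma pascal_sum (x : nat -> V) l N :
  \sum_(i < N.+1) binomz K (l + 1) i *: x i =
  \sum_(i < N.+1) binomz K l i *: x i + \sum_(i < N) binomz K l i *: x i.+1.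
Proof.
rewrite big_ord_recl [in RHS]big_ord_recl !binomz0 -addrA -big_split.
congr +%R; apply: eq_bigr => i _ /=.
by rewrite /bump /= add1n binomz_pascal scalerDl.
Qed.

Lemma series_map0 i : Phi 0 i = 0.
Proof.
by apply: (@addIr _ (Phi 0 i)); rewrite -{1}[Phi 0 i]scale1r -PhiL scale1r !add0r.
Qed.

Lemma series_mapZ c u i : Phi (c *: u) i = c *: Phi u i.
Proof.
by have := PhiL c u 0 i; rewrite !addr0 series_map0 addr0.
Qed.

Variables (v : A) (w : V).

Definition lhs_term u (l m n : int) (i : nat) : V :=
  binomz K m i *: mode Phi (va_mul D u (l + i%:Z) v) (m + n - i%:Z) w.

Definition rhs_term u (l m n : int) (i : nat) : V :=
  (binomz K l i * (-1) ^+ i) *: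
    (mode Phi u (l + m - i%:Z) (mode Phi v (n + i%:Z) w) +
     (-1) ^ (l + 1) *: mode Phi v (l + n - i%:Z) (mode Phi u (m + i%:Z) w)).

(* The Borcherds identity with both sums cut off at any large enough bound. *)
Definition borch (l m n : int) : Prop := forall u, exists N0, forall N,
  (N0 <= N)%N -> \sum_(i < N) lhs_term u l m n i = \sum_(i < N) rhs_term u l m n i.

(** Pascal's rule in m. Together with [rhs_rec] it shows that both sides obey B(l, m+1, n) = B(l, m,
    n+1) + B(l+1, m, n), the coefficient form of multiplication by x1 = x2 + x0 when l, m, n are the
    exponents of x0, x1, x2. *)
Lemma lhs_rec u l m n N : \sum_(i < N.+1) lhs_term u l (m + 1) n i =
  \sum_(i < N.+1) lhs_term u l m (n + 1) i + \sum_(i < N) lhs_term u (l + 1) m n i.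
Proof.
pose x (i : nat) := mode Phi (va_mul D u (l + i%:Z) v) (m + 1 + n - i%:Z) w.
rewrite -[LHS]/(\sum_(i < N.+1) binomz K (m + 1) i *: x i) pascal_sum.
congr +%R; apply: eq_bigr => i _; rewrite /lhs_term /x; congr (_ *: _).
  by rewrite (_ : m + 1 + n - i%:Z = m + (n + 1) - i%:Z) //; lia.
rewrite (_ : m + 1 + n - i.+1%:Z = m + n - i%:Z); last by lia.
by rewrite (_ : l + i.+1%:Z = l + 1 + i%:Z) //; lia.
Qed.

Lemma mode_eq0 u : exists B : nat, forall j, B%:Z <= j -> mode Phi u j = 0.
Proof.
have [m [um _ _]] := PhiM u u; exists m => j mj; rewrite /mode um //; lia.
Qed.

Lemma rhs_rec_aux (c e : K) (P Q R T : V) :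
  c *: (P + e *: Q) =
  c *: (R + e *: T) + (c *: (P - e *: T) - c *: (R - e *: Q)).
Proof.
rewrite -scalerBr -scalerDr; congr (_ *: _).
move: (e *: Q) (e *: T) => X Y.
rewrite opprB addrACA [R + _]addrC [Y + _]addrCA addrACA [R + _]addrCA.
by rewrite subrr addr0 addrAC subrK.
Qed.

(** On this side Pascal's rule is applied in l. The bound makes the last term of the shifted sum
    vanish, so that all three sums have the same length. *)
Lemma rhs_rec u l m n : exists N0, forall N, (N0 <= N)%N ->
  \sum_(i < N.+1) rhs_term u l (m + 1) n i =
  \sum_(i < N.+1) rhs_term u l m (n + 1) i + \sum_(i < N.+1) rhs_term u (l + 1) m n i.
Proof.
have [B1 B1P] := mode_eq0 u; have [B2 B2P] := mode_eq0 v.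
exists (B1 + B2 + absz m + absz n)%N => N NB.
pose x (i : nat) := (-1) ^+ i *:
    (mode Phi u (l + 1 + m - i%:Z) (mode Phi v (n + i%:Z) w) +
     (-1) ^ (l + 1 + 1) *: mode Phi v (l + 1 + n - i%:Z) (mode Phi u (m + i%:Z) w)).
have -> : \sum_(i < N.+1) rhs_term u (l + 1) m n i =
    \sum_(i < N.+1) binomz K (l + 1) i *: x i.
  by apply: eq_bigr => i _; rewrite /x scalerA.
rewrite pascal_sum.
have -> : \sum_(i < N) binomz K l i *: x i.+1 = \sum_(i < N.+1) binomz K l i *: x i.+1.
  rewrite big_ord_recr /= [x N.+1](_ : _ = 0) ?scaler0 ?addr0 // /x.
  rewrite (B2P (n + N.+1%:Z)); last by lia.
  rewrite (B1P (m + N.+1%:Z)); last by lia.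
  by rewrite !lfunsE !lfun_at0 scaler0 addr0 scaler0.
rewrite -!big_split; apply: eq_bigr => i _ /=.
rewrite /rhs_term /x.
rewrite (_ : l + (m + 1) - i%:Z = l + 1 + m - i%:Z); last by lia.
rewrite (_ : m + 1 + i%:Z = m + i.+1%:Z); last by lia.
rewrite (_ : l + (n + 1) - i%:Z = l + 1 + n - i%:Z); last by lia.
rewrite (_ : n + 1 + i%:Z = n + i.+1%:Z); last by lia.
rewrite (_ : l + 1 + n - i.+1%:Z = l + n - i%:Z); last by lia.
rewrite (_ : l + 1 + m - i.+1%:Z = l + m - i%:Z); last by lia.
have -> : (-1 : K) ^ (l + 1 + 1) = - (-1) ^ (l + 1).
  by rewrite expfzDr ?oppr_eq0 ?oner_eq0 // expr1z mulrN1.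
by rewrite exprS mulN1r !scaleNr scalerN !scalerA; exact: rhs_rec_aux.
Qed.

Lemma borch_0 m n : borch 0 m n.
Proof.
move=> u; exists 1%N => -[//|N] _.
rewrite [LHS]big1 => [|i _]; last first.
  by rewrite /lhs_term add0r /= /mode series_map0 lfunsE scaler0.
rewrite big_ord_recl /= [X in _ + X]big1 => [|i _]; last first.
  by rewrite /rhs_term binomz_0S mul0r scale0r.
rewrite /rhs_term binomz0 mulr1 scale1r !add0r expr1z !subr0 !addr0 scaleN1r.
by rewrite /mode PhiC subrr.
Qed.

Lemma lhs_sum u l n N :
  \sum_(i < N.+1) lhs_term u l 0 n i = mode Phi (va_mul D u l v) n w.
Proof.
rewrite big_ord_recl /= [X in _ + X]big1 => [|i _]; last first.
  by rewrite /lhs_term binomz_0S scale0r.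
by rewrite addr0 /lhs_term binomz0 scale1r addr0 subr0 add0r.
Qed.

Lemma borch_N1 n : borch (-1) 0 n.
Proof.
move=> u; have [m [um vm uvM]] := PhiM u v.
pose k := - n - 1.
pose F i := Phi u i (Phi v (k - i) w).
exists (m + m + absz k).+3 => -[//|N] NN.
rewrite lhs_sum /mode /= fact0 invr1 scale1r.
rewrite (_ : - _ - 1 = k); last by rewrite /k /=; lia.
rewrite (uvM k w (absz k + m + m).+1); last by lia.
rewrite (eq_bigr (fun i : 'I_N.+1 => F i%:Z + F (- 1 - i%:Z))) => [|i _]; last first.
  rewrite /rhs_term binomz_N1 scale1r addNr expr0z scale1r /mode.
  rewrite (_ : - (-1 + 0 - i%:Z) - 1 = i%:Z); last by lia.
  rewrite (_ : - (n + i%:Z) - 1 = k - i%:Z); last by rewrite /k; lia.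
  rewrite [X in _ + X]PhiC.
  rewrite (_ : - (-1 + n - i%:Z) - 1 = k - (- 1 - i%:Z)); last by rewrite /k; lia.
  by rewrite (_ : - (0 + i%:Z) - 1 = - 1 - i%:Z); last by lia.
rewrite (@sum_int_window _ F (- m%:Z) (absz k + m + m).+1).
- apply: eq_bigr => i _; rewrite /F (_ : - m%:Z + i%:Z = i%:Z - m%:Z); last by lia.
  by rewrite (_ : k - _ = k + m%:Z - i%:Z) //; lia.
- by move=> i im; rewrite /F um // lfunsE.
- by move=> i im; rewrite /F (vm (k - i)) ?lfunsE ?lfun_at0 //; lia.
- by lia.
- by lia.
Qed.

Lemma mode_deriv u j : mode Phi (D u) j = - j%:~R *: mode Phi u (j - 1).
Proof.
rewrite /mode PhiD (_ : - j - 1 + 1 = - j); last by lia.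
by rewrite mulrNz (_ : - (j - 1) - 1 = - j) //; lia.
Qed.

(** Since u_{-k-2} v is (D u)_{-k-1} v divided by k + 1, the hypothesis is applied to D u; this is
    why [borch] quantifies over u. Then (D u)_j = - j u_{j-1} turns it into the identity for u. *)
Lemma borch_deriv (k : nat) n : borch (Negz k) 0 n -> borch (Negz k.+1) 0 n.
Proof.
move=> B u; have [N1 N1P] := B (D u).
have [B1 B1P] := mode_eq0 u.
exists (N1 + B1).+2 => -[//|N] NN.
have k0 := natS_neq0 K k.
have := N1P N.+1; rewrite (leq_trans _ NN) => [/(_ isT)|]; last by lia.
rewrite !lhs_sum /= -iterSr -/(iter k.+1 D u) => e.
rewrite factS natrM invfM -scalerA /mode series_mapZ lfunsE -/(mode _ _ _) e.
have l1 : Negz k.+1 + 1 = Negz k by lia.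
pose l := Negz k.+1; rewrite -l1 -/l.
apply: (scalerI k0); rewrite scalerA mulfV // scale1r.
have kl : k.+1%:R = - (l + 1)%:~R :> K.
  by rewrite pmulrn -mulrNz; congr (_%:~R); rewrite /l; lia.
pose a (i : nat) := mode Phi u (l - i%:Z) (mode Phi v (n + i%:Z) w).
pose b (i : nat) := mode Phi v (l + n - i%:Z) (mode Phi u i%:Z w).
transitivity (\sum_(i < N.+1) (k.+1%:R * (binomz K l i * (-1) ^+ i)) *: a i +
    \sum_(i < N.+1) (k.+1%:R * (binomz K l i * (-1) ^+ i) * (-1) ^ (l + 1)) *: b i);
  last first.
  rewrite -big_split scaler_sumr; apply: eq_bigr => i _ /=.
  by rewrite /rhs_term addr0 add0r -/(a i) -/(b i) scalerA scalerDr scalerA.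
under eq_bigr => i _ do rewrite /rhs_term scalerDr.
rewrite big_split /=; congr +%R.
  apply: eq_bigr => i _; rewrite addr0 mode_deriv lfunsE !scalerA.
  rewrite (_ : l + 1 - i%:Z - 1 = l - i%:Z); last by lia.
  congr (_ *: _); rewrite kl mulrA mulNr -binomz_shift; ring.
(* The terms with (D u)_i applied first begin with a zero at i = 0, so their indices are shifted by
   one against those for u. *)
have Du0 : mode Phi (D u) 0 = 0 by rewrite mode_deriv mulr0z oppr0 scale0r.
rewrite big_ord_recl add0r Du0 lfunsE lfun_at0 !scaler0 add0r [RHS]big_ord_recr /=.
rewrite [b N](_ : _ = 0) ?scaler0 ?addr0; last first.
  by rewrite /b B1P ?lfunsE ?lfun_at0 //; lia.
apply: eq_bigr => i _; rewrite /bump /= add1n add0r mode_deriv lfunsE lfunZ !scalerA.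
rewrite (_ : l + 1 + n - i.+1%:Z = l + n - i%:Z); last by lia.
rewrite (_ : i.+1%:Z - 1 = i%:Z); last by lia.
congr (_ *: _); rewrite kl [in RHS]mulrA mulNr -binomz_absorb -pmulrn.
rewrite expfzDr ?oppr_eq0 ?oner_eq0 // expr1z exprS; ring.
Qed.

Lemma rhs_term_eq0 u l m n : exists N0, forall i, (N0 <= i)%N ->
  rhs_term u l m n i = 0.
Proof.
have [B1 B1P] := mode_eq0 u; have [B2 B2P] := mode_eq0 v.
exists (B1 + B2 + absz m + absz n)%N => i Ni; rewrite /rhs_term.
rewrite (B2P (n + i%:Z)); last by lia.
rewrite (B1P (m + i%:Z)); last by lia.
by rewrite !lfunsE !lfun_at0 scaler0 addr0 scaler0.
Qed.

Lemma borch_rec l m n u : exists N0, forall N, (N0 <= N)%N ->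
  let d l m n N := \sum_(i < N) lhs_term u l m n i - \sum_(i < N) rhs_term u l m n i in
  d l (m + 1) n N.+1 = d l m (n + 1) N.+1 + d (l + 1) m n N.
Proof.
have [N1 N1P] := rhs_rec u l m n; have [N2 N2P] := rhs_term_eq0 u (l + 1) m n.
exists (N1 + N2)%N => N NN d.
rewrite /d lhs_rec N1P; last by lia.
rewrite [\sum_(i < N.+1) rhs_term u (l + 1) m n i]big_ord_recr /= N2P; last by lia.
by rewrite addr0 opprD addrACA.
Qed.

(** By [borch_rec] any two of the instances (l, m+1, n), (l, m, n+1), (l+1, m, n) give the third.
    For l < 0 the case m = 0 spreads to all m in both directions once l + 1 is settled; for l > 0
    the instance follows from two instances at l - 1. *)
Lemma borch_all l m n : borch l m n.
Proof.
have zeroP l' m' n' : borch l' m' n' <-> (forall u, exists N0, forall N, (N0 <= N)%N ->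
    \sum_(i < N) lhs_term u l' m' n' i - \sum_(i < N) rhs_term u l' m' n' i = 0).
  split=> B u; have [N0 NP] := B u; exists N0 => N /NP; first by move=> ->; rewrite subrr.
  by move/subr0_eq.
have step l' m' n' :
    [/\ borch l' (m' + 1) n' -> borch l' m' (n' + 1) -> borch (l' + 1) m' n',
        borch l' m' (n' + 1) -> borch (l' + 1) m' n' -> borch l' (m' + 1) n' &
        borch l' (m' + 1) n' -> borch (l' + 1) m' n' -> borch l' m' (n' + 1)].
  split=> /zeroP B1 /zeroP B2; apply/zeroP => u; have [N1 N1P] := B1 u;
    have [N2 N2P] := B2 u; have [N3 N3P] := borch_rec l' m' n' u;
    exists (N1 + N2 + N3).+2 => -[//|N] NN.
  - move: (N3P N.+1) => /=; rewrite N1P ?N2P ?add0r; try lia.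
    by move=> h; rewrite -h //; lia.
  - by move: (N3P N) => /= ->; rewrite ?N1P ?N2P ?add0r //; lia.
  - move: (N3P N) => /=; rewrite N1P ?N2P ?addr0; try lia.
    by move=> h; rewrite -h //; lia.
have neg k : forall m' n', borch (Negz k) m' n'.
  have all0 (P : int -> int -> Prop) : (forall n', P 0 n') ->
      (forall m' n', P m' (n' + 1) -> P (m' + 1) n') ->
      (forall m' n', P (m' + 1) n' -> P m' (n' + 1)) -> forall m' n', P m' n'.
    move=> P0 Pup Pdn; elim=> [n'|j IH n'|j IH n'] //.
    - by rewrite -addn1 PoszD; apply/Pup/IH.
    - rewrite -[n'](subrK 1); apply: Pdn.
      by rewrite (_ : - j.+1%:Z + 1 = - j%:Z) //; lia.
  elim: k => [|k IH]; apply: all0 => m'.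
  - exact: borch_N1.
  - by move=> n' B; have [_ + _] := step (-1) m' n'; apply => //; exact: borch_0.
  - by move=> n' B; have [_ _] := step (-1) m' n'; apply => //; exact: borch_0.
  - exact/borch_deriv/IH.
  - move=> n' B; have [_ + _] := step (Negz k.+1) m' n'; apply => //.
    by rewrite (_ : Negz k.+1 + 1 = Negz k) //; lia.
  - move=> n' B; have [_ _] := step (Negz k.+1) m' n'; apply => //.
    by rewrite (_ : Negz k.+1 + 1 = Negz k) //; lia.
case: l => [l|//]; elim: l m n => [|l IH] m n; first exact: borch_0.
by rewrite -addn1 PoszD; have [+ _ _] := step l%:Z m n; apply; exact: IH.
Qed.

End ModuleOfSeries.

Section ModuleOfSeriesBuild.
Variables (K : numFieldType) (A : comAlgType K) (D : A -> A) (V : vectType K).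
Variable Phi : A -> int -> 'End(V).
Hypothesis PhiL : forall c u v i, Phi (c *: u + v) i = c *: Phi u i + Phi v i.
Hypothesis Phi1 : forall i, Phi 1 i = if i == 0 then \1%VF else 0.
Hypothesis PhiC : forall u v i j w, Phi u i (Phi v j w) = Phi v j (Phi u i w).
Hypothesis PhiD : forall u k, Phi (D u) k = (k + 1)%:~R *: Phi u (k + 1).
Hypothesis PhiM : forall u v, exists m : nat,
  [/\ forall i, i < - m%:Z -> Phi u i = 0, forall i, i < - m%:Z -> Phi v i = 0 &
      forall k w (n : nat), k + m%:Z + m%:Z < n%:Z ->
      Phi (u * v) k w =
        \sum_(i < n) Phi u (i%:Z - m%:Z) (Phi v (k + m%:Z - i%:Z) w)].

Lemma series_trunc (u : A) (w : V) : exists L, forall i, i < L -> Phi u i w = 0.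
Proof.
have [m [um _ _]] := PhiM u u; exists (- m%:Z) => i /um ->.
by rewrite lfunsE.
Qed.

Lemma series_borcherds (u v : A) (l m n : int) (w : V) :
  \sum_(i \in [set: nat]%classic)
    binomz K m i *: mode Phi (va_mul D u (l + i%:Z) v) (m + n - i%:Z) w =
  \sum_(i \in [set: nat]%classic)
    (binomz K l i * (-1) ^+ i) *:
      (mode Phi u (l + m - i%:Z) (mode Phi v (n + i%:Z) w) +
       (-1) ^ (l + 1) *:
         mode Phi v (l + n - i%:Z) (mode Phi u (m + i%:Z) w)).
Proof.
have [N1 N1P] := borch_all PhiL PhiC PhiD PhiM v w l m n u.
have [N2 N2P] := rhs_term_eq0 PhiM v w u l m n.
have N3P i : (absz l <= i)%N -> lhs_term D Phi v w u l m n i = 0.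
  move=> li; rewrite /lhs_term.
  have : 0 <= l + i%:Z by lia.
  by case: (l + i%:Z) => // k _; rewrite /= /mode (series_map0 PhiL) lfunsE scaler0.
pose N := (N1 + N2 + absz l)%N.
rewrite (@fsbig_nat_bound _ (lhs_term D Phi v w u l m n) N); last first.
  by move=> i Ni; apply: N3P; lia.
rewrite (@fsbig_nat_bound _ (rhs_term Phi v w u l m n) N); last first.
  by move=> i Ni; apply: N2P; lia.
by apply: N1P; lia.
Qed.

Definition module_of_series : vamodule D :=
  VAModule PhiL series_trunc Phi1 series_borcherds.

End ModuleOfSeriesBuild.

(** * The eigenvalues of an indecomposable module *)

Lemma scaler_injr (K : fieldType) (V : lmodType K) (v : V) (a b : K) :
  v != 0 -> a *: v = b *: v -> a = b.
Proof.
move=> v0 /eqP; rewrite -subr_eq0 -scalerBl scaler_eq0 (negPf v0) orbF subr_eq0.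
by move/eqP.
Qed.

Section Eigenvalues.
Variables (K : numClosedFieldType) (A : comAlgType K) (D : A -> A).
Variable M : vamodule D.
Local Notation Y := (Ycoef M).

(** The first clause identifies chi with the semisimple parts; the common eigenvector lets every
    identity between the operators be read as one between scalars. *)
Definition is_character (chi : A -> int -> K) : Prop :=
  (forall u i, nilpotent_end (Y u i - chi u i *: \1%VF)) /\
  exists v : M, v != 0 /\ forall u i, Y u i v = chi u i *: v.

(** Both Fitting components of X - a are submodules. The kernel contains an eigenvector, so
    indecomposability forces the other component to be 0. *)
Lemma indecomposable_eigenvalue (X : 'End(M)) :
  (forall u i w, Y u i (X w) = X (Y u i w)) ->
  indecomposable M -> (0 < vadim M)%N ->
  exists lambda, nilpotent_end (X - lambda *: \1%VF).
Proof.
move=> XY iM M0; have [a [v [v0 Xv]]] := exists_eigenvector X M0.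
exists a; set Z := X - _.
have ZE w : Z w = X w - a *: w by rewrite !lfunsE.
have ZY u i w : Y u i (Z w) = Z (Y u i w) by rewrite !ZE lfunB lfunZ XY.
have [m [kfull k0]] := fitting Z.
have ZmY u i w : Y u i (iter_lfun Z m.+1 w) = iter_lfun Z m.+1 (Y u i w).
  by rewrite !iter_lfunE; elim: (m.+1) => //= j <-; rewrite ZY.
have [||e|e] := iM _ _ _ _ kfull k0.
- move=> u i; apply/invariantP => w; rewrite !memv_ker -ZmY => /eqP ->.
  by rewrite lfun_at0.
- move=> u i; apply/invariantP => _ /memv_imgP[w _ ->].
  by rewrite ZmY memv_img ?memvf.
- have : iter_lfun Z m.+1 v == 0 -> v == 0 by rewrite -memv_ker e memv0.
  rewrite iter_lfunE iterSr ZE Xv subrr lfun_iter0 eqxx => /(_ isT).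
  by rewrite (negPf v0).
- exists m.+1 => w; rewrite -iter_lfunE; apply/eqP.
  by rewrite -memv0 -e memv_img ?memvf.
Qed.

Lemma character_exists : indecomposable M -> (0 < vadim M)%N ->
  exists chi, is_character chi.
Proof.
move=> iM M0.
have /choice[chi chiP] : forall p : A * int, exists lambda,
    nilpotent_end (Y p.1 p.2 - lambda *: \1%VF).
  by move=> p; apply: indecomposable_eigenvalue => // u i w; rewrite Ycoef_comm.
exists (fun u i => chi (u, i)); split=> [u i|]; first exact: (chiP (u, i)).
pose Z u i := Y u i - chi (u, i) *: \1%VF.
have ZE u i w : Z u i w = Y u i w - chi (u, i) *: w by rewrite !lfunsE.
have ZY u i u' i' w : Y u' i' (Z u i w) = Z u i (Y u' i' w).
  by rewrite !ZE lfunB lfunZ Ycoef_comm.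
(* If some [Z u i] does not vanish on U, its kernel in U is smaller, non-zero by nilpotency, and a
   submodule by commutativity. *)
have main d : forall U : {vspace M}, is_submodule U -> U != 0%VS -> (\dim U <= d)%N ->
    exists v, v != 0 /\ forall u i, Z u i v = 0.
  elim: d => [|d IH] U sU U0 dU.
    by move: dU; rewrite leqn0 dimv_eq0 (negPf U0).
  have [[u [i kU]]|h] := pselect (exists u i, ~~ (U <= lker (Z u i))%VS); last first.
    exists (vpick U); split; first by rewrite vpick0.
    move=> u i; apply/eqP; rewrite -memv_ker.
    apply: (subvP _ _ (memv_pick U)); apply: contra_notT h => h.
    by exists u, i.
  apply: (IH (U :&: lker (Z u i))%VS).
  - move=> u' i'; apply/invariantP => w; rewrite !memv_cap !memv_ker.
    move=> /andP[wU /eqP Zw]; rewrite -ZY Zw lfun_at0 eqxx andbT.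
    by have /invariantP := sU u' i'; apply.
  - have [||w [wU w0 Zw]] := nilpotent_ker (chiP (u, i)) (U := U) => //.
      apply/invariantP => w wU; rewrite -/(Z u i) ZE memvB ?memvZ //.
      by have /invariantP := sU u i; apply.
    apply: contraNneq w0 => e; rewrite -memv0 -e memv_cap wU memv_ker.
    exact/eqP.
  - rewrite -ltnS (leq_trans _ dU) // ltn_neqAle dimvS ?capvSl // andbT.
    apply: contra kU => /eqP e; apply/capv_idPl/eqP.
    by rewrite eqEdim capvSl e leqnn.
have [v [v0 Zv]] : exists v, v != 0 /\ forall u i, Z u i v = 0.
  apply: (main (\dim {:M}) fullv) => //; last by rewrite -dimv_eq0 -lt0n.
  by move=> u i; exact: subvf.
exists v; split => // u i; apply/eqP; rewrite -subr_eq0 -ZE.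
exact/eqP.
Qed.

Section Character.
Variable chi : A -> int -> K.
Hypothesis chiP : is_character chi.

Lemma ss_part_Ycoef u i : ss_part (Y u i) = chi u i *: \1%VF.
Proof. by apply: ss_part_scalar; exact: chiP.1. Qed.

Lemma character_bound u : exists n : nat, forall i, i < - n%:Z -> chi u i = 0.
Proof.
have [n nP] := Ycoef_bound M u; have [v [v0 vP]] := chiP.2.
exists n => i /nP Yui; have := vP u i; rewrite Yui lfunsE => /esym/eqP.
by rewrite scaler_eq0 (negPf v0) orbF => /eqP.
Qed.

Lemma characterZD c u u' i : chi (c *: u + u') i = c * chi u i + chi u' i.
Proof.
have [v [v0 vP]] := chiP.2.
apply: (scaler_injr v0); rewrite -vP Ycoef_linear !lfunsE !vP.
by rewrite scalerDl scalerA.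
Qed.

Lemma character1 i : chi 1 i = (i == 0)%:R.
Proof.
have [v [v0 vP]] := chiP.2.
apply: (scaler_injr v0); rewrite -vP Ycoef_vacuum.
by case: eqP => _; rewrite lfunsE ?scale1r ?scale0r.
Qed.

Lemma characterD u k : chi (D u) k = (k + 1)%:~R * chi u (k + 1).
Proof.
have [v [v0 vP]] := chiP.2.
by apply: (scaler_injr v0); rewrite -vP Ycoef_deriv lfunsE vP scalerA.
Qed.

Lemma characterM u u' (a b : int) (n : nat) k :
  (forall i, i < a -> chi u i = 0) -> (forall i, i < b -> chi u' i = 0) ->
  k < a + b + n%:Z ->
  chi (u * u') k = \sum_(i < n) chi u (a + i%:Z) * chi u' (k - a - i%:Z).
Proof.
move=> ua u'b kn; have [v [v0 vP]] := chiP.2.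
have [m mP] := Ycoef_bound M u; have [m' m'P] := Ycoef_bound M u'.
(* The bounds a and b hold for chi only, whereas [YcoefM] needs bounds for the operators, whose
   nilpotent parts may reach lower; hence the detour through a wider window. *)
pose c := (absz a + absz b + m)%N; pose d := (absz b + m')%N.
pose F i := chi u i * chi u' (k - i).
have -> : chi (u * u') k = \sum_(i < n + c + c + d) F (- c%:Z + i%:Z).
  apply: (scaler_injr v0); rewrite -vP.
  rewrite (@YcoefM _ _ _ M u u' (- c%:Z) (- d%:Z) (n + c + c + d)).
  - rewrite scaler_suml; apply: eq_bigr => i _.
    by rewrite vP lfunZ vP scalerA mulrC /F opprD opprK !addrA.
  - by move=> i ic; apply: mP; lia.
  - by move=> i ic; apply: m'P; lia.
  - by lia.
rewrite (@sum_int_widen _ F a (- c%:Z) n) //.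
- by apply: eq_bigr => i _; rewrite /F opprD addrA.
- by move=> i /ua; rewrite /F => ->; rewrite mul0r.
- by move=> i ai; rewrite /F (u'b (k - i)) ?mulr0 //; lia.
- by lia.
- by lia.
Qed.

(** Here c may be 0, so that [has_ldM] and [has_ldD] hold without side conditions; the latter really
    loses the leading term at m = 0. *)
Definition has_ld u (m : int) (c : K) : Prop :=
  (forall i, i < m -> chi u i = 0) /\ chi u m = c.

Lemma has_ldM u u' m m' c c' : has_ld u m c -> has_ld u' m' c' ->
  has_ld (u * u') (m + m') (c * c').
Proof.
move=> [um uc] [u'm u'c]; split=> [i im|].
  by rewrite (@characterM u u' m m' 0) ?big_ord0 ?addr0.
rewrite (@characterM u u' m m' 1) ?big_ord1 //; last by lia.
by rewrite addr0 subr0 addrAC subrr add0r uc u'c.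
Qed.

Lemma has_ldX u m c n : has_ld u m c -> has_ld (u ^+ n) (n%:Z * m) (c ^+ n).
Proof.
move=> um; elim: n => [|n IH].
  rewrite mul0r; split=> [i i0|]; rewrite character1 //.
  by case: eqP i0 => // ->.
rewrite !exprS (_ : n.+1%:Z * m = m + n%:Z * m); last by lia.
exact: has_ldM.
Qed.

Lemma has_ld_uniq u m m' c c' : c != 0 -> c' != 0 ->
  has_ld u m c -> has_ld u m' c' -> m = m' /\ c = c'.
Proof.
move=> c0 c'0 [um uc] [um' uc'].
have [mm'|mm'|e] := ltgtP m m'; last by rewrite e in uc *; rewrite -uc -uc'.
  by move: c0; rewrite -uc um' // eqxx.
by move: c'0; rewrite -uc' um // eqxx.
Qed.

Lemma has_ldD u m c : has_ld u m c -> has_ld (D u) (m - 1) (m%:~R * c).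
Proof.
move=> [um uc]; split=> [i im|]; rewrite characterD; last by rewrite subrK uc.
by rewrite um ?mulr0 //; lia.
Qed.

Lemma character_neq0 u u' : u * u' = 1 -> exists i, chi u i != 0.
Proof.
move=> uu'; apply: contrapT => h.
have u0 i : chi u i = 0 by apply/eqP/negPn/negP => ui; apply: h; exists i.
have [m mP] := character_bound u'.
have := @characterM u u' 0 (- m%:Z) m.+1 0; rewrite uu' character1 eqxx.
rewrite big1 => [e|i _]; last by rewrite u0 mul0r.
suff /eqP : (1 : K) = 0 by rewrite oner_eq0.
by apply: e => [i _|i im|] //; [exact: mP|lia].
Qed.

Lemma character_ld u u' : u * u' = 1 ->
  exists m c, c != 0 /\ has_ld u m c.
Proof.
move=> /character_neq0[i ui]; have [m mP] := character_bound u.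
have ex : exists n, chi u (n%:Z - m%:Z) != 0.
  exists (absz (i + m%:Z)); rewrite (_ : _ - m%:Z = i) //.
  have : ~~ (i < - m%:Z) by apply: contra ui => /mP ->.
  lia.
case: (ex_minnP ex) => n n0 nmin; exists (n%:Z - m%:Z), (chi u (n%:Z - m%:Z)).
split=> //; split=> // j jn.
have [/mP //|jm] := ltP j (- m%:Z).
apply/eqP/negPn/negP => j0.
have := nmin (absz (j + m%:Z)); rewrite (_ : _ - m%:Z = j); last by lia.
by move=> /(_ j0); lia.
Qed.

Section Generator.
Variable t : A.

Lemma has_ld_poly0 (h : {poly K}) :
  (forall i, i <= 0 -> chi t i = 0) -> has_ld (horner_alg t h) 0 h.[0].
Proof.
move=> t0; elim/poly_ind: h => [|h c [hlo h0]].
  rewrite rmorph0 horner0; have e i : chi 0 i = 0.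
    by have := characterZD (-1) 1 1 i; rewrite scaleN1r addNr mulN1r addNr.
  by split.
rewrite rmorphD rmorphM /= horner_algX horner_algC !hornerE.
have cE i : chi (horner_alg t h * t + c%:A) i =
    chi (horner_alg t h * t) i + c * chi 1 i.
  by rewrite addrC characterZD addrC.
have ht : has_ld (horner_alg t h * t) (0 + 0) (h.[0] * 0).
  by apply: has_ldM; [split|split=> [i i0|]; apply: t0; rewrite // ltW].
rewrite addr0 mulr0 in ht; split=> [i i0|]; rewrite cE character1.
  by rewrite ht.1 // (_ : (i == 0) = false) ?mulr0 ?addr0 //; apply/eqP; lia.
by rewrite ht.2 eqxx mulr1 ?mulr0 ?add0r.
Qed.

Lemma has_ld_poly (h : {poly K}) (L : int) tau :
  0 < L -> has_ld t L tau -> h != 0 -> exists a h1,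
  [/\ h1.[0] != 0, has_ld (horner_alg t h) (a%:Z * L) (h1.[0] * tau ^+ a) &
      h = h1 * 'X^a].
Proof.
move=> L0 tL h0; have [a [h1]] := multiplicity_XsubC h 0.
rewrite h0 subr0 /root => h1P hE; exists a, h1; split=> //.
rewrite hE rmorphM rmorphXn /= horner_algX -[_ * L]add0r; apply: has_ldM.
  by apply: has_ld_poly0 => i i0; apply: tL.1; lia.
exact: has_ldX.
Qed.

Variables P Q : {poly K}.
Hypotheses (P0 : P != 0) (Q0 : Q != 0) (PQ0 : (P.[0] != 0) || (Q.[0] != 0)).
Hypothesis Dt : D t * horner_alg t Q = horner_alg t P.

(** With a, b the orders of P, Q at 0, comparing orders in D(t) Q(t) = P(t) gives aL = L - 1 + bL.
    As a or b is 0, this forces L = 1 and a = b = 0, and the leading coefficients then give tau.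
    Characteristic 0 keeps the leading term of chi(D t) alive. *)
Lemma generator_ld (L : int) tau : 0 < L -> tau != 0 -> has_ld t L tau ->
  [/\ P.[0] != 0, Q.[0] != 0, L = 1 & tau = P.[0] / Q.[0]].
Proof.
move=> L0 tau0 tL.
have [a [P1 [P10 ldP PE]]] := has_ld_poly L0 tL P0.
have [b [Q1 [Q10 ldQ QE]]] := has_ld_poly L0 tL Q0.
have := has_ldM (has_ldD tL) ldQ; rewrite Dt => ldP'.
have L0' : L%:~R != 0 :> K by rewrite intr_eq0 gt_eqF.
have [||e1 e2] := has_ld_uniq _ _ ldP ldP'.
- by rewrite mulf_neq0 // expf_neq0.
- by rewrite !mulf_neq0 // expf_neq0.
have ab : (a == 0%N) || (b == 0%N).
  move: PQ0; rewrite PE QE !hornerM !hornerXn !mulf_eq0 !negb_or P10 Q10 /=.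
  by rewrite !expr0n; case: (a) (b) => [|a'] [|b']; rewrite ?eqxx.
have L1 : L = 1.
  have nL (n : nat) : 0 <= n%:Z * L by apply: mulr_ge0 => //; exact: ltW.
  have bL := nL b; case/orP: ab => /eqP z; rewrite z !mul0r in e1; first by lia.
  case: (a) e1 => [|a']; first by rewrite mul0r; lia.
  by rewrite -addn1 PoszD mulrDl mul1r; have := nL a'; lia.
have eab : a = b by rewrite L1 in e1; lia.
have a0 : a = 0%N by case/orP: ab => /eqP; rewrite eab.
move: e2 PE QE; rewrite -eab a0 !expr0 !mulr1 L1 mul1r => e2 -> ->.
by split => //; rewrite e2 mulfK.
Qed.

End Generator.
End Character.
End Eigenvalues.

(** * The generator has no negative powers *)

Section Regularity.
Variables (K : numClosedFieldType) (A : comAlgType K) (D : A -> A).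
Variable M : vamodule D.
Local Notation Y := (Ycoef M).
Variables (chi : A -> int -> K) (t : A) (P Q : {poly K}).
Hypothesis chiP : is_character M chi.
Hypothesis Dt : D t * horner_alg t Q = horner_alg t P.
Hypothesis Q0 : Q.[0] != 0.
Hypothesis t0 : forall i, i <= 0 -> chi t i = 0.

Let Z u i := Y u i - chi u i *: \1%VF.

Let ZE u i w : Z u i w = Y u i w - chi u i *: w.
Proof. by rewrite !lfunsE. Qed.

Let YE u i w : Y u i w = Z u i w + chi u i *: w.
Proof. by rewrite ZE subrK. Qed.

(* [U] is a submodule on whose proper submodules the coefficients of
   negative powers of x in Y(t) vanish; [Z g j] is nilpotent, so it maps [U]
   into one of them. *)
Section Step.
Variables (U : {vspace M}) (e : int).
Hypotheses (e0 : e < 0) (sU : is_submodule U).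
Hypothesis tZ : forall i g j u, i < 0 -> u \in U -> Y t i (Z g j u) = 0.
Hypothesis te : forall i u, i < e -> u \in U -> Y t i u = 0.

(** Two exponents whose sum is below e are either not both at least e, or both negative; in the
    second case one factor may be replaced by its nilpotent part [Z], whose values the other factor
    kills. This makes the conditions stable under products. *)
Let good f :=
  [/\ forall j u, j < e -> u \in U -> Y f j u = 0,
      forall j g i u, j < 0 -> u \in U -> Y f j (Z g i u) = 0 &
      forall j, j < 0 -> chi f j = 0].

Let goodM f g : good f -> good g -> good (f * g).
Proof.
move=> [f1 f2 f3] [g1 g2 g3].
have [m mP] := Ycoef_bound M f; have [m' m'P] := Ycoef_bound M g.
have YM k w := @YcoefM _ _ _ M f g (- m%:Z) (- m'%:Z) (absz k + m + m').+1 k w mP m'P.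
split=> [k u ke uU|k h i u k0 uU|k k0].
- rewrite YM ?big1 //; last by lia.
  move=> i _; set i1 := - m%:Z + i%:Z; set j1 := k - - m%:Z - i%:Z.
  have ij : i1 + j1 = k by rewrite /i1 /j1; lia.
  have [je|je] := ltP j1 e; first by rewrite (g1 _ _ je) ?lfun_at0.
  have [ie|ie] := ltP i1 e; first by rewrite Ycoef_comm (f1 _ _ ie) ?lfun_at0.
  rewrite (YE g) g3 ?scale0r ?addr0; last by lia.
  by apply: f2 => //; lia.
- rewrite YM ?big1 //; last by lia.
  move=> n _; set i1 := - m%:Z + n%:Z; set j1 := k - - m%:Z - n%:Z.
  have ij : i1 + j1 = k by rewrite /i1 /j1; lia.
  have [j0|j0] := ltP j1 0; first by rewrite g2 ?lfun_at0.
  by rewrite Ycoef_comm f2 ?lfun_at0 //; lia.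
- by rewrite (@characterM _ _ _ _ _ chiP f g 0 0 0) ?big_ord0 //; lia.
Qed.

Let good_poly (h : {poly K}) : good (horner_alg t h).
Proof.
have gt : good t by split => // j j0; apply: t0; rewrite ltW.
elim/poly_ind: h => [|h c gh].
  rewrite rmorph0; split=> [j u _ _|j g i u _ _|j _]; rewrite ?Ycoef0 ?lfunsE //.
  by have := characterZD chiP (-1) 1 1 j; rewrite scaleN1r addNr mulN1r addNr.
rewrite rmorphD rmorphM /= horner_algX horner_algC addrC.
have [h1 h2 h3] := goodM gh gt.
split=> [j u je uU|j g i u j0 uU|j j0].
- rewrite Ycoef_linear !lfunsE h1 // addr0 Ycoef_vacuum ifF ?lfunsE ?scaler0 //.
  by apply/eqP; lia.
- rewrite Ycoef_linear add_lfunE h2 // addr0 Ycoef_vacuum ifF ?lfunsE ?scaler0 //.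
  by apply/eqP; lia.
- rewrite (characterZD chiP) h3 // (character1 chiP) (_ : (j == 0) = false) ?mulr0 ?addr0 //.
  by apply/eqP; lia.
Qed.

(* The coefficient of x^(e-1) in Q(Y(t)) Y(t)' = P(Y(t)) acts on [U] as
   e Q(0) times that of x^e in Y(t) on the left, and as 0 on the right. *)
Lemma regular_step u : u \in U -> Y t e u = 0.
Proof.
move=> uU.
have [P1 _ _] := good_poly P; have [Q1 Q2 Q3] := good_poly Q.
have [m mP] := Ycoef_bound M (D t).
have [m' m'P] := Ycoef_bound M (horner_alg t Q).
have := P1 (e - 1) u; rewrite -Dt => /(_ _ uU) h.
have {h} := h ltac:(lia).
(* The window starts at or below e - 1, so it contains the exponent e - 1 of Y(D t), the one that
   meets the constant term of Q(Y(t)). *)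
pose c (n : nat) := Y (D t) (- (m + absz e)%N.+1%:Z + n%:Z)
  (Y (horner_alg t Q) (e - 1 - - (m + absz e)%N.+1%:Z - n%:Z) u).
rewrite (@YcoefM _ _ _ M (D t) (horner_alg t Q) (- (m + absz e)%N.+1%:Z) (- m'%:Z)
   (absz e + m + absz e + m').+3) //; first last.
- by lia.
- by move=> i im; apply: mP; lia.
rewrite (@sum_pick _ _ c (absz (e + (m + absz e)%N%:Z))); first last.
- move=> n _ ne; rewrite /c Ycoef_deriv lfunsE.
  set i1 := - _ + n%:Z; set j1 := e - 1 - _ - _.
  have ij : i1 + 1 = e - j1 by rewrite /i1 /j1; lia.
  have j0 : j1 != 0 by apply: contra ne => /eqP; rewrite /j1 => j0; apply/eqP; lia.
  rewrite ij; have [jpos|jneg] := ltP 0 j1.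
    by rewrite Ycoef_comm te ?lfun_at0 ?scaler0 //; lia.
  have [je|je] := ltP j1 e; first by rewrite Q1 ?lfun_at0 ?scaler0.
  rewrite (YE (horner_alg t Q)) Q3 ?scale0r ?addr0; last by lia.
  have [->|je'] := eqVneq j1 e; first by rewrite subrr scale0r.
  by rewrite tZ ?scaler0 //; lia.
- by lia.
rewrite /c Ycoef_deriv lfunsE.
rewrite (_ : - _ + _ + 1 = e); last by lia.
rewrite (_ : e - 1 - _ - _ = 0); last by lia.
rewrite YE lfunD tZ // add0r lfunZ (has_ld_poly0 chiP Q t0).2 scalerA.
move/eqP; rewrite scaler_eq0 mulf_eq0 (negPf Q0) orbF intr_eq0 lt_eqF //=.
by move/eqP.
Qed.

End Step.

(** The outer induction is on the dimension of a submodule U: [Z g k] maps U onto a smaller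
    submodule, which supplies the hypothesis [tZ] of [regular_step]. The inner one goes up in the
    exponent from the bound for Y(t) and supplies [te]. *)
Lemma regular_generator i : i < 0 -> Y t i = 0.
Proof.
have main d : forall U : {vspace M}, is_submodule U -> (\dim U <= d)%N ->
    forall i u, i < 0 -> u \in U -> Y t i u = 0.
  elim: d => [|d IH] U sU dU {}i u i0 uU.
    move: dU uU; rewrite leqn0 dimv_eq0 => /eqP ->.
    by rewrite memv0 => /eqP ->; rewrite lfun_at0.
  have [U0|U0] := eqVneq U 0%VS.
    by move: uU; rewrite U0 memv0 => /eqP ->; rewrite lfun_at0.
  have YU g j w : w \in U -> Y g j w \in U by have /invariantP := sU g j; apply.
  have tZ j g k w : j < 0 -> w \in U -> Y t j (Z g k w) = 0.
    move=> j0 wU; apply: (IH (Z g k @: U)%VS) => //; last exact: memv_img.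
      move=> g' k'; apply/invariantP => _ /memv_imgP[x xU ->].
      have -> : Y g' k' (Z g k x) = Z g k (Y g' k' x).
        by rewrite !ZE lfunB lfunZ Ycoef_comm.
      by rewrite memv_img // YU.
    rewrite -ltnS (leq_trans _ dU) //; apply: nilpotent_img_dim => //.
      exact: chiP.1.
    by apply/invariantP => x xU; rewrite -/(Z g k) ZE memvB ?memvZ ?YU.
  have [m mP] := Ycoef_bound M t.
  have up (k : nat) : forall j w, j < - m%:Z + k%:Z -> j < 0 -> w \in U -> Y t j w = 0.
    elim: k => [|k IHk] j w jk j0 wU; first by rewrite mP ?lfunsE //; lia.
    apply: (@regular_step U j) => // j' w' jj' w'U; apply: IHk => //; lia.
  by apply: (up (m + absz i).+1) => //; lia.
move=> i0; apply/lfunP => w; rewrite lfunsE.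
by apply: (main (\dim {:M}) fullv) => // [u j|]; [exact: subvf|exact: memvf].
Qed.

End Regularity.

(** * Intertwining operators *)

(** This is the combinatorial content of associativity of Cauchy products, as used in
    [intertwinesV], [ps_mulA] and [shift_opM]. *)
Lemma triangular_exchange (V : zmodType) (F : nat -> nat -> V) n :
  \sum_(i < n) \sum_(j < i.+1) F j (i - j)%N = \sum_(j < n) \sum_(i < n - j) F j i.
Proof.
elim: n => [|n IH]; first by rewrite !big_ord0.
rewrite big_ord_recr /= IH [RHS]big_ord_recr /= subSnn big_ord1.
rewrite (big_ord_recr n) /= subnn addrA -big_split; congr (_ + _).
by apply: eq_bigr => j _; rewrite /= subSn ?big_ord_recr //= ltnW.
Qed.

Section Intertwiners.
Variables (K : numFieldType) (A : comAlgType K) (D : A -> A).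
Variables (M N : vamodule D) (C : 'Hom(M, N)).

Definition intertwines (f : A) : Prop :=
  forall i w, C (Ycoef M f i w) = Ycoef N f i (C w).

Lemma intertwinesZD c f g :
  intertwines f -> intertwines g -> intertwines (c *: f + g).
Proof. by move=> If Ig i w; rewrite !Ycoef_linear !lfunsE lfunD lfunZ If Ig. Qed.

Lemma intertwines1 : intertwines 1.
Proof. by move=> i w; rewrite !Ycoef_vacuum; case: eqP; rewrite !lfunsE ?lfun_at0. Qed.

Lemma common_bound f : exists m : nat,
  (forall i, i < - m%:Z -> Ycoef M f i = 0) /\
  (forall i, i < - m%:Z -> Ycoef N f i = 0).
Proof.
have [m mP] := Ycoef_bound M f; have [m' m'P] := Ycoef_bound N f.
by exists (m + m')%N; split=> i im; [apply: mP|apply: m'P]; lia.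
Qed.

Lemma intertwinesM f g : intertwines f -> intertwines g -> intertwines (f * g).
Proof.
move=> If Ig i w.
have [m [mM mN]] := common_bound f; have [m' [m'M m'N]] := common_bound g.
have im : i < - m%:Z + - m'%:Z + (absz i + m + m').+1%:Z by lia.
rewrite (YcoefM _ mM m'M im) (YcoefM _ mN m'N im) lfun_sum.
by apply: eq_bigr => j _; rewrite If Ig.
Qed.

(* With C commuting to f: C g = (g f) (C g) = g (f (C g)) = g (C (f g)) = g C. *)
Lemma intertwinesV f g : f * g = 1 -> intertwines f -> intertwines g.
Proof.
move=> fg If k w.
have [a [aM aN]] := common_bound f; have [b [bM bN]] := common_bound g.
have [kb|kb] := ltP k (- b%:Z); first by rewrite bM // bN // !lfunsE lfun_at0.
have [k' kE] : exists k' : nat, k = - b%:Z + k'%:Z by exists (absz (k + b%:Z)); lia.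
(* [G], [F] and [c] below are the coefficients of Y(g), Y(f) and C Y(g), re-indexed from 0. Total
   index [n] then corresponds to x^k in the triple product, and index [s] to x^0 in the product of
   Y(f) and Y(g). *)
pose s := (a + b)%N; pose n := (k' + s)%N.
pose G (j : nat) := Ycoef N g (- b%:Z + j%:Z).
pose F (i : nat) := Ycoef N f (- a%:Z + i%:Z).
pose c (m : nat) := C (Ycoef M g (- b%:Z + m%:Z) w).
have := triangular_exchange (fun j i => G j (F i (c (n - j - i)%N))) n.+1.
have -> : \sum_(i < n.+1) \sum_(j < i.+1) G j (F (i - j)%N (c (n - j - (i - j))%N)) = c k'.
  pose H (i : nat) := Ycoef N (g * f) (- b%:Z + - a%:Z + i%:Z) (c (n - i)%N).
  transitivity (\sum_(i < n.+1) H i).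
    apply: eq_bigr => i _; rewrite /H (YcoefM (n := i.+1) _ bN aN); last by lia.
    apply: eq_bigr => j _; have := ltn_ord j; rewrite ltnS => ji.
    rewrite /G /F -subnDA subnKC //.
    by congr (Ycoef N g _ (Ycoef N f _ _)); lia.
  rewrite (@sum_pick _ _ H s) /n; first 1 last.
  - by rewrite ltnS leq_addl.
  - move=> i _ is_; rewrite /H mulrC fg Ycoef_vacuum ifF ?lfunsE //.
    by apply/eqP => e; case/eqP: is_; rewrite /s; lia.
  by rewrite /H mulrC fg Ycoef_vacuum ifT ?lfunsE ?addnK //; apply/eqP; rewrite /s; lia.
rewrite /c -kE => ->.
pose H (j : nat) := G j (C (Ycoef M (f * g) (- a%:Z + - b%:Z + (n - j)%N%:Z) w)).
transitivity (\sum_(j < n.+1) H j).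
  apply: eq_bigr => j _; have := ltn_ord j; rewrite ltnS => jn.
  rewrite /H -lfun_sum; congr (G _ _).
  rewrite (YcoefM (n := (n - j).+1) _ aM bM); last by lia.
  rewrite lfun_sum subSn //; apply: eq_bigr => i _; have := ltn_ord i; rewrite ltnS => ij.
  rewrite If /F; congr (Ycoef N f _ (C (Ycoef M g _ _))); lia.
rewrite (@sum_pick _ _ H k') /H; first 1 last.
- by rewrite ltnS leq_addr.
- move=> j jn jk; rewrite fg Ycoef_vacuum ifF ?lfunsE ?lfun_at0 //.
  by apply/eqP => e; case/eqP: jk; rewrite /n /s in e jn *; lia.
rewrite fg Ycoef_vacuum ifT ?lfunsE; first by rewrite /G -kE.
by apply/eqP; rewrite /n /s; lia.
Qed.

End Intertwiners.

Section RegularIntertwiners.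
Variables (K : numFieldType) (A : comAlgType K) (D : A -> A).
Variables (M N : vamodule D) (C : 'Hom(M, N)) (t : A) (P Q : {poly K}).
Hypothesis Dt : D t * horner_alg t Q = horner_alg t P.
Hypothesis t_gen : forall f, exists n d g,
  horner_alg t d * g = 1 /\ f = horner_alg t n * g.
Hypothesis regM : forall i, i < 0 -> Ycoef M t i = 0.
Hypothesis regN : forall i, i < 0 -> Ycoef N t i = 0.
Hypothesis Qinj : injective (Ycoef N (horner_alg t Q) 0).
Hypothesis C0 : forall w, C (Ycoef M t 0 w) = Ycoef N t 0 (C w).

Let good (k : nat) f :=
  [/\ forall i, i < 0 -> Ycoef M f i = 0, forall i, i < 0 -> Ycoef N f i = 0 &
      forall i w, i <= k%:Z -> C (Ycoef M f i w) = Ycoef N f i (C w)].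

Let goodM k f g : good k f -> good k g -> good k (f * g).
Proof.
move=> [fM fN fC] [gM gN gC].
have sM i w : Ycoef M (f * g) i w = \sum_(j < (absz i).+1 | (0 <= i))
    Ycoef M f j%:Z (Ycoef M g (i - j%:Z) w).
  have [i0|i0] := boolP (0 <= i); last first.
    by rewrite big_pred0_eq (YcoefM (n := 0) _ fM gM) ?big_ord0 //; lia.
  rewrite (YcoefM (n := (absz i).+1) _ fM gM); last by lia.
  by apply: eq_bigr => j _; rewrite add0r subr0.
have sN i w : Ycoef N (f * g) i w = \sum_(j < (absz i).+1 | (0 <= i))
    Ycoef N f j%:Z (Ycoef N g (i - j%:Z) w).
  have [i0|i0] := boolP (0 <= i); last first.
    by rewrite big_pred0_eq (YcoefM (n := 0) _ fN gN) ?big_ord0 //; lia.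
  rewrite (YcoefM (n := (absz i).+1) _ fN gN); last by lia.
  by apply: eq_bigr => j _; rewrite add0r subr0.
split=> [i i0|i i0|i w ik].
- by apply/lfunP => w; rewrite sM big_pred0 ?lfunsE // => j; apply/negP; lia.
- by apply/lfunP => w; rewrite sN big_pred0 ?lfunsE // => j; apply/negP; lia.
- rewrite sM sN lfun_sum; apply: eq_bigr => j i0.
  by have := ltn_ord j => ji; rewrite fC ?gC //; lia.
Qed.

Let good_poly k (h : {poly K}) : good k t -> good k (horner_alg t h).
Proof.
move=> gt; elim/poly_ind: h => [|h c gh].
  rewrite rmorph0; split=> [i _|i _|i w _]; rewrite ?Ycoef0 //.
  by rewrite !lfunsE lfun_at0.
rewrite rmorphD rmorphM /= horner_algX horner_algC addrC.
have [hM hN hC] := goodM gh gt; split=> [i i0|i i0|i w ik].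
- by rewrite Ycoef_linear hM // addr0 Ycoef_vacuum ifF ?scaler0 //; apply/eqP; lia.
- by rewrite Ycoef_linear hN // addr0 Ycoef_vacuum ifF ?scaler0 //; apply/eqP; lia.
- rewrite !Ycoef_linear !add_lfunE lfunD hC //; congr (_ + _).
  rewrite !scale_lfunE lfunZ !Ycoef_vacuum.
  by case: eqP => _; rewrite !lfunsE ?lfun_at0.
Qed.

(** In the coefficient of x^k of Q(Y(t)) Y(t)' = P(Y(t)), the coefficient of x^(k+1) in Y(t) occurs
    only next to the constant term of Q(Y(t)), with factor k + 1. All else involves coefficients up
    to degree k, already compatible with C, and [Qinj] cancels the constant term. *)
Lemma generator_intertwines : intertwines C t.
Proof.
have main k : good k t.
  elim: k => [|k IH]; split=> // i w ik.
    have [i0|i0] := ltP i 0; first by rewrite regM ?regN // !lfunsE lfun_at0.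
    by rewrite (_ : i = 0) //; lia.
  have [_ _ tC] := IH.
  have [ik'|ki] := lerP i k%:Z; first exact: tC.
  have -> : i = k%:Z + 1 by lia.
  have [PM PN PC] := good_poly P IH; have [QM QN QC] := good_poly Q IH.
  have DM j : j < 0 -> Ycoef M (D t) j = 0.
    move=> j0; rewrite Ycoef_deriv; have [->|j1] := eqVneq j (-1).
      by rewrite addNr scale0r.
    by rewrite regM ?scaler0 //; lia.
  have DN j : j < 0 -> Ycoef N (D t) j = 0.
    move=> j0; rewrite Ycoef_deriv; have [->|j1] := eqVneq j (-1).
      by rewrite addNr scale0r.
    by rewrite regN ?scaler0 //; lia.
  have := PC k%:Z w (lexx _); rewrite -Dt mulrC.
  have sum_recl (R : vamodule D) x : (forall j, j < 0 -> Ycoef R (horner_alg t Q) j = 0) ->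
      (forall j, j < 0 -> Ycoef R (D t) j = 0) ->
      Ycoef R (horner_alg t Q * D t) k%:Z x =
      Ycoef R (horner_alg t Q) 0 (Ycoef R (D t) k%:Z x) +
      \sum_(j < k) Ycoef R (horner_alg t Q) j.+1%:Z (Ycoef R (D t) (k%:Z - j.+1%:Z) x).
    move=> QR DR; rewrite (YcoefM (n := k.+1) _ QR DR); last by lia.
    rewrite big_ord_recl; congr (_ + _).
      by congr (Ycoef R _ _ (Ycoef R _ _ _)); rewrite /=; lia.
    apply: eq_bigr => j _.
    by congr (Ycoef R _ _ (Ycoef R _ _ _)); rewrite /= /bump /=; lia.
  rewrite !sum_recl // lfunD lfun_sum.
  rewrite (eq_bigr (fun j : 'I_k => Ycoef N (horner_alg t Q) j.+1%:Z
    (Ycoef N (D t) (k%:Z - j.+1%:Z) (C w)))); last first.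
    move=> j _; have := ltn_ord j => jk; rewrite QC; last by lia.
    by rewrite !Ycoef_deriv !scale_lfunE lfunZ tC //; lia.
  move/addIr; rewrite QC // => /Qinj.
  rewrite !Ycoef_deriv !scale_lfunE lfunZ; apply: scalerI.
  by rewrite intr_eq0; lia.
move=> i w; have [_ _ tC] := main (absz i); apply: tC; lia.
Qed.

Lemma all_intertwines f : intertwines C f.
Proof.
have poly_int h : intertwines C (horner_alg t h).
  elim/poly_ind: h => [|h c Ih].
    by rewrite rmorph0 => i w; rewrite !Ycoef0 !lfunsE lfun_at0.
  rewrite rmorphD rmorphM /= horner_algX horner_algC addrC.
  apply: intertwinesZD; first exact: intertwines1.
  by apply: intertwinesM => //; exact: generator_intertwines.
have [n [d [g [dg ->]]]] := t_gen f.
by apply: intertwinesM => //; apply: intertwinesV dg _.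
Qed.

End RegularIntertwiners.

(** * Splitting off a maximal Jordan chain *)

(* If T^r = 0 and phi(T^(r-1) v) <> 0, the span of v, Tv, ..., T^(r-1) v is
   complemented by the T-invariant space of the w with phi(T^j w) = 0 for all j. *)
Section JordanChain.
Variables (K : fieldType) (V : vectType K) (T : 'End(V)) (phi : 'Hom(V, K^o)).
Variable r : nat.

Definition functional_orbit (w : V) : 'rV[K]_r := \row_j phi (iter j T w).

Lemma iterT_linear j : linear (iter j T).
Proof. by move=> c u v; rewrite -!iter_lfunE lfunD lfunZ. Qed.

Lemma functional_orbit_linear : linear functional_orbit.
Proof. by move=> c u v; apply/rowP => j; rewrite !mxE iterT_linear lfunD lfunZ. Qed.

HB.instance Definition _ :=
  GRing.isLinear.Build K V 'rV[K]_r *:%R functional_orbit functional_orbit_linear.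

Lemma functional_orbitE w (j : 'I_r) :
  linfun functional_orbit w 0 j = phi (iter j T w).
Proof. by rewrite lfunE /= mxE. Qed.

Variable v : V.
Definition vector_orbit (c : 'rV[K]_r) : V := \sum_i c 0 i *: iter i T v.

Lemma vector_orbit_linear : linear vector_orbit.
Proof.
move=> a c d; rewrite /vector_orbit scaler_sumr -big_split.
by apply: eq_bigr => i _; rewrite !mxE scalerDl scalerA.
Qed.

HB.instance Definition _ :=
  GRing.isLinear.Build K 'rV[K]_r V *:%R vector_orbit vector_orbit_linear.

Hypothesis Tr : forall w, iter r T w = 0.
Hypothesis phiv : phi (iter r.-1 T v) != 0.

Lemma iter_ge_r j w : (r <= j)%N -> iter j T w = 0.
Proof. by move=> rj; rewrite -(subnK rj) iterD Tr lfun_iter0. Qed.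

Definition chain_space := limg (linfun vector_orbit).
Definition chain_compl := lker (linfun functional_orbit).

Lemma chain_complP w : w \in chain_compl -> forall j, phi (iter j T w) = 0.
Proof.
rewrite memv_ker lfunE => /eqP/rowP h j.
have [jr|rj] := ltnP j r; first by have := h (Ordinal jr); rewrite !mxE.
by rewrite iter_ge_r // lfun_at0.
Qed.

Lemma chain_complI w : (forall j, phi (iter j T w) = 0) -> w \in chain_compl.
Proof. by move=> h; rewrite memv_ker lfunE; apply/eqP/rowP => j; rewrite !mxE h. Qed.

(** The pairing has the matrix phi(T^(i+j) v), which is zero for i + j >= r and non-zero for i + j =
    r - 1, hence triangular up to order; the coefficients vanish one after the other for increasing
    i. *)
Lemma orbit_pairing_inj c : vector_orbit c \in chain_compl -> c = 0.
Proof.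
move=> /chain_complP h.
have z k : forall i : 'I_r, (i < k)%N -> c 0 i = 0.
  elim: k => // k IH i; rewrite ltnS leq_eqVlt => /orP[/eqP ik|]; last exact: IH.
  have := h (r.-1 - i)%N; rewrite -iter_lfunE lfun_sum lfun_sum /=.
  rewrite (bigD1 i) //= big1 ?addr0 => [|i' ii'].
    rewrite lfunZ lfunZ iter_lfunE -iterD subnK; last by have := ltn_ord i; lia.
    by move/eqP; rewrite scaler_eq0 (negPf phiv) orbF => /eqP.
  rewrite lfunZ lfunZ iter_lfunE -iterD.
  have [i'i|] := ltnP i' i; first by rewrite IH ?scale0r // -ik.
  rewrite leq_eqVlt => /orP[/eqP/val_inj e|i'i]; first by rewrite e eqxx in ii'.
  by rewrite iter_ge_r ?lfun_at0 ?scaler0 //; have := ltn_ord i; lia.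
by apply/rowP => i; rewrite mxE; apply: (z i.+1).
Qed.

Lemma chain_space_cap : (chain_space :&: chain_compl = 0)%VS.
Proof.
apply/eqP; rewrite -subv0; apply/subvP => _ /memv_capP[/memv_imgP[c _ ->]].
by rewrite lfunE /= => /orbit_pairing_inj ->; rewrite linear0 mem0v.
Qed.

Lemma chain_space_add : (chain_space + chain_compl = fullv)%VS.
Proof.
(* Being an injective endomorphism of K^r, [g] is onto, so the values of the functionals on w are
   also taken on some chain vector, and the difference lies in the complement. *)
pose g := (linfun functional_orbit \o linfun vector_orbit)%VF.
have g0 : lker g == 0%VS.
  rewrite -subv0; apply/subvP => c; rewrite memv_ker comp_lfunE -memv_ker lfunE.
  by move/orbit_pairing_inj ->; rewrite mem0v.
apply/eqP; rewrite eqEsubv subvf; apply/subvP => w _.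
have : linfun functional_orbit w \in limg g by rewrite lker0_limgf ?memvf.
case/memv_imgP => c _ e; rewrite -[w](subrK (linfun vector_orbit c)) addrC.
apply: memv_add; first by rewrite memv_img ?memvf.
by rewrite memv_ker lfunB e comp_lfunE subrr.
Qed.

Lemma chain_space_invariant : invariant T chain_space.
Proof.
apply/invariantP => _ /memv_imgP[c _ ->]; rewrite lfunE /= /vector_orbit lfun_sum.
apply: memv_suml => i _; rewrite lfunZ memvZ // -iterS.
have [ir|ri] := ltnP i.+1 r; last by rewrite iter_ge_r ?mem0v.
have -> : iter i.+1 T v = linfun vector_orbit (delta_mx 0 (Ordinal ir)).
  rewrite lfunE /= /vector_orbit (bigD1 (Ordinal ir)) //= big1 ?addr0 => [|j ji].
    by rewrite mxE !eqxx scale1r.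
  by rewrite mxE (negPf ji) andbF scale0r.
by rewrite memv_img ?memvf.
Qed.

Lemma chain_compl_invariant : invariant T chain_compl.
Proof.
apply/invariantP => w /chain_complP h; apply: chain_complI => j.
by rewrite -iterSr.
Qed.

Lemma chain_space_neq0 : (0 < r)%N -> chain_space != 0%VS.
Proof.
move=> r0; apply: contraNneq phiv => e.
have : linfun vector_orbit (delta_mx 0 (Ordinal r0)) \in chain_space by rewrite memv_img ?memvf.
rewrite e memv0 lfunE /= => /eqP h.
have /rowP/(_ (Ordinal r0)) : delta_mx 0 (Ordinal r0) = 0 :> 'rV[K]_r.
  by apply: orbit_pairing_inj; rewrite h mem0v.
by rewrite !mxE !eqxx => /eqP; rewrite oner_eq0.
Qed.

Lemma chain_space_dim : \dim chain_space = r.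
Proof.
have k0 : (fullv :&: lker (linfun vector_orbit) = 0)%VS.
  rewrite capfv; apply/eqP; rewrite -subv0; apply/subvP => c.
  rewrite memv_ker lfunE => /eqP /= e; rewrite memv0.
  by apply/eqP/orbit_pairing_inj; rewrite e mem0v.
by rewrite /chain_space limg_dim_eq // dimvf /= /dim /= mul1n.
Qed.

End JordanChain.

(** * Uniqueness *)

Section GeneratorCase.
Variables (K : numClosedFieldType) (A : comAlgType K) (D : A -> A).
Variables (t : A) (P Q : {poly K}).
Hypotheses (P0 : P != 0) (Q0 : Q != 0) (PQ0 : (P.[0] != 0) || (Q.[0] != 0)).
Hypothesis Dt : D t * horner_alg t Q = horner_alg t P.
Hypothesis t_gen : forall f, exists n d g,
  horner_alg t d * g = 1 /\ f = horner_alg t n * g.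

Definition positive_ld (M : vamodule D) : Prop :=
  [/\ (0 < vadim M)%N, indecomposable M &
    exists L, is_ld (ss_series (Ycoef M t)) L /\ 0 < L].

Lemma vadim_gt0 (M : vamodule D) : (0 < vadim M)%N -> exists w : M, w != 0.
Proof.
rewrite /vadim lt0n dimv_eq0 => M0; exists (vpick {:M}).
by rewrite vpick0.
Qed.

Lemma scalar_lfun_inj (M : vamodule D) (a b : K) : (0 < vadim M)%N ->
  a *: \1%VF = b *: \1%VF :> 'End(M) -> a = b.
Proof.
move=> /vadim_gt0[w w0] /lfunP/(_ w); rewrite !lfunsE; exact: scaler_injr.
Qed.

Lemma is_ld_character (M : vamodule D) chi f L c : (0 < vadim M)%N ->
  is_character M chi -> c != 0 ->
  (is_ld (ss_series (Ycoef M f)) L /\ ss_series (Ycoef M f) L = c *: \1%VF) <->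
  has_ld chi f L c.
Proof.
move=> M0 chiP c0; rewrite /is_ld /ss_series !(ss_part_Ycoef chiP).
have zE a : (a *: \1%VF == 0 :> 'End(M)) = (a == 0).
  apply/eqP/eqP => [|->]; last by rewrite scale0r.
  by rewrite -{1}[0](scale0r (\1%VF : 'End(M))) => /(scalar_lfun_inj M0).
split=> [[[_ lo] /(scalar_lfun_inj M0) hc]|[lo hc]].
  by split=> // i /lo /eqP; rewrite (ss_part_Ycoef chiP) zE => /eqP.
split; last by rewrite hc.
split; first by rewrite zE hc.
by move=> i /lo e; rewrite (ss_part_Ycoef chiP) e scale0r.
Qed.

Lemma positive_ldP M : positive_ld M -> exists chi,
  [/\ is_character M chi, has_ld chi t 1 (P.[0] / Q.[0]), P.[0] != 0, Q.[0] != 0 &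
      is_power_series (Ycoef M t)].
Proof.
move=> [M0 iM [L [ldL L0]]]; have [chi chiP] := character_exists iM M0.
exists chi.
have hL : has_ld chi t L (chi t L).
  split=> // i iL; have := ldL.2 i iL; rewrite /ss_series (ss_part_Ycoef chiP).
  by rewrite -{1}[0](scale0r (\1%VF : 'End(M))) => /(scalar_lfun_inj M0).
have c0 : chi t L != 0.
  apply: contraNneq ldL.1 => e; apply/eqP.
  by rewrite /ss_series (ss_part_Ycoef chiP) e scale0r.
have [P00 Q00 L1 cE] := generator_ld chiP P0 Q0 PQ0 Dt L0 c0 hL.
split=> //; first by rewrite -cE -L1.
apply: (regular_generator chiP Dt Q00) => i i0; apply: hL.1; lia.
Qed.

Lemma horner_alg_mode0_inj (M : vamodule D) chi :
  is_character M chi -> has_ld chi t 1 (P.[0] / Q.[0]) -> Q.[0] != 0 ->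
  injective (Ycoef M (horner_alg t Q) 0).
Proof.
move=> chiP ht Q00.
have t0 i : i <= 0 -> chi t i = 0 by move=> i0; apply: ht.1; lia.
apply: (nilpotent_add_injective (N := Ycoef M (horner_alg t Q) 0 -
  chi (horner_alg t Q) 0 *: \1%VF) Q00); last exact: chiP.1.
by move=> w; rewrite (has_ld_poly0 chiP Q t0).2 !lfunsE addrCA subrr addr0.
Qed.

(** The projection onto U along W commutes with T = Y(t)_0, hence with every coefficient by
    [all_intertwines], so its image is a submodule. This turns indecomposability of M into a
    statement about T alone. *)
Lemma invariant_submodule (M : vamodule D) (U W : {vspace M}) :
  positive_ld M -> invariant (Ycoef M t 0) U -> invariant (Ycoef M t 0) W ->
  (U + W = fullv)%VS -> (U :&: W = 0)%VS -> is_submodule U.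
Proof.
move=> /positive_ldP[chi [chiP ht P00 Q00 reg]] /invariantP TU /invariantP TW UW UW0 f i.
have WU0 : (W :&: U = 0)%VS by rewrite capvC.
have decomp w : w = daddv_pi U W w + daddv_pi W U w.
  by rewrite daddv_pi_add // UW memvf.
have piW w : w \in W -> daddv_pi U W w = 0.
  move=> wW; have := decomp w; rewrite (daddv_pi_id WU0 wW) => e.
  by apply/eqP; rewrite -(can_eq (addrK w)) -e add0r.
apply/invariantP => u uU.
have := @all_intertwines _ _ _ M M (daddv_pi U W) t P Q Dt t_gen reg reg
  (horner_alg_mode0_inj chiP ht Q00) _ f i u.
rewrite (daddv_pi_id UW0 uU) => <-; first exact: memv_pi.
move=> w; rewrite {1}[w]decomp !lfunD [X in _ + X]piW ?addr0; last first.
  exact/TW/memv_pi.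
by apply: daddv_pi_id => //; apply/TU/memv_pi.
Qed.

Lemma nilpotent_minimal (V : vectType K) (T : 'End(V)) : (exists w : V, w != 0) ->
  nilpotent_end T -> exists r v, [/\ (0 < r)%N, forall w, iter r T w = 0 & iter r.-1 T v != 0].
Proof.
move=> [w w0] nT.
have ex : exists k, `[< forall v, iter k T v = 0 >] by case: nT => k ?; exists k; apply/asboolP.
case: (ex_minnP ex) => -[|r] /asboolP rP rmin; first by case/eqP: w0; exact: (rP w).
exists r.+1; apply: contrapT => h.
suff : (r.+1 <= r)%N by rewrite ltnn.
apply: rmin; apply/asboolP => v; apply/eqP/negPn/negP => v0.
by apply: h; exists v.
Qed.

Lemma separating_functional (V : vectType K) (w : V) : w != 0 ->
  exists phi : 'Hom(V, K^o), phi w != 0.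
Proof.
move=> w0; apply: contrapT => h; case/eqP: w0.
rewrite (coord_vbasis (memvf w)) big1 // => i _.
have [e|e] := eqVneq (coord (vbasis fullv) i w) 0; first by rewrite e scale0r.
by case: h; exists (linfun (coord (vbasis fullv) i : V -> K^o)); rewrite lfunE.
Qed.

(** A Jordan chain of maximal length splits off for T, hence as a submodule, and so fills M. Its
    complement, the kernel of the functional orbit, is then 0: the functionals phi T^j are
    coordinates on M. *)
Lemma positive_ld_orbit M : positive_ld M -> exists phi : 'Hom(M, K^o),
  (forall w, iter (vadim M) (Ycoef M t 0) w = 0) /\
  lker (linfun (functional_orbit (Ycoef M t 0) phi (vadim M))) = 0%VS.
Proof.
move=> pM; have [chi [chiP ht P00 Q00 reg]] := positive_ldP pM.
have [M0 iM _] := pM.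
have nT : nilpotent_end (Ycoef M t 0).
  by have := chiP.1 t 0; rewrite ht.1 // scale0r subr0.
have [r [v [r0 Tr v0]]] := nilpotent_minimal (vadim_gt0 M0) nT.
have [phi phiv] := separating_functional v0.
have addE := chain_space_add Tr phiv; have capE := chain_space_cap Tr phiv.
have invU := chain_space_invariant v Tr.
have invW := chain_compl_invariant phi Tr.
have sU := invariant_submodule pM invU invW addE capE.
have sW : is_submodule (chain_compl (Ycoef M t 0) phi r).
  by apply: (invariant_submodule pM invW invU); rewrite ?[(chain_compl _ _ _ + _)%VS]addvC // capvC.
have [/eqP|W0] := iM _ _ sU sW addE capE.
  by rewrite (negPf (chain_space_neq0 Tr phiv r0)).
have rE : r = vadim M.
  by rewrite -(chain_space_dim Tr phiv) /vadim -addE W0 addv0.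
by exists phi; rewrite -rE.
Qed.

(** In the coordinates phi T^j the operator T shifts the entries, with 0 entering at the end, on
    both modules. The map matching coordinates is thus compatible with T, and [all_intertwines]
    extends this to all coefficients. *)
Lemma positive_ld_unique M N : vadim M = vadim N ->
  positive_ld M -> positive_ld N -> vaiso M N.
Proof.
move=> MN pM pN.
have [phi [Tn ker0]] := positive_ld_orbit pM.
have [phi' [Tn' ker0']] := positive_ld_orbit pN.
have [chi [chiP ht P00 Q00 reg]] := positive_ldP pM.
have [chi' [chi'P ht' _ _ reg']] := positive_ldP pN.
rewrite -MN in Tn' ker0'; set n := vadim M in Tn ker0 Tn' ker0'.
pose psi := linfun (functional_orbit (Ycoef M t 0) phi n).
pose psi' := linfun (functional_orbit (Ycoef N t 0) phi' n).
have full : limg psi = fullv.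
  apply/eqP; rewrite eqEdim subvf limg_dim_eq ?ker0 ?capv0 // dimvf /dim /= mul1n.
  by rewrite -/(vadim M).
have full' : limg psi' = fullv.
  apply/eqP; rewrite eqEdim subvf limg_dim_eq ?ker0' ?capv0 // dimvf /dim /= mul1n.
  by rewrite -/(vadim N) -MN.
have inj' : injective psi' by apply/lker0P; rewrite ker0'.
have inj : injective psi by apply/lker0P; rewrite ker0.
have [f fE] : exists f : 'Hom(M, N), forall w, psi' (f w) = psi w.
  exists (psi'^-1 \o psi)%VF => w.
  by rewrite comp_lfunE limg_lfunVK // full' memvf.
have [g gE] : exists g : 'Hom(N, M), forall w, psi (g w) = psi' w.
  exists (psi^-1 \o psi')%VF => w.
  by rewrite comp_lfunE limg_lfunVK // full memvf.
have T0 w : f (Ycoef M t 0 w) = Ycoef N t 0 (f w).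
  apply: inj'; rewrite fE; apply/rowP => j; rewrite !functional_orbitE -!iterSr.
  have [jn|nj] := ltnP j.+1 n; last by rewrite !(iter_ge_r (r := n)) // !lfun_at0.
  by have /rowP/(_ (Ordinal jn)) := fE w; rewrite !functional_orbitE => ->.
exists f; split.
  exists g => w; first by apply: inj; rewrite gE fE.
  by apply: inj'; rewrite fE gE.
move=> a i; apply/lfunP => w; rewrite !comp_lfunE.
exact: (all_intertwines Dt t_gen reg reg' (horner_alg_mode0_inj chi'P ht' Q00) T0).
Qed.

End GeneratorCase.

(** * Formal power series *)

(* An alias, so that the ring structure is not the pointwise one of functions. *)
Definition power_series (K : Type) : Type := nat -> K.

Section PowerSeriesZmod.
Variable K : zmodType.
Local Notation PS := (power_series K).
Implicit Types F G H : PS.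

HB.instance Definition _ := Choice.copy PS (nat -> K).

Lemma ps_addA : associative (fun F G k => F k + G k : K).
Proof. by move=> F G H; apply/funext => k; rewrite addrA. Qed.
Lemma ps_addC : commutative (fun F G k => F k + G k : K).
Proof. by move=> F G; apply/funext => k; rewrite addrC. Qed.
Lemma ps_add0 : left_id (fun=> 0) (fun F G k => F k + G k : K).
Proof. by move=> F; apply/funext => k; rewrite add0r. Qed.
Lemma ps_addN : left_inverse (fun=> 0) (fun F k => - F k) (fun F G k => F k + G k : K).
Proof. by move=> F; apply/funext => k; rewrite addNr. Qed.

HB.instance Definition _ := GRing.isZmodule.Build PS ps_addA ps_addC ps_add0 ps_addN.

Lemma coef_psD F G k : (F + G) k = F k + G k. Proof. by []. Qed.
Lemma coef_psN F k : (- F) k = - F k. Proof. by []. Qed.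
Lemma coef_ps_sum I (r : seq I) (p : pred I) (f : I -> PS) k :
  (\sum_(i <- r | p i) f i) k = \sum_(i <- r | p i) f i k.
Proof. by elim/big_rec2: _ => // i x y _ <-. Qed.

Lemma coef_psMn F n k : (F *+ n) k = F k *+ n.
Proof. by elim: n => // n IH; rewrite !mulrS coef_psD IH. Qed.

End PowerSeriesZmod.

Section PowerSeriesRing.
Variable K : comNzRingType.
Local Notation PS := (power_series K).
Implicit Types F G H : PS.

Definition ps_mul F G : PS := fun k => \sum_(i < k.+1) F i * G (k - i)%N.
Definition ps_one : PS := fun k => (k == 0)%N%:R.

Lemma ps_mulA : associative ps_mul.
Proof.
move=> F G H; apply/funext => k; rewrite /ps_mul.
under [RHS]eq_bigr => i _ do rewrite mulr_suml.
have := @triangular_exchange K (fun j i : nat => F j * G i * H (k - j - i)%N) k.+1.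
rewrite (eq_bigr (fun i : 'I_k.+1 =>
    \sum_(j < i.+1) F j * G (i - j)%N * H (k - i)%N)) => [->|i _]; last first.
  apply: eq_bigr => j _; have := ltn_ord j; rewrite ltnS => ji.
  by rewrite -subnDA subnKC.
apply: eq_bigr => j _; rewrite subSn; last by rewrite -ltnS.
by rewrite mulr_sumr; apply: eq_bigr => i _; rewrite mulrA.
Qed.

Lemma ps_mulC : commutative ps_mul.
Proof.
move=> F G; apply/funext => k; rewrite /ps_mul (reindex_inj rev_ord_inj) /=.
by apply: eq_bigr => i _; rewrite subSS mulrC subKn // -ltnS.
Qed.

Lemma ps_mul1 : left_id ps_one ps_mul.
Proof.
move=> F; apply/funext => k; rewrite /ps_mul big_ord_recl big1 => [|i _].
  by rewrite mul1r subn0 addr0.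
by rewrite mul0r.
Qed.

Lemma ps_mulDl : left_distributive ps_mul +%R.
Proof.
move=> F G H; apply/funext => k; rewrite coef_psD /ps_mul -big_split.
by apply: eq_bigr => i _; rewrite mulrDl.
Qed.

Lemma ps_one_neq0 : ps_one != 0.
Proof. by apply/eqP => /(congr1 (fun F : PS => F 0%N)) /eqP; rewrite oner_eq0. Qed.

HB.instance Definition _ := GRing.Zmodule_isComNzRing.Build PS
  ps_mulA ps_mulC ps_mul1 ps_mulDl ps_one_neq0.

Lemma coef_psM F G k : (F * G) k = \sum_(i < k.+1) F i * G (k - i)%N.
Proof. by []. Qed.
Lemma coef_ps1 k : (1 : PS) k = (k == 0)%N%:R. Proof. by []. Qed.

Lemma coef_ps_exp F n : F 0%N = 0 ->
  (forall k, (k < n)%N -> (F ^+ n) k = 0) /\ (F ^+ n) n = F 1%N ^+ n.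
Proof.
move=> F0; elim: n => [|n [IH1 IH2]]; first by [].
split=> [k kn|]; rewrite exprS coef_psM big_ord_recl F0 mul0r add0r.
  apply: big1 => i _; rewrite IH1 ?mulr0 //= /bump /=.
  by have := ltn_ord i; lia.
rewrite big_ord_recl big1 => [|i _]; first by rewrite addr0 /= subSS subn0 IH2 exprS.
by rewrite IH1 ?mulr0 //= /bump /=; have := ltn_ord i; lia.
Qed.

Definition ps_X : PS := fun k => (k == 1)%N%:R.

Lemma coef_psXM F k : (ps_X * F) k = if k is k'.+1 then F k' else 0.
Proof.
rewrite coef_psM; case: k => [|k]; first by rewrite big_ord1 mul0r.
rewrite !big_ord_recl big1 => [|i _]; last by rewrite mul0r.
by rewrite mul0r mul1r add0r addr0 subn1.
Qed.

Definition ps_deriv F : PS := fun k => F k.+1 *+ k.+1.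

Lemma ps_derivM F G : ps_deriv (F * G) = ps_deriv F * G + F * ps_deriv G.
Proof.
apply/funext => k; rewrite coef_psD !coef_psM /ps_deriv coef_psM -sumrMnl.
rewrite (eq_bigr (fun i : 'I_k.+2 => F i * G (k.+1 - i)%N *+ i +
    F i * G (k.+1 - i)%N *+ (k.+1 - i))) => [|i _]; last first.
  by rewrite -mulrnDr subnKC // -ltnS.
rewrite big_split /= big_ord_recl mulr0n add0r; congr (_ + _).
  by apply: eq_bigr => i _; rewrite /= /bump /= subSS mulrnAl.
rewrite big_ord_recr /= subnn mulr0n addr0; apply: eq_bigr => i _.
by rewrite mulrnAr subSn // -ltnS.
Qed.

Lemma ps_derivX F n : ps_deriv (F ^+ n.+1) = F ^+ n * ps_deriv F *+ n.+1.
Proof.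
elim: n => [|n IH]; first by rewrite expr0 mul1r expr1.
rewrite exprS ps_derivM IH mulrnAr mulrA -exprS mulrC [in RHS]mulrS.
by rewrite mulrC [in X in X + _]mulrC.
Qed.

Lemma ps_derivXX : ps_deriv ps_X = 1.
Proof.
by apply/funext => -[|k]; rewrite /ps_deriv /ps_X coef_ps1 ?mulr1n //= mul0rn.
Qed.

End PowerSeriesRing.

Lemma ps_unit (K : fieldType) (F : power_series K) : F 0%N != 0 ->
  exists G, F * G = 1.
Proof.
move=> F0; pose c : power_series K := fun k => if k is 0%N then (F 0%N)^-1 else 0.
have cM G k : (c * G) k = (F 0%N)^-1 * G k.
  rewrite coef_psM big_ord_recl big1 => [|i _]; last by rewrite mul0r.
  by rewrite addr0 subn0.
pose h := 1 - c * F.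
have h0 : h 0%N = 0 by rewrite /h coef_psD coef_psN cM mulVf // coef_ps1 subrr.
have [hn _] : (forall n k, (k < n)%N -> (h ^+ n) k = 0) /\ True.
  by split=> // n; have [] := coef_ps_exp n h0.
(* The geometric series of h, of which only k + 1 terms contribute to x^k. *)
pose G : power_series K := fun k => (\sum_(m < k.+1) h ^+ m) k.
have GE n k : (k < n)%N -> G k = (\sum_(m < n) h ^+ m) k.
  move=> kn; rewrite /G !coef_ps_sum -(subnKC kn) big_split_ord /=.
  by rewrite [X in _ = _ + X]big1 ?addr0 // => i _; rewrite hn // ltn_addr.
exists (c * G); apply/funext => k.
rewrite mulrCA mulrA [c * F](_ : _ = 1 - h); last by rewrite /h opprB addrC subrK.
have -> : ((1 - h) * G) k = ((1 - h) * \sum_(m < k.+1) h ^+ m) k.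
  rewrite !coef_psM; apply: eq_bigr => i _; congr (_ * _); apply: GE.
  by rewrite ltnS leq_subr.
by rewrite -opprB mulNr -subrX1 opprB coef_psD coef_psN hn // subr0.
Qed.

(** * The character attached to a generator *)

Section LocalRing.
Variables (K : numFieldType) (A : comAlgType K) (D : A -> A) (t : A).
Hypothesis DL : forall c u v, D (c *: u + v) = c *: D u + D v.
Hypothesis DM : forall u v, D (u * v) = D u * v + u * D v.
Hypothesis t_trans : forall h, horner_alg t h = 0 -> h = 0.
Hypothesis t_gen : forall f, exists n d g,
  horner_alg t d * g = 1 /\ f = horner_alg t n * g.
Variables P Q : {poly K}.
Hypothesis Dt : D t * horner_alg t Q = horner_alg t P.
Hypotheses (P0 : P.[0] != 0) (Q0 : Q.[0] != 0).

Lemma derD u v : D (u + v) = D u + D v.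
Proof. by have := DL 1 u v; rewrite !scale1r. Qed.

Lemma der0 : D 0 = 0.
Proof. by apply: (@addIr _ (D 0)); rewrite -derD !add0r. Qed.

Lemma derZ c u : D (c *: u) = c *: D u.
Proof. by have := DL c u 0; rewrite der0 !addr0. Qed.

Lemma der1 : D 1 = 0.
Proof. by apply: (@addIr _ (D 1)); have := DM 1 1; rewrite !mulr1 mul1r add0r. Qed.

Lemma der_sum I (r : seq I) (p : pred I) (f : I -> A) :
  D (\sum_(i <- r | p i) f i) = \sum_(i <- r | p i) D (f i).
Proof. by elim/big_rec2: _ => [|i x y _ <-]; rewrite ?der0 ?derD. Qed.

Lemma derMn u n : D (u *+ n) = D u *+ n.
Proof. by elim: n => [|n IH]; rewrite ?der0 // !mulrS derD IH. Qed.

Lemma der_poly h : D (horner_alg t h) = horner_alg t h^`() * D t.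
Proof.
elim/poly_ind: h => [|h c IH]; first by rewrite deriv0 rmorph0 der0 mul0r.
rewrite derivD derivC addr0 derivM derivX mulr1 !rmorphD !rmorphM /=.
rewrite horner_algX horner_algC derD derZ der1 scaler0 addr0 DM IH mulrDl.
by rewrite mulrAC.
Qed.

Lemma derX u n : D (u ^+ n) = u ^+ n.-1 * D u *+ n.
Proof.
elim: n => [|n IH]; first by rewrite expr0 der1.
rewrite exprS DM IH /= mulrnAr mulrA -[D u * _]mulrC.
by case: n {IH} => [|n]; rewrite ?mulr0n ?addr0 // -exprS [in RHS]mulrS.
Qed.

Lemma der_leibniz n u v : iter n D (u * v) =
  \sum_(i < n.+1) (iter i D u * iter (n - i) D v) *+ 'C(n, i).
Proof.
elim: n => [|n IH]; first by rewrite big_ord1 bin0 mulr1n.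
rewrite iterS IH der_sum.
pose a (i : nat) := iter i D u * iter (n.+1 - i) D v.
rewrite (eq_bigr (fun i : 'I_n.+1 => a i.+1 *+ 'C(n, i) + a i *+ 'C(n, i))); last first.
  move=> i _; rewrite derMn DM mulrnDl -!iterS /a subSS -subSn //.
  by rewrite -ltnS.
rewrite -[RHS]/(\sum_(i < n.+2) a i *+ 'C(n.+1, i)) big_split /= addrC.
have e : \sum_(i < n.+2) a i *+ 'C(n, i) = \sum_(i < n.+1) a i *+ 'C(n, i).
  by rewrite big_ord_recr /= bin_small // mulr0n addr0.
rewrite -e big_ord_recl [RHS]big_ord_recl !bin0 -addrA -big_split /=; congr (_ + _).
by apply: eq_bigr => i _; rewrite /= /bump /= add1n binS mulrnDr.
Qed.

Definition local_at (f : A) : Prop := exists n d : {poly K},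
  d.[0] != 0 /\ f * horner_alg t d = horner_alg t n.

(* The value of [f] at t = 0, and 0 when [f] is not in the local ring there. *)
Definition ev (f : A) : K := xget 0 [set c | exists n d : {poly K},
  [/\ d.[0] != 0, f * horner_alg t d = horner_alg t n & c = n.[0] / d.[0]]]%classic.

(** Two representations of f have equal cross products because t is transcendental, so the value
    does not depend on the choice made by [xget]. *)
Lemma evE f n d : d.[0] != 0 -> f * horner_alg t d = horner_alg t n ->
  ev f = n.[0] / d.[0].
Proof.
move=> d0 fd; rewrite /ev; case: xgetP => [c _ [n' [d' [d'0 fd' ->]]]|/(_ (n.[0] / d.[0]))].
  have e : n * d' = n' * d.
    apply/eqP; rewrite -subr_eq0; apply/eqP/t_trans.
    by rewrite rmorphB !rmorphM /= -fd -fd' mulrAC subrr.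
  by apply/eqP; rewrite eqr_div // -!hornerM e.
by case; exists n, d.
Qed.

Lemma local_poly h : local_at (horner_alg t h) /\ ev (horner_alg t h) = h.[0].
Proof.
have e : horner_alg t h * horner_alg t 1 = horner_alg t h by rewrite rmorph1 mulr1.
have h1 : (1 : {poly K}).[0] != 0 by rewrite hornerE oner_eq0.
by split; [exists h, 1|rewrite (evE h1 e) hornerE divr1].
Qed.

Lemma local1 : local_at 1 /\ ev 1 = 1.
Proof. by have := local_poly 1; rewrite rmorph1 hornerE. Qed.

Lemma localZD c f g : local_at f -> local_at g ->
  local_at (c *: f + g) /\ ev (c *: f + g) = c * ev f + ev g.
Proof.
move=> [n [d [d0 fd]]] [n' [d' [d'0 gd']]].
have e : (c *: f + g) * horner_alg t (d * d') = horner_alg t (c%:P * (n * d') + n' * d).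
  rewrite rmorphD !rmorphM /= horner_algC -fd -gd' mulr_algl mulrDl -scalerAl.
  by congr (_ *: _ + _); ring.
have dd : (d * d').[0] != 0 by rewrite hornerM mulf_neq0.
split; first by do 2!eexists; split; eassumption.
rewrite (evE dd e) (evE d0 fd) (evE d'0 gd') hornerD !hornerM hornerC.
by rewrite [c * (_ / _)]mulrA addf_div // !mulrA.
Qed.

Lemma localM f g : local_at f -> local_at g ->
  local_at (f * g) /\ ev (f * g) = ev f * ev g.
Proof.
move=> [n [d [d0 fd]]] [n' [d' [d'0 gd']]].
have e : (f * g) * horner_alg t (d * d') = horner_alg t (n * n').
  by rewrite !rmorphM /= -fd -gd'; ring.
have dd : (d * d').[0] != 0 by rewrite hornerM mulf_neq0.
split; first by do 2!eexists; split; eassumption.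
by rewrite (evE dd e) (evE d0 fd) (evE d'0 gd') !hornerM mulf_div.
Qed.

(** By the quotient rule D f has the denominator d^2 Q, and Q(0) != 0 keeps it non-zero at t = 0. *)
Lemma local_der f : local_at f -> local_at (D f).
Proof.
move=> [n [d [d0 fd]]]; exists ((n^`() * d - n * d^`()) * P), (d ^+ 2 * Q).
split; first by rewrite !hornerE mulf_neq0 ?expf_neq0.
have := congr1 D fd; rewrite DM !der_poly => e.
rewrite !(rmorphM, rmorphB, rmorphXn) /= -Dt -fd.
have -> : D f * (horner_alg t d ^+ 2 * horner_alg t Q) =
   (D f * horner_alg t d) * (horner_alg t d * horner_alg t Q) by ring.
rewrite (_ : D f * horner_alg t d = horner_alg t n^`() * D t - f * (horner_alg t d^`() * D t)).
  by ring.
by rewrite -e addrK.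
Qed.

Lemma local_iter f n : local_at f -> local_at (iter n D f).
Proof. by move=> lf; elim: n => //= n; exact: local_der. Qed.

Lemma local_t : local_at t /\ ev t = 0.
Proof. by have := local_poly 'X; rewrite horner_algX hornerX. Qed.

Lemma ev_sum n (f : 'I_n -> A) : (forall i, local_at (f i)) ->
  local_at (\sum_i f i) /\ ev (\sum_i f i) = \sum_i ev (f i).
Proof.
move=> lf; elim/big_rec2: _ => [|i x y _ [ly e]].
  by have := local_poly 0; rewrite rmorph0 horner0.
have := localZD 1 (lf i) ly; rewrite scale1r mul1r => -[l' ->].
by rewrite e.
Qed.

Definition taylor (f : A) : power_series K := fun i => ev (iter i D f) / i`!%:R.

Lemma taylor1 : taylor 1 = 1.
Proof.
apply/funext => -[|i]; rewrite /taylor coef_ps1 /=.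
  by rewrite local1.2 fact0 divr1.
have -> : D (iter i D 1) = 0.
  by rewrite -iterS iterSr der1; elim: i => //= i ->; exact: der0.
by have := (local_poly 0).2; rewrite rmorph0 horner0 => ->; rewrite mul0r.
Qed.

Lemma iterDL c f g i : iter i D (c *: f + g) = c *: iter i D f + iter i D g.
Proof. by elim: i => //= i ->; rewrite DL. Qed.

Lemma taylorZD c f g i : local_at f -> local_at g ->
  taylor (c *: f + g) i = c * taylor f i + taylor g i.
Proof.
move=> lf lg; rewrite /taylor iterDL.
rewrite (localZD c (local_iter i lf) (local_iter i lg)).2 mulrDl mulrA.
by [].
Qed.

Lemma taylorM f g : local_at f -> local_at g -> taylor (f * g) = taylor f * taylor g.
Proof.
move=> lf lg; apply/funext => k; rewrite coef_psM /taylor der_leibniz.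
have l2 (i : 'I_k.+1) := localM (local_iter i lf) (local_iter (k - i) lg).
have lMn u n : local_at u -> local_at (u *+ n) /\ ev (u *+ n) = ev u *+ n.
  move=> lu; have z := local_poly 0; rewrite rmorph0 horner0 in z.
  have := localZD n%:R lu z.1; rewrite z.2 !addr0 scaler_nat => -[h ->].
  by rewrite mulr_natl.
rewrite (ev_sum (fun i => (lMn _ _ (l2 i).1).1)).2 mulr_suml.
apply: eq_bigr => i _; rewrite (lMn _ _ (l2 i).1).2 (l2 i).2.
have ik : (i <= k)%N by rewrite -ltnS.
have := bin_fact ik => /(congr1 (fun n => n%:R : K)); rewrite !natrM => e.
have f1 := fact_neq0 K i; have f2 := fact_neq0 K (k - i); have f3 := fact_neq0 K k.
rewrite -[_ *+ 'C(k, i)]mulr_natr; apply: (mulIf f3); rewrite mulfVK // -e.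
by rewrite mulf_div mulrCA mulfVK ?mulf_neq0 // mulrC.
Qed.

Lemma taylor_der f : taylor (D f) = ps_deriv (taylor f).
Proof.
apply/funext => k; rewrite /taylor /ps_deriv -iterSr factS natrM.
rewrite -[RHS]mulr_natr invfM [X in _ * X * _]mulrC !mulrA mulfVK //.
exact: natS_neq0.
Qed.

End LocalRing.

(** * Extension of the Taylor expansion from the local ring to the whole algebra *)

Section LaurentExpansion.
Variables (K : numFieldType) (A : comAlgType K) (D : A -> A) (t : A).
Hypothesis DL : forall c u v, D (c *: u + v) = c *: D u + D v.
Hypothesis DM : forall u v, D (u * v) = D u * v + u * D v.
Hypothesis t_trans : forall h, horner_alg t h = 0 -> h = 0.
Hypothesis t_gen : forall f, exists n d g,
  horner_alg t d * g = 1 /\ f = horner_alg t n * g.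
Variables P Q : {poly K}.
Hypothesis Dt : D t * horner_alg t Q = horner_alg t P.
Hypotheses (P0 : P.[0] != 0) (Q0 : Q.[0] != 0).

Local Notation local := (local_at t).
Local Notation tser := (taylor D t).
Implicit Types (f g : A) (G : power_series K).

(* The coefficient of x^i in x^-k G. *)
Definition laurent_coef (k : nat) G (i : int) : K :=
  if i + k%:Z is Posz m then G m else 0.

Lemma laurent_coefE k G (m : nat) : laurent_coef k G (m%:Z - k%:Z) = G m.
Proof. by rewrite /laurent_coef subrK. Qed.

Lemma laurent_coef_lt k G i : i < - k%:Z -> laurent_coef k G i = 0.
Proof. by rewrite /laurent_coef => ik; case E : (i + k%:Z) => [m|//]; lia. Qed.

Lemma laurent_coefP k G i : i < - k%:Z \/ exists m : nat, i = m%:Z - k%:Z.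
Proof.
have [ik|ki] := ltP i (- k%:Z); [by left|right].
by exists (absz (i + k%:Z)); lia.
Qed.

Lemma laurent_coefX k G i :
  laurent_coef k.+1 (ps_X K * G) i = laurent_coef k G i.
Proof.
rewrite /laurent_coef; case E : (i + k%:Z) => [m|m].
  by rewrite (_ : i + k.+1%:Z = m.+1); [rewrite coef_psXM|lia].
case E' : (i + k.+1%:Z) => [m'|//]; have -> : m' = 0%N by lia.
by rewrite coef_psXM.
Qed.

(** This is chi(t) / x. Its constant term is P(0)/Q(0), so it is invertible, with inverse
    [t_unit_inv]. *)
Definition t_unit_part : power_series K := fun k => tser t k.+1.

Lemma taylor_t : tser t = ps_X K * t_unit_part.
Proof.
apply/funext => -[|k]; rewrite coef_psXM //.
by rewrite /taylor fact0 divr1 /= (local_t t_trans).2.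
Qed.

Lemma t_unit_part0 : t_unit_part 0%N != 0.
Proof.
by rewrite /t_unit_part /taylor /= (evE t_trans Q0 Dt) divr1 mulf_neq0 ?invr_neq0.
Qed.

Definition t_unit_inv : power_series K := projT1 (cid (ps_unit t_unit_part0)).

Lemma t_unit_invP : t_unit_part * t_unit_inv = 1.
Proof. exact: projT2 (cid (ps_unit t_unit_part0)). Qed.

Lemma local_mulX f : exists k, local (t ^+ k * f).
Proof.
have [n [d [g [dg ->]]]] := t_gen f.
have d_neq0 : d != 0.
  apply: contra_eq_neq dg => ->; rewrite rmorph0 mul0r eq_sym.
  apply/eqP => e; have := t_trans (h := 1); rewrite rmorph1 => /(_ e) /eqP.
  by rewrite oner_eq0.
have [k [d1]] := multiplicity_XsubC d 0; rewrite d_neq0 subr0 /root => d1P dE.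
exists k, n, d1; split=> //.
rewrite dE rmorphM rmorphXn /= horner_algX in dg.
by rewrite -[RHS]mulr1 -dg; ring.
Qed.

Lemma local_mulX_le f k k' : (k <= k')%N -> local (t ^+ k * f) -> local (t ^+ k' * f).
Proof.
move=> kk' lf; rewrite -(subnK kk') exprD -mulrA; apply: (localM t_trans _ lf).1.
by have := (local_poly t_trans ('X^(k' - k)%N)).1; rewrite rmorphXn /= horner_algX.
Qed.

(** Some admissible exponent, not necessarily the least; by [laurentE] all of them give the same
    coefficients. *)
Definition polar_order f : nat := projT1 (cid (local_mulX f)).

Lemma polar_orderP f : local (t ^+ polar_order f * f).
Proof. exact: projT2 (cid (local_mulX f)). Qed.

(* x^k chi(f) = (x / chi(t))^k chi(t^k f). *)
Definition regular_part k f : power_series K :=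
  t_unit_inv ^+ k * tser (t ^+ k * f).

Definition laurent f (i : int) : K :=
  laurent_coef (polar_order f) (regular_part (polar_order f) f) i.

Lemma regular_partS k f i : local (t ^+ k * f) ->
  laurent_coef k.+1 (regular_part k.+1 f) i = laurent_coef k (regular_part k f) i.
Proof.
move=> lf; rewrite -[RHS]laurent_coefX; congr (laurent_coef _ _ _).
rewrite /regular_part [t ^+ k.+1]exprS -[t * _ * f]mulrA.
rewrite (taylorM DL DM t_trans Dt Q0 (local_t t_trans).1 lf) taylor_t exprS.
move: (tser (t ^+ k * f)) => F.
rewrite (_ : _ * _ = (t_unit_part * t_unit_inv) * (ps_X K * (t_unit_inv ^+ k * F))).
  by rewrite t_unit_invP mul1r.
by ring.
Qed.

Lemma laurentE k f i : local (t ^+ k * f) ->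
  laurent f i = laurent_coef k (regular_part k f) i.
Proof.
have up j m : local (t ^+ j * f) -> laurent_coef (m + j) (regular_part (m + j) f) i =
    laurent_coef j (regular_part j f) i.
  move=> lf; elim: m => // m IH; rewrite addSn regular_partS ?IH //.
  by apply: local_mulX_le lf; exact: leq_addl.
move=> lf; rewrite /laurent -(up _ k (polar_orderP f)) addnC.
exact: (up k).
Qed.

Lemma laurent_common f g : exists k, local (t ^+ k * f) /\ local (t ^+ k * g).
Proof.
exists (polar_order f + polar_order g)%N; split.
  by apply: local_mulX_le (polar_orderP f); exact: leq_addr.
by apply: local_mulX_le (polar_orderP g); exact: leq_addl.
Qed.

Lemma laurentZD c f g i : laurent (c *: f + g) i = c * laurent f i + laurent g i.
Proof.
have [k [lf lg]] := laurent_common f g.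
have e : t ^+ k * (c *: f + g) = c *: (t ^+ k * f) + t ^+ k * g.
  by rewrite mulrDr scalerAr.
have lfg : local (t ^+ k * (c *: f + g)) by rewrite e; apply: (localZD t_trans c lf lg).1.
rewrite (laurentE _ lf) (laurentE _ lg) (laurentE _ lfg) /laurent_coef.
case: (i + k%:Z) => [m|_]; last by rewrite mulr0 addr0.
rewrite /regular_part !coef_psM e mulr_sumr -big_split; apply: eq_bigr => j _ /=.
rewrite (taylorZD DL DM t_trans Dt Q0 c _ lf lg).
by ring.
Qed.

Lemma laurent_lt k f i : local (t ^+ k * f) -> i < - k%:Z -> laurent f i = 0.
Proof. by move=> lf ik; rewrite (laurentE _ lf) laurent_coef_lt. Qed.

Lemma laurent_local f i : local f ->
  laurent f i = if i is Posz m then tser f m else 0.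
Proof.
move=> lf; rewrite (@laurentE 0) ?expr0 ?mul1r // /laurent_coef addr0.
by rewrite /regular_part !expr0 !mul1r.
Qed.

Lemma laurent1 i : laurent 1 i = (i == 0)%:R.
Proof.
rewrite laurent_local; last exact: (local1 t_trans).1.
by case: i => [m|//]; rewrite (taylor1 DL DM t_trans) coef_ps1.
Qed.

Lemma laurentM k f g : local (t ^+ k * f) -> local (t ^+ k * g) ->
  forall i (n : nat), i + k%:Z + k%:Z < n%:Z ->
  laurent (f * g) i =
    \sum_(j < n) laurent f (j%:Z - k%:Z) * laurent g (i + k%:Z - j%:Z).
Proof.
move=> lf lg i n ikn.
have e : t ^+ (k + k) * (f * g) = (t ^+ k * f) * (t ^+ k * g) by rewrite exprD; ring.
have lfg : local (t ^+ (k + k) * (f * g)) by rewrite e; apply: (localM t_trans lf lg).1.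
have RM : regular_part (k + k) (f * g) = regular_part k f * regular_part k g.
  by rewrite /regular_part e (taylorM DL DM t_trans Dt Q0 lf lg) exprD; ring.
have [ik|[m mE]] := laurent_coefP (k + k) (regular_part (k + k) (f * g)) i.
  rewrite (laurent_lt lfg) // big1 // => j _.
  by rewrite [X in _ * X](laurent_lt lg) ?mulr0 //; lia.
rewrite (laurentE _ lfg) mE laurent_coefE RM coef_psM.
rewrite -(subnKC (_ : m.+1 <= n)%N); last by lia.
rewrite big_split_ord /= [X in _ = _ + X]big1 ?addr0 => [|j _]; last first.
  by rewrite [X in _ * X](laurent_lt lg) ?mulr0 //; lia.
apply: eq_bigr => j _; have := ltn_ord j; rewrite ltnS => jm.
rewrite (laurentE _ lf) (laurentE _ lg) laurent_coefE; congr (_ * _).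
rewrite (_ : _ + _ - _ = (m - j)%N%:Z - k%:Z); first by rewrite laurent_coefE.
by lia.
Qed.

(** Leibniz's rule for t^(k+1) f, multiplied by t and solved for the term with D f, so that only
    products of local elements remain. *)
Lemma local_t_der k f : local (t ^+ k.+1 * f) ->
  t ^+ k.+2 * D f =
    (- k.+1%:R) *: (t ^+ k.+1 * f * D t) + t * D (t ^+ k.+1 * f).
Proof.
move=> lf; rewrite [D (_ * f)]DM (derX DM) /= scaleNr scaler_nat.
rewrite mulrDr mulrnAl mulrnAr addrA [X in X + _](_ : _ = 0) ?add0r.
  by rewrite [t ^+ k.+2]exprS; ring.
by apply/eqP; rewrite addr_eq0 -mulNrn -!mulNrn; apply/eqP; rewrite exprS; ring.
Qed.

(** Writing chi(f) = x^-(k+1) G, the right side is x^(k+2) times the derivative of chi(f). *)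
Lemma regular_part_der k f : local (t ^+ k.+1 * f) ->
  regular_part k.+2 (D f) =
    ps_X K * ps_deriv (regular_part k.+1 f) - regular_part k.+1 f *+ k.+1.
Proof.
move=> lf; set G := regular_part k.+1 f.
have lt := (local_t t_trans).1.
have lDt := local_der DL DM Dt Q0 lt; have lDf := local_der DL DM Dt Q0 lf.
have lgt := (localM t_trans lf lDt).1; have ltg := (localM t_trans lt lDf).1.
have GE : tser (t ^+ k.+1 * f) = t_unit_part ^+ k.+1 * G.
  by rewrite /G /regular_part mulrA -exprMn t_unit_invP expr1n mul1r.
have TE : tser (t ^+ k.+2 * D f) =
    tser t * ps_deriv (tser (t ^+ k.+1 * f)) -
    (tser (t ^+ k.+1 * f) * ps_deriv (tser t)) *+ k.+1.
  rewrite (local_t_der lf) -!taylor_der -(taylorM DL DM t_trans Dt Q0 lt lDf).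
  rewrite -(taylorM DL DM t_trans Dt Q0 lf lDt); apply/funext => m.
  rewrite (taylorZD DL DM t_trans Dt Q0 _ _ lgt ltg) coef_psD coef_psN coef_psMn.
  by rewrite addrC mulNr mulr_natl.
rewrite {1}/regular_part TE GE taylor_t; move: (G) => {G GE TE} G.
rewrite !ps_derivM ps_derivX ps_derivXX.
move: t_unit_invP; set u := t_unit_part; set w := t_unit_inv => uw.
transitivity ((u * w) ^+ k.+2 * (ps_X K * ps_deriv G - G *+ k.+1)); last first.
  by rewrite uw expr1n mul1r.
by rewrite exprMn !exprS; ring.
Qed.

Lemma laurent_der f i : laurent (D f) i = (i + 1)%:~R * laurent f (i + 1).
Proof.
pose k := polar_order f.
have lf : local (t ^+ k.+1 * f) by apply: local_mulX_le (polar_orderP f).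
have lDf : local (t ^+ k.+2 * D f).
  have lt := (local_t t_trans).1.
  have lDt := local_der DL DM Dt Q0 lt; have lDf := local_der DL DM Dt Q0 lf.
  rewrite (local_t_der lf); apply: (localZD t_trans _ _ _).1.
    exact: (localM t_trans lf lDt).1.
  exact: (localM t_trans lt lDf).1.
have [ik|[m mE]] := laurent_coefP k.+1 (regular_part k.+1 f) (i + 1).
  by rewrite (laurent_lt lDf) ?(laurent_lt lf) ?mulr0 //; lia.
rewrite (laurentE _ lf) mE laurent_coefE (laurentE _ lDf).
rewrite (_ : i = m%:Z - k.+2%:Z); last by lia.
rewrite laurent_coefE (regular_part_der lf) coef_psD coef_psN coef_psMn coef_psXM.
rewrite rmorphB /= -!pmulrn mulrBl !mulr_natl; congr (_ - _).
by case: (m).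
Qed.

End LaurentExpansion.

(** * Modules of every dimension *)

Section ShiftAlgebra.
Variables (K : fieldType) (n : nat).
Local Notation V := 'rV[K]_n.+1.
Implicit Types F G : power_series K.

Definition shift_fun (v : V) : V :=
  \row_j (if nat_of_ord j is j'.+1 then v 0 (inord j') else 0).

Lemma shift_linear : linear shift_fun.
Proof.
move=> c u v; apply/rowP => j; rewrite !mxE; case: (nat_of_ord j) => [|j'].
  by rewrite mulr0 addr0.
by rewrite !mxE.
Qed.

HB.instance Definition _ := GRing.isLinear.Build K V V *:%R shift_fun shift_linear.

Definition shift : 'End(V) := linfun shift_fun.

Lemma iter_shiftE k v (j : 'I_n.+1) :
  iter k shift v 0 j = if (k <= j)%N then v 0 (inord (j - k)) else 0.
Proof.
elim: k j => [|k IH] j; first by rewrite leq0n subn0 inord_val.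
rewrite iterS lfunE /= mxE; case E : (nat_of_ord j) => [|j'] //.
have jn : (j' < n.+1)%N by have := ltn_ord j; lia.
by rewrite IH inordK // subSS.
Qed.

Lemma iter_shift0 k v : (n < k)%N -> iter k shift v = 0.
Proof.
move=> nk; apply/rowP => j; rewrite iter_shiftE mxE ifF //.
by apply/negbTE; rewrite -ltnNge; have := ltn_ord j; lia.
Qed.

Lemma iter_shift_neq0 : exists v, iter n shift v != 0.
Proof.
exists (delta_mx 0 ord0); apply/eqP => /rowP/(_ ord_max).
rewrite iter_shiftE /= leqnn subnn !mxE /= (_ : inord 0 = ord0) ?eqxx; last first.
  by apply: val_inj; rewrite /= inordK.
by move/eqP; rewrite oner_eq0.
Qed.

(** Evaluation of F at the Jordan block nu = [shift]; as nu^(n+1) = 0, it is the action of the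
    truncated series K[[nu]]/(nu^(n+1)) on a space of dimension n + 1. *)
Definition shift_op F : 'End(V) := \sum_(j < n.+1) F j *: iter_lfun shift j.

Lemma shift_opE F w : shift_op F w = \sum_(j < n.+1) F j *: iter j shift w.
Proof. by rewrite sum_lfunE; apply: eq_bigr => j _; rewrite lfunsE iter_lfunE. Qed.

Lemma shift_opM F G w : shift_op (F * G) w = shift_op F (shift_op G w).
Proof.
rewrite [RHS]shift_opE.
have e := triangular_exchange (fun j i => (F j * G i) *: iter (j + i) shift w) n.+1.
transitivity (\sum_(j < n.+1) \sum_(i < n.+1 - j) (F j * G i) *: iter (j + i) shift w).
  rewrite -e shift_opE; apply: eq_bigr => k _; rewrite coef_psM scaler_suml.
  by apply: eq_bigr => j _; rewrite subnKC // -ltnS.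
apply: eq_bigr => j _.
rewrite shift_opE -iter_lfunE lfun_sum scaler_sumr.
rewrite (@sum_ord_trunc _ (fun i => F j *: iter_lfun shift j (G i *: iter i shift w))
  (n.+1 - j)); first 1 last.
- exact: leq_subr.
- move=> i ji; rewrite lfunZ iter_lfunE -iterD iter_shift0 ?scaler0 //.
  by have := ltn_ord j; lia.
by apply: eq_bigr => i _; rewrite lfunZ scalerA iter_lfunE iterD.
Qed.

Lemma shift_op_eq F G : (forall j, (j <= n)%N -> F j = G j) -> shift_op F = shift_op G.
Proof. by move=> e; apply: eq_bigr => j _; rewrite e // -ltnS. Qed.

Lemma shift_op1 : shift_op 1 = \1%VF.
Proof.
apply/lfunP => w; rewrite shift_opE big_ord_recl big1 => [|j _]; last by rewrite scale0r.
by rewrite addr0 scale1r id_lfunE.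
Qed.

Lemma shift_opX F k w : shift_op (F ^+ k) w = iter k (shift_op F) w.
Proof.
elim: k w => [|k IH] w; first by rewrite expr0 shift_op1 id_lfunE.
by rewrite exprS shift_opM IH.
Qed.

Lemma shift_op_nilpotent F : F 0%N = 0 -> nilpotent_end (shift_op F).
Proof.
move=> F0; exists n.+1 => w; rewrite -shift_opX.
rewrite shift_opE big1 // => j _.
by rewrite ((coef_ps_exp n.+1 F0).1 j (ltn_ord j)) scale0r.
Qed.

Lemma shift_op_exp_neq0 F : F 0%N = 0 -> F 1%N != 0 ->
  exists w, iter n (shift_op F) w != 0.
Proof.
move=> F0 F1; have [v v0] := iter_shift_neq0; exists v.
have [lo hi] := coef_ps_exp n F0.
rewrite -shift_opX shift_opE big_ord_recr big1 /= => [|j _]; last first.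
  by rewrite lo ?scale0r.
by rewrite add0r hi scaler_eq0 (negPf v0) orbF expf_neq0.
Qed.

End ShiftAlgebra.

Lemma nilpotent_iter_dim (K : fieldType) (V : vectType K) (X : 'End(V)) :
  nilpotent_end X -> forall d (U : {vspace V}), invariant X U -> (\dim U <= d)%N ->
  forall u, u \in U -> iter d X u = 0.
Proof.
move=> nX; elim=> [|d IH] U XU dU u uU.
  by move: dU uU; rewrite leqn0 dimv_eq0 => /eqP ->; rewrite memv0 => /eqP.
have [U0|U0] := eqVneq U 0%VS.
  by move: uU; rewrite U0 memv0 => /eqP ->; rewrite lfun_iter0.
rewrite iterSr; apply: (IH (X @: U)%VS); last exact: memv_img.
  by apply/invariantP => w wU; move/invariantP: (XU) => XU'; apply/memv_img/(subvP XU).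
by rewrite -ltnS (leq_trans (nilpotent_img_dim nX XU U0)).
Qed.

Section ModuleOfCharacter.
Variables (K : numClosedFieldType) (A : comAlgType K) (D : A -> A).
Hypothesis DL : forall c u v, D (c *: u + v) = c *: D u + D v.
Hypothesis DM : forall u v, D (u * v) = D u * v + u * D v.
Variable L : A -> int -> K.
Hypothesis LZD : forall c f g i, L (c *: f + g) i = c * L f i + L g i.
Hypothesis L1 : forall i, L 1 i = (i == 0)%:R.
Hypothesis LD : forall f i, L (D f) i = (i + 1)%:~R * L f (i + 1).
Hypothesis L_bound : forall f, exists k : nat, forall i, i < - k%:Z -> L f i = 0.
Hypothesis LM : forall f g k,
  (forall i, i < - k%:Z -> L f i = 0) -> (forall i, i < - k%:Z -> L g i = 0) ->
  forall i (n : nat), i + k%:Z + k%:Z < n%:Z ->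
  L (f * g) i = \sum_(j < n) L f (j%:Z - k%:Z) * L g (i + k%:Z - j%:Z).
Variable n : nat.

(* The coefficients in nu of the coefficient of x^i in exp(nu d/dx) L(f). *)
Definition taylor_shift f i : power_series K := fun j => L (iter j D f) i / j`!%:R.

Definition shift_series f i : 'End('rV[K]_n.+1) := shift_op n (taylor_shift f i).

Lemma laurent_map_iter_bound f k j i : (forall i, i < - k%:Z -> L f i = 0) ->
  i < - (k + j)%N%:Z -> L (iter j D f) i = 0.
Proof.
move=> kP; elim: j i => [|j IH] i ij; first by apply: kP; lia.
rewrite iterS LD; have [->|ik] := eqVneq i (-1); first by rewrite addNr mul0r.
by rewrite IH ?mulr0 //; lia.
Qed.

Lemma shift_seriesL c u v i :
  shift_series (c *: u + v) i = c *: shift_series u i + shift_series v i.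
Proof.
rewrite /shift_series /shift_op scaler_sumr -big_split; apply: eq_bigr => j _ /=.
rewrite scalerA -scalerDl; congr (_ *: _); rewrite /taylor_shift (iterDL DL) LZD.
by rewrite mulrDl mulrA.
Qed.

Lemma laurent_map0 i : L 0 i = 0.
Proof. by have := LZD (-1) 1 1 i; rewrite scaleN1r addNr mulN1r addNr. Qed.

Lemma shift_series1 i : shift_series 1 i = if i == 0 then \1%VF else 0.
Proof.
have D0 j : iter j.+1 D 1 = 0.
  by rewrite iterSr (der1 DM); elim: j => //= j ->; exact: (der0 DL).
have e j : taylor_shift 1 i j = (i == 0)%:R * (1 : power_series K) j.
  rewrite /taylor_shift coef_ps1; case: j => [|j].
    by rewrite /= L1 fact0 divr1 mulr1.
  by rewrite D0 laurent_map0 mul0r mulr0.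
rewrite -(shift_op1 K n) /shift_series; case: eqP e => _ e.
  by apply: shift_op_eq => j _; rewrite e mul1r.
by rewrite /shift_op big1 // => j _; rewrite e mul0r scale0r.
Qed.

Lemma shift_seriesC u v i j w :
  shift_series u i (shift_series v j w) = shift_series v j (shift_series u i w).
Proof. by rewrite /shift_series -!shift_opM mulrC. Qed.

Lemma shift_series_der u k :
  shift_series (D u) k = (k + 1)%:~R *: shift_series u (k + 1).
Proof.
rewrite /shift_series /shift_op scaler_sumr; apply: eq_bigr => j _.
by rewrite scalerA /taylor_shift -iterSr iterS LD mulrA.
Qed.

Lemma shift_series_lt f k i : (forall i, i < - k%:Z -> L f i = 0) ->
  i < - (k + n)%N%:Z -> shift_series f i = 0.
Proof.
move=> kP ik; rewrite /shift_series /shift_op big1 // => j _.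
rewrite /taylor_shift (laurent_map_iter_bound kP) ?mul0r ?scale0r //.
by have := ltn_ord j; lia.
Qed.

(** At nu^j this is Leibniz's rule for D^j (uv) / j! combined with [LM]. Up to n derivations occur,
    each lowering the order by at most one, hence the summand n in m. *)
Lemma shift_seriesM u v : exists m : nat,
  [/\ forall i, i < - m%:Z -> shift_series u i = 0,
      forall i, i < - m%:Z -> shift_series v i = 0 &
      forall k w (N : nat), k + m%:Z + m%:Z < N%:Z ->
      shift_series (u * v) k w =
        \sum_(i < N) shift_series u (i%:Z - m%:Z) (shift_series v (k + m%:Z - i%:Z) w)].
Proof.
have [a aP] := L_bound u; have [b bP] := L_bound v.
exists (a + b + n)%N; set m := (a + b + n)%N; split=> [i im|i im|k w N kN].
- by apply: (shift_series_lt aP); lia.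
- by apply: (shift_series_lt bP); lia.
have bu j i : (j <= n)%N -> i < - m%:Z -> L (iter j D u) i = 0.
  by move=> jn im; apply: (laurent_map_iter_bound aP); lia.
have bv j i : (j <= n)%N -> i < - m%:Z -> L (iter j D v) i = 0.
  by move=> jn im; apply: (laurent_map_iter_bound bP); lia.
under eq_bigr => i _ do rewrite /shift_series -shift_opM.
rewrite -sum_lfunE; congr (fun_of_lfun _ w).
transitivity (shift_op n (\sum_(i < N) taylor_shift u (i%:Z - m%:Z) *
    taylor_shift v (k + m%:Z - i%:Z))); last first.
  rewrite /shift_op exchange_big; apply: eq_bigr => j _ /=.
  by rewrite -scaler_suml coef_ps_sum.
apply: shift_op_eq => j jn; rewrite coef_ps_sum /taylor_shift (der_leibniz DL DM).
have Lsum (p : nat) (F : 'I_p -> A) (c : 'I_p -> nat) :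
    L (\sum_(x < p) F x *+ c x) k = \sum_(x < p) (c x)%:R * L (F x) k.
  elim/big_rec2: _ => [|x y z _ <-]; first exact: laurent_map0.
  by rewrite -scaler_nat LZD.
rewrite Lsum mulr_suml.
under [RHS]eq_bigr => i _ do rewrite coef_psM.
rewrite exchange_big; apply: eq_bigr => x _ /=.
have xj : (x <= j)%N by rewrite -ltnS.
rewrite (LM (k := m) _ _ kN); last 2 first.
- by move=> i; apply: bu; have := ltn_ord x; lia.
- by move=> i; apply: bv; lia.
rewrite mulr_sumr mulr_suml; apply: eq_bigr => i _.
have := bin_fact xj => /(congr1 (fun z => z%:R : K)); rewrite !natrM => e.
have f1 := fact_neq0 K x; have f2 := fact_neq0 K (j - x); have f3 := fact_neq0 K j.
apply: (mulIf f3); rewrite mulfVK // -e mulf_div.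
by rewrite [RHS]mulrCA mulfVK ?mulf_neq0.
Qed.

Definition character_module : vamodule D :=
  module_of_series shift_seriesL shift_series1 shift_seriesC shift_series_der shift_seriesM.

Lemma vadim_character_module : vadim character_module = n.+1.
Proof. by rewrite /vadim dimvf /dim /= mul1n. Qed.

Lemma character_module_nilpotent u i :
  nilpotent_end (Ycoef character_module u i - L u i *: \1%VF).
Proof.
have -> : Ycoef character_module u i - L u i *: \1%VF =
    shift_op n (fun j => if j is 0%N then 0 else taylor_shift u i j).
  apply/lfunP => w; rewrite !lfunsE /= /shift_series !shift_opE.
  rewrite !big_ord_recl /= scale0r add0r {1}/taylor_shift /= fact0 divr1.
  by rewrite addrC addKr.
exact: shift_op_nilpotent.
Qed.

(** T is a series in nu without constant term whose coefficient at nu is L(t)_1, so T^n is non-zero.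
    On a sum of two non-zero complementary submodules T^n would vanish, since each has dimension at
    most n. *)
Lemma character_module_positive_ld t : (forall i, i < 1 -> L t i = 0) ->
  L t 1 != 0 -> positive_ld t character_module.
Proof.
move=> tlo t1.
have ss i : ss_part (Ycoef character_module t i) = L t i *: \1%VF.
  exact/ss_part_scalar/character_module_nilpotent.
have M0 : (0 < vadim character_module)%N by rewrite vadim_character_module.
split=> //; last first.
  exists 1; split=> //; split=> [|i iL]; rewrite /ss_series ss.
    apply: contra t1 => /eqP; rewrite -[0](scale0r (\1%VF : 'End(character_module))).
    by move=> /(scalar_lfun_inj M0) ->.
  by rewrite tlo // scale0r.
move=> U W sU sW UW UW0.
pose T := Ycoef character_module t 0.
have nT : nilpotent_end T.
  have := character_module_nilpotent t 0.
  by rewrite tlo // scale0r subr0.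
have [w w0] : exists w, iter n T w != 0.
  apply: shift_op_exp_neq0; rewrite /taylor_shift /=.
    by rewrite tlo // mul0r.
  by rewrite LD add0r mul1r divr1.
have dims : (\dim U + \dim W = n.+1)%N.
  by rewrite -vadim_character_module /vadim -UW dimv_disjoint_sum.
have [U0|U0] := eqVneq U 0%VS; [by left|right].
apply/eqP/negPn/negP => W0; case/eqP: w0.
move: U0 W0; rewrite -!dimv_eq0 -!lt0n => U0 W0.
have : w \in (U + W)%VS by rewrite UW memvf.
case/memv_addP => u uU [x xW ->]; rewrite -iter_lfunE lfunD !iter_lfunE.
rewrite (nilpotent_iter_dim nT (sU t 0) _ uU) ?(nilpotent_iter_dim nT (sW t 0) _ xW) ?addr0 //.
  by move: dims U0 W0; lia.
by move: dims U0 W0; lia.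
Qed.

End ModuleOfCharacter.

Section UniqueModules.
Variables (K : numClosedFieldType) (A : comAlgType K) (D : A -> A) (t : A).
Hypothesis DL : forall c u v, D (c *: u + v) = c *: D u + D v.
Hypothesis DM : forall u v, D (u * v) = D u * v + u * D v.
Hypothesis t_trans : forall h, horner_alg t h = 0 -> h = 0.
Hypothesis t_gen : forall f, exists n d g,
  horner_alg t d * g = 1 /\ f = horner_alg t n * g.
Variables P Q : {poly K}.
Hypothesis Dt : D t * horner_alg t Q = horner_alg t P.
Hypotheses (P0 : P.[0] != 0) (Q0 : Q.[0] != 0).

Lemma positive_ld_exists n : exists M : vamodule D, vadim M = n.+1 /\ positive_ld t M.
Proof.
pose L := laurent t_trans t_gen Dt P0 Q0.
have L_bound f : exists k : nat, forall i, i < - k%:Z -> L f i = 0.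
  by exists (polar_order t_trans t_gen f) => i; apply/laurent_lt/polar_orderP.
(* [laurentM] takes an exponent k that makes t^k f and t^k g local, whereas the module construction
   starts from bounds on the coefficients; a wide window links the two. *)
have LM f g k : (forall i, i < - k%:Z -> L f i = 0) ->
    (forall i, i < - k%:Z -> L g i = 0) ->
    forall i (N : nat), i + k%:Z + k%:Z < N%:Z ->
    L (f * g) i = \sum_(j < N) L f (j%:Z - k%:Z) * L g (i + k%:Z - j%:Z).
  move=> fk gk i N iN; pose F x := L f x * L g (i - x).
  have [k' [lf lg]] := laurent_common t_trans t_gen f g.
  pose m := (k + k')%N.
  have lfm := local_mulX_le t_trans (leq_addl k k') lf.
  have lgm := local_mulX_le t_trans (leq_addl k k') lg.
  rewrite /L (laurentM DL DM t_trans t_gen Dt P0 Q0 lfm lgm (n := (absz i + m + m + N).+1));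
    last by lia.
  transitivity (\sum_(j < (absz i + m + m + N).+1) F (- m%:Z + j%:Z)).
    by apply: eq_bigr => j _; congr (L f _ * L g _); rewrite /m; lia.
  rewrite (@sum_int_widen _ F (- k%:Z) (- m%:Z) N).
  - by apply: eq_bigr => j _; congr (L f _ * L g _); lia.
  - by move=> x xk; rewrite /F fk ?mul0r.
  - by move=> x xk; rewrite /F (gk (i - x)) ?mulr0 //; lia.
  - by rewrite /m; lia.
  - by rewrite /m; lia.
have LZD : forall c f g i, L (c *: f + g) i = c * L f i + L g i.
  by move=> *; exact: laurentZD.
have L1 : forall i, L 1 i = (i == 0)%:R by move=> i; exact: laurent1.
have LD : forall f i, L (D f) i = (i + 1)%:~R * L f (i + 1).
  by move=> *; exact: laurent_der.
exists (character_module DL DM LZD L1 LD L_bound LM n); split.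
  exact: vadim_character_module.
have Lt i : L t i = if i is Posz m then taylor D t t m else 0.
  by apply: laurent_local => //; exact: (local_t t_trans).1.
apply: character_module_positive_ld => [i i1|].
  rewrite Lt; case: i i1 => // -[|//] _.
  by rewrite /taylor fact0 divr1 /= (local_t t_trans).2.
by rewrite Lt; exact: (t_unit_part0 t_trans Dt P0 Q0).
Qed.

Lemma positive_ld_unique_in_each_dim : unique_in_each_dim (@positive_ld K A D t).
Proof.
have Pn0 : P != 0 by apply: contraNneq P0 => ->; rewrite horner0.
have Qn0 : Q != 0 by apply: contraNneq Q0 => ->; rewrite horner0.
case=> // n _; split; first exact: positive_ld_exists.
move=> M N dM pM dN pN.
apply: (positive_ld_unique Pn0 Qn0 _ Dt t_gen) => //; first by rewrite P0.
by rewrite dM dN.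
Qed.

End UniqueModules.

Section CharacterCases.
Variables (K : numClosedFieldType) (A : comAlgType K) (D : A -> A).
Implicit Type M : vamodule D.

Lemma positive_ld_character (t : A) M chi L c : (0 < vadim M)%N -> indecomposable M ->
  is_character M chi -> has_ld chi t L c -> 0 < L -> c != 0 -> positive_ld t M.
Proof.
move=> M0 iM chiP tL L0 c0; split=> //; exists L; split => //.
by have [_ /(_ tL)[]] := is_ld_character t L M0 chiP c0.
Qed.

Lemma has_ld_inverse M chi (f g : A) L c : is_character M chi -> f * g = 1 ->
  c != 0 -> has_ld chi f L c -> has_ld chi g (- L) c^-1.
Proof.
move=> chiP fg c0 fL; have gf : g * f = 1 by rewrite mulrC.
have [m [d [d0 gm]]] := character_ld chiP gf.
have one : has_ld chi 1 0 1.
  split=> [i i0|]; rewrite (character1 chiP) //.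
  by rewrite (_ : (i == 0) = false) //; apply/eqP; lia.
have := has_ldM chiP fL gm; rewrite fg => fgL.
have [||e1 e2] := has_ld_uniq _ _ one fgL; rewrite ?oner_neq0 ?mulf_neq0 //.
have -> : - L = m by lia.
suff -> : c^-1 = d by [].
by apply: (mulfI c0); rewrite mulfV.
Qed.

End CharacterCases.

(** * The generators s, s - alpha and 1/s *)

Section RationalCases.
Variables (K : numClosedFieldType) (p q : {poly K}).
Local Notation A := {fraction {poly K}}.
Local Notation D := (ratder p q).
Local Notation s := ('X%:F : A).
Implicit Type M : ratmodule p q.

Lemma leading_caseP (Pr : int -> Prop) alpha M : alpha != 0 ->
  leading_case Pr alpha M <->
  exists chi, [/\ (0 < vadim M)%N, indecomposable M, is_character M chi &
    exists2 L, Pr L & has_ld chi s L alpha].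
Proof.
move=> a0; split=> [[M0 iM [L [ldL PL cL]]]|[chi [M0 iM chiP [L PL hL]]]].
  have [chi chiP] := character_exists iM M0; exists chi; split=> //.
  by exists L => //; apply/(is_ld_character _ _ M0 chiP a0).
split=> //; exists L.
by have [_ /(_ hL)[]] := is_ld_character s L M0 chiP a0.
Qed.

Lemma horner_alg_gen (h : {poly K}) : horner_alg s h = h%:F.
Proof.
elim/poly_ind: h => [|h c IH]; first by rewrite !rmorph0.
rewrite !rmorphD !rmorphM /= horner_algX horner_algC IH.
by rewrite fracpoly_scaleE mulr1.
Qed.

Lemma generated_of_fractions (t : A) : (forall h, horner_alg t h = 0 -> h = 0) ->
  (forall f : A, exists n d : {poly K}, d != 0 /\ f = horner_alg t n / horner_alg t d) ->
  forall f : A, exists n d g, horner_alg t d * g = 1 /\ f = horner_alg t n * g.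
Proof.
move=> t_trans t_gen f; have [n [d [d0 ->]]] := t_gen f.
exists n, d, (horner_alg t d)^-1; split=> //; apply: mulfV.
by apply: contra d0 => /eqP/t_trans ->.
Qed.

Lemma gen_transcendental (h : {poly K}) : horner_alg s h = 0 -> h = 0.
Proof. by rewrite horner_alg_gen => /eqP; rewrite tofrac_eq0 => /eqP. Qed.

Lemma gen_fractions (f : A) : exists n d g, horner_alg s d * g = 1 /\ f = horner_alg s n * g.
Proof.
apply: generated_of_fractions => [|{}f]; first exact: gen_transcendental.
have [n [d [d0 ->]]] := fracpolyP f; exists n, d.
by rewrite !horner_alg_gen.
Qed.

Hypotheses (p0 : p != 0) (q0 : q != 0).

Lemma ratder_gen : D s * horner_alg s q = horner_alg s p.
Proof. by rewrite ratder_s !horner_alg_gen mulfVK ?tofrac_eq0. Qed.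

End RationalCases.

Lemma predn_split (n i : nat) : (i < n)%N -> n.-1 = (i + (n - i.+1))%N.
Proof. lia. Qed.

Lemma inverse_frac (F : fieldType) (s x y : F) (a b : nat) : s != 0 -> y != 0 ->
  s ^+ a * x / (s ^+ b * y) = x * s^-1 ^+ b / (y * s^-1 ^+ a).
Proof.
move=> s0 y0; rewrite !exprVn.
by field; rewrite ?y0 ?expf_neq0 ?s0.
Qed.

Lemma inverse_der (F : fieldType) (s ds dt x y : F) (a b : nat) : s != 0 ->
  ds * (s ^+ b * y) = s ^+ a * x -> dt = - (s^-1 ^+ 2 * ds) ->
  dt * (s^-1 ^+ (a - (b + 2)) * y) = - (s^-1 ^+ (b + 2 - a) * x).
Proof.
move=> s0 e ->; have st (k : nat) : s^-1 ^+ k * s ^+ k = 1.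
  by rewrite -exprMn mulVf ?expr1n.
move: st; have : s^-1 != 0 by rewrite invr_neq0.
move: (s^-1) => t t0 st.
have e' : ds * y * t ^+ a = x * t ^+ b.
  transitivity (ds * (s ^+ b * y) * t ^+ a * t ^+ b).
    by rewrite -[LHS]mulr1 -(st b); ring.
  by rewrite e -[RHS]mulr1 -(st a); ring.
apply: (mulIf (expf_neq0 a t0)).
transitivity (- (t ^+ 2 * t ^+ (a - (b + 2)) * (ds * y * t ^+ a))); first by ring.
rewrite e'.
transitivity (- (t ^+ (2 + (a - (b + 2)) + b) * x)); first by rewrite !exprD; ring.
(* Both exponents are the maximum of a and b + 2. *)
rewrite (_ : 2 + (a - (b + 2)) + b = b + 2 - a + a)%N; last by lia.
by rewrite exprD; ring.
Qed.

Lemma der_inv (F : fieldType) (d : F -> F) (s : F) :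
  (forall u v, d (u * v) = d u * v + u * d v) -> s != 0 ->
  d s^-1 = - (s^-1 ^+ 2 * d s).
Proof.
move=> dM s0; have d1 : d 1 = 0.
  by apply: (@addIr _ (d 1)); have := dM 1 1; rewrite !mulr1 mul1r add0r.
have := dM s s^-1; rewrite mulfV // d1 => /esym/eqP; rewrite addrC addr_eq0 => /eqP e.
by apply: (mulfI s0); rewrite e expr2 mulrN !mulrA mulfV // mul1r mulrC.
Qed.

Section MoebiusCases.
Variables (K : numClosedFieldType) (p q : {poly K}).
Hypotheses (p0 : p != 0) (q0 : q != 0) (pq : coprimep p q).
Local Notation A := {fraction {poly K}}.
Local Notation D := (ratder p q).
Local Notation s := ('X%:F : A).
Implicit Type M : ratmodule p q.

Lemma coprime_horner_neq0 x : (p.[x] != 0) || (q.[x] != 0).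
Proof.
have [/eqP px|//] := boolP (p.[x] == 0); rewrite /=.
by have := coprimep_root pq; apply; apply/eqP.
Qed.

(** * The generator s - alpha *)

Section Translate.
Variable alpha : K.
Local Notation t := (s - alpha%:A).
Local Notation tr h := (h \Po ('X + alpha%:P)).

Lemma horner_alg_translate (h : {poly K}) : horner_alg t (tr h) = horner_alg s h.
Proof.
elim/poly_ind: h => [|h c IH]; first by rewrite comp_poly0 !rmorph0.
rewrite comp_polyD comp_polyM comp_polyX comp_polyC !rmorphD !rmorphM /= rmorphD /=.
by rewrite !horner_algX !horner_algC IH subrK.
Qed.

Lemma translate_translate (h : {poly K}) : tr (h \Po ('X - alpha%:P)) = h.
Proof.
by rewrite -comp_polyA comp_polyB comp_polyX comp_polyC addrK comp_polyXr.
Qed.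

Lemma translate_transcendental (h : {poly K}) : horner_alg t h = 0 -> h = 0.
Proof.
rewrite -[h]translate_translate horner_alg_translate => /gen_transcendental ->.
by rewrite comp_poly0.
Qed.

Lemma translate_gen (f : A) :
  exists n d g, horner_alg t d * g = 1 /\ f = horner_alg t n * g.
Proof.
have [n [d [g [dg ->]]]] := gen_fractions f; exists (tr n), (tr d), g.
by rewrite !horner_alg_translate.
Qed.

Lemma ratder_translate : D t * horner_alg t (tr q) = horner_alg t (tr p).
Proof.
have -> : D t = D s.
  rewrite -[t]addrC -scaleNr ratderZD (der1 (ratderM p q)) scaler0 add0r //.
by rewrite !horner_alg_translate ratder_gen.
Qed.

Lemma horner_translate (h : {poly K}) : (tr h).[0] = h.[alpha].
Proof. by rewrite horner_comp !hornerE. Qed.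

Lemma translate_neq0 (h : {poly K}) : h != 0 -> tr h != 0.
Proof.
by apply: contra_neq => e; apply: gen_transcendental; rewrite -horner_alg_translate e rmorph0.
Qed.

Lemma coprime_translate : ((tr p).[0] != 0) || ((tr q).[0] != 0).
Proof. by rewrite !horner_translate coprime_horner_neq0. Qed.

Lemma character_translate M chi i : is_character M chi ->
  chi t i = chi s i - alpha * (i == 0)%:R.
Proof.
move=> chiP; rewrite -[t]addrC -scaleNr (characterZD chiP) (character1 chiP).
by rewrite mulNr addrC.
Qed.

(** Forward, chi(t) has a leading term because t is invertible, and its exponent is positive: up to
    exponent 0 the only coefficient of chi(s) is alpha, which the translation cancels. Backward, ld
    chi(t) = 1 gives chi(s) = alpha + O(x). *)
Lemma case2_translate M : alpha != 0 ->
  leading_case (fun L => L = 0) alpha M <-> positive_ld t M.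
Proof.
move=> a0; split.
  move=> /(leading_caseP _ _ a0)[chi [M0 iM chiP [L -> [lo hi]]]].
  have t_unit : t * t^-1 = 1.
    apply: mulfV; apply/eqP => t0; have := @translate_transcendental 'X; rewrite horner_algX.
    by move=> /(_ t0)/eqP; rewrite polyX_eq0.
  have [m [c [c0 tm]]] := character_ld chiP t_unit.
  apply: (positive_ld_character M0 iM chiP tm _ c0).
  rewrite ltNge; apply/negP => m0; case/eqP: c0; rewrite -tm.2.
  rewrite (character_translate _ chiP); have [->|mn0] := eqVneq m 0.
    by rewrite hi mulr1 subrr.
  by rewrite lo ?mulr0 ?subr0 //; lia.
move=> pM; apply/(leading_caseP _ _ a0).
have [M0 iM _] := pM.
have [chi [chiP tl _ _ _]] := positive_ldP
  (translate_neq0 p0) (translate_neq0 q0) coprime_translate ratder_translate pM.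
exists chi; split=> //; exists 0 => //.
have e i : chi s i = chi t i + alpha * (i == 0)%:R.
  by rewrite (character_translate _ chiP) subrK.
split=> [i i0|]; rewrite e tl.1 ?add0r ?mulr1 //; last by lia.
by rewrite (_ : (i == 0) = false) ?mulr0 //; apply/eqP; lia.
Qed.

End Translate.

(** * The generator 1/s *)

Section Inverse.
Local Notation t := (s^-1).
(* x^(deg h) h(1/x) *)
Local Notation rv h := (\poly_(i < size h) h`_(size h - i.+1)).

Lemma horner_alg_sum (a : A) (h : {poly K}) n (E : nat -> K) : h = \poly_(i < n) E i ->
  horner_alg a h = \sum_(i < n) E i *: a ^+ i.
Proof.
move=> ->; rewrite poly_def raddf_sum; apply: eq_bigr => i _ /=.
by rewrite -mul_polyC rmorphM rmorphXn /= horner_algX horner_algC mulr_algl.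
Qed.

Lemma gen_neq0 : s != 0. Proof. by rewrite tofrac_eq0 polyX_eq0. Qed.

Lemma horner_alg_rev (h : {poly K}) : h != 0 ->
  s ^+ (size h).-1 * horner_alg t (rv h) = horner_alg s h.
Proof.
move=> h0; rewrite (horner_alg_sum t (erefl (rv h))) (horner_alg_sum s (esym (coefK h))).
rewrite mulr_sumr (reindex_inj rev_ord_inj) /=; apply: eq_bigr => i _.
have ih := ltn_ord i.
rewrite -scalerAr subnSK // subKn ?(ltnW ih) //.
congr (_ *: _); rewrite (predn_split ih).
by rewrite exprD -mulrA -exprMn mulfV ?gen_neq0 // expr1n mulr1.
Qed.

Lemma rev0 (h : {poly K}) : (rv h).[0] = lead_coef h.
Proof.
rewrite horner_coef0 coef_poly lead_coefE; case: posnP => [h0|_]; last by rewrite subn1.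
by rewrite h0 nth_default // h0.
Qed.

Lemma rev_neq0 (h : {poly K}) : h != 0 -> rv h != 0.
Proof. by rewrite -lead_coef_eq0 -rev0; apply: contra_neq => ->; rewrite horner0. Qed.

Lemma horner_alg_inverse (h : {poly K}) : h != 0 ->
  s ^+ (size h).-1 * horner_alg t h = horner_alg s (rv h).
Proof.
move=> h0; rewrite (horner_alg_sum s (erefl (rv h))) (horner_alg_sum t (esym (coefK h))).
rewrite mulr_sumr (reindex_inj rev_ord_inj) /=; apply: eq_bigr => i _.
have ih := ltn_ord i.
rewrite -scalerAr; congr (_ *: _).
rewrite (predn_split ih) addnC.
by rewrite exprD mulrAC -exprMn mulfV ?gen_neq0 // expr1n mul1r.
Qed.

Lemma inverse_transcendental (h : {poly K}) : horner_alg t h = 0 -> h = 0.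
Proof.
have [//|h0] := eqVneq h 0; move=> e; have := horner_alg_inverse h0.
rewrite e mulr0 => /esym/gen_transcendental rh0.
by have := rev_neq0 h0; rewrite rh0 eqxx.
Qed.

Lemma inverse_gen (f : A) :
  exists n d g, horner_alg t d * g = 1 /\ f = horner_alg t n * g.
Proof.
apply: generated_of_fractions => [|{}f]; first exact: inverse_transcendental.
have [n [d [d0 ->]]] := fracpolyP f.
have [->|n0] := eqVneq n 0.
  by exists 0, 1; rewrite oner_neq0 !rmorph0 !mul0r.
exists (rv n * 'X^((size d).-1)), (rv d * 'X^((size n).-1)).
split; first by rewrite mulf_neq0 ?rev_neq0 // -size_poly_eq0 size_polyXn.
rewrite -(horner_alg_gen n) -(horner_alg_gen d).
rewrite -(horner_alg_rev n0) -(horner_alg_rev d0) !rmorphM !rmorphXn /= !horner_algX.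
have rd0 : horner_alg t (rv d) != 0.
  by apply: contra_neq (rev_neq0 d0) => /inverse_transcendental.
exact: inverse_frac gen_neq0 rd0.
Qed.

(* D(1/s) = - s^-2 p(s)/q(s) as a fraction in 1/s: truncated subtraction makes
   exactly the needed power of 1/s appear above or below the bar. *)
Definition inverse_num : {poly K} :=
  - ('X^((size q).-1 + 2 - (size p).-1) * rv p).
Definition inverse_den : {poly K} :=
  'X^((size p).-1 - ((size q).-1 + 2)) * rv q.

Lemma ratder_inverse : D t * horner_alg t inverse_den = horner_alg t inverse_num.
Proof.
have s0 := gen_neq0; have t0 : t != 0 by rewrite invr_neq0.
have Dt : D t = - (t ^+ 2 * D s) := der_inv (ratderM p q) s0.
have Ds := ratder_gen p q0; rewrite -(horner_alg_rev p0) -(horner_alg_rev q0) in Ds.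
rewrite rmorphN !rmorphM !rmorphXn /= horner_algX.
exact: inverse_der s0 Ds Dt.
Qed.

Lemma inverse_num0 : inverse_num.[0] =
  - (lead_coef p *+ ((size q).-1 + 2 <= (size p).-1)%N).
Proof.
rewrite /inverse_num hornerN hornerM hornerXn rev0 expr0n subn_eq0.
by case: leqP; rewrite ?mul1r ?mul0r.
Qed.

Lemma inverse_den0 : inverse_den.[0] =
  lead_coef q *+ ((size p).-1 <= (size q).-1 + 2)%N.
Proof.
rewrite /inverse_den hornerM hornerXn rev0 expr0n subn_eq0.
by case: leqP; rewrite ?mul1r ?mul0r.
Qed.

Lemma inverse_num_neq0 : inverse_num != 0.
Proof. by rewrite oppr_eq0 mulf_neq0 ?rev_neq0 // -size_poly_eq0 size_polyXn. Qed.

Lemma inverse_den_neq0 : inverse_den != 0.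
Proof. by rewrite mulf_neq0 ?rev_neq0 // -size_poly_eq0 size_polyXn. Qed.

Lemma inverse_num_den0 : (inverse_num.[0] != 0) || (inverse_den.[0] != 0).
Proof.
rewrite inverse_num0 inverse_den0 oppr_eq0.
case: leqP => [_|/ltnW ->]; first by rewrite lead_coef_eq0 p0.
by rewrite lead_coef_eq0 q0 orbT.
Qed.

(** Non-vanishing of the numerator at 0 means deg p >= deg q + 2, that of the denominator the
    opposite inequality. *)
Lemma inverse_num_den_neq0 :
  (inverse_num.[0] != 0 /\ inverse_den.[0] != 0) <-> (size p).-1 = ((size q).-1 + 2)%N.
Proof.
rewrite inverse_num0 inverse_den0 oppr_eq0; split=> [[]|->].
  case: leqP => [h1 _|_]; last by rewrite eqxx.
  by case: leqP => [h2 _|_]; [apply/eqP; rewrite eqn_leq h1 h2|rewrite eqxx].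
by rewrite leqnn !mulr1n !lead_coef_eq0.
Qed.

End Inverse.
End MoebiusCases.

Section Classification.
Variables (K : numClosedFieldType) (p q : {poly K}).
Hypotheses (p0 : p != 0) (q0 : q != 0) (pq : coprimep p q).
Local Notation A := {fraction {poly K}}.
Local Notation D := (ratder p q).
Local Notation s := ('X%:F : A).
Implicit Type M : ratmodule p q.

Section Generator.
Variables (t : A) (P Q : {poly K}) (case : ratmodule p q -> Prop) (c : Prop).
Hypotheses (P0 : P != 0) (Q0 : Q != 0) (PQ0 : (P.[0] != 0) || (Q.[0] != 0)).
Hypothesis Dt : D t * horner_alg t Q = horner_alg t P.
Hypothesis t_trans : forall h, horner_alg t h = 0 -> h = 0.
Hypothesis t_gen : forall f, exists n d g,
  horner_alg t d * g = 1 /\ f = horner_alg t n * g.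
Hypothesis caseP : forall M, case M <-> positive_ld t M /\ c.

(** The proposition [c] carries the condition on alpha: its prescribed value in cases 1 and 3, and
    [True] in case 2, where alpha is built into the generator t. *)
Lemma generator_unique : P.[0] != 0 /\ Q.[0] != 0 -> c -> unique_in_each_dim case.
Proof.
move=> [P00 Q00] hc n n0.
have [[M [dM pM]] uniq] := positive_ld_unique_in_each_dim (ratderZD p q) (ratderM p q)
  t_trans t_gen Dt P00 Q00 n0.
split; first by exists M; split=> //; apply/caseP.
by move=> M1 M2 d1 /caseP[p1 _] d2 /caseP[p2 _]; exact: uniq.
Qed.

Lemma generator_exists : (exists M, case M) <-> (P.[0] != 0 /\ Q.[0] != 0) /\ c.
Proof.
split=> [[M /caseP[pM hc]]|[PQ hc]].
  by have [_ [_ _ P00 Q00 _]] := positive_ldP P0 Q0 PQ0 Dt pM.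
by have [[M [_ cM]] _] := generator_unique PQ hc (isT : 0 < 1)%N; exists M.
Qed.

End Generator.

Variable alpha : K.
Hypothesis alpha0 : alpha != 0.

Lemma case1P M : leading_case (fun L => 0 < L) alpha M <->
  positive_ld s M /\ alpha = p.[0] / q.[0].
Proof.
have pq00 := coprime_horner_neq0 pq 0; have Ds := ratder_gen p q0.
split=> [/(leading_caseP _ _ alpha0)[chi [M0 iM chiP [L L0 hL]]]|[pM ->]].
  split; first exact: positive_ld_character chiP hL L0 alpha0.
  by have [_ _ _ ->] := generator_ld chiP p0 q0 pq00 Ds L0 alpha0 hL.
have [M0 iM _] := pM.
have [chi [chiP hL p00 q00 _]] := positive_ldP p0 q0 pq00 Ds pM.
by apply/leading_caseP; [rewrite mulf_neq0 ?invr_neq0|exists chi; split=> //; exists 1].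
Qed.

Lemma case1_regular M : leading_case (fun L => 0 < L) alpha M ->
  is_ld (ss_series (Sser M)) 1 /\ is_power_series (Sser M).
Proof.
move=> /case1P[pM aE]; have [M0 _ _] := pM.
have [chi [chiP hL p00 q00 reg]] :=
  positive_ldP p0 q0 (coprime_horner_neq0 pq 0) (ratder_gen p q0) pM.
split=> //; rewrite -aE in hL.
by have [_ /(_ hL)[]] := is_ld_character s 1 M0 chiP alpha0.
Qed.

Lemma case2_regular M : leading_case (fun L => L = 0) alpha M ->
  is_power_series (Sser M) /\
  ss_series (Sser M) 1 = (p.[alpha] / q.[alpha]) *: \1%VF.
Proof.
move=> /(case2_translate p0 q0 pq _ alpha0) pM.
have [chi [chiP hL _ _ reg]] := positive_ldP (translate_neq0 alpha p0) (translate_neq0 alpha q0)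
  (coprime_translate pq alpha) (ratder_translate p q0 alpha) pM.
split.
  move=> i i0; have e : s = alpha *: 1 + (s - alpha%:A) by rewrite addrC subrK.
  rewrite /Sser [X in Ycoef M X]e Ycoef_linear reg // addr0 Ycoef_vacuum ifF ?scaler0 //.
  by apply/eqP; lia.
rewrite /ss_series (ss_part_Ycoef chiP); congr (_ *: _).
have := hL.2; rewrite (character_translate _ _ chiP) !horner_translate => <-.
by rewrite mulr0 subr0.
Qed.

(** For t = 1/s the leading coefficient P(0)/Q(0) of chi(t) is minus the quotient of the leading
    coefficients of p and q, the sign being that of D(1/s) = - s^-2 D(s); alpha is its inverse. *)
Lemma case3P M : leading_case (fun L => L < 0) alpha M <->
  positive_ld s^-1 M /\ alpha = - (lead_coef q / lead_coef p).
Proof.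
have st : s * s^-1 = 1 := mulfV (gen_neq0 K).
have ts : s^-1 * s = 1 := mulVf (gen_neq0 K).
have lp0 : lead_coef p != 0 by rewrite lead_coef_eq0.
have lq0 : lead_coef q != 0 by rewrite lead_coef_eq0.
have PQ0 : (inverse_num p q).[0] != 0 -> (inverse_den p q).[0] != 0 ->
    ((inverse_num p q).[0] / (inverse_den p q).[0])^-1 = - (lead_coef q / lead_coef p).
  move=> P00 Q00; have e := (inverse_num_den_neq0 p0 q0).1 (conj P00 Q00).
  by rewrite inverse_num0 inverse_den0 e leqnn !mulr1n invf_div invrN mulrN.
split=> [/(leading_caseP _ _ alpha0)[chi [M0 iM chiP [L L0 hL]]]|[pM aE]].
  have L0' : 0 < - L by lia.
  have hL' := has_ld_inverse chiP st alpha0 hL.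
  have a0' : alpha^-1 != 0 by rewrite invr_neq0.
  split; first exact: positive_ld_character chiP hL' L0' a0'.
  have [P00 Q00 _ e] := generator_ld chiP (inverse_num_neq0 q p0) (inverse_den_neq0 p q0)
    (inverse_num_den0 p0 q0) (ratder_inverse p0 q0) L0' a0' hL'.
  by rewrite -[LHS]invrK e PQ0.
have [M0 iM _] := pM.
have [chi [chiP hL P00 Q00 _]] := positive_ldP (inverse_num_neq0 q p0)
  (inverse_den_neq0 p q0) (inverse_num_den0 p0 q0) (ratder_inverse p0 q0) pM.
have c0 : (inverse_num p q).[0] / (inverse_den p q).[0] != 0.
  by rewrite mulf_neq0 ?invr_neq0.
have := has_ld_inverse chiP ts c0 hL; rewrite PQ0 // -aE => hs.
by apply/(leading_caseP _ _ alpha0); exists chi; split=> //; exists (-1).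
Qed.

Lemma case3_ld M : leading_case (fun L => L < 0) alpha M ->
  is_ld (ss_series (Sser M)) (-1).
Proof.
move=> cM; have [pM _] := (case3P M).1 cM.
have [chi [M0 _ chiP [L L0 hL]]] := (leading_caseP _ _ alpha0).1 cM.
have L0' : 0 < - L by lia.
have st : s * s^-1 = 1 := mulfV (gen_neq0 K).
have hL' := has_ld_inverse chiP st alpha0 hL.
have a0' : alpha^-1 != 0 by rewrite invr_neq0.
have [_ _ L1 _] := generator_ld chiP (inverse_num_neq0 q p0) (inverse_den_neq0 p q0)
  (inverse_num_den0 p0 q0) (ratder_inverse p0 q0) L0' a0' hL'.
rewrite -[1]L1 opprK.
by have [_ /(_ hL)[]] := is_ld_character s L M0 chiP alpha0.
Qed.

End Classification.

Theorem theorem2 (R : realType) (p q : {poly R[i]})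
    (p_neq0 : p != 0) (q_neq0 : q != 0) (pq_coprime : coprimep p q)
    (alpha : R[i]) (alpha_neq0 : alpha != 0) :
  let case1 := @leading_case _ p q (fun L => 0 < L) alpha in
  let case2 := @leading_case _ p q (fun L => L = 0) alpha in
  let case3 := @leading_case _ p q (fun L => L < 0) alpha in
  let cond1 := p.[0] * q.[0] != 0 /\ alpha = p.[0] / q.[0] in
  let cond2 := p.[alpha] * q.[alpha] != 0 in
  let cond3 := (size p).-1 = ((size q).-1 + 2)%N /\
               alpha = - (lead_coef q / lead_coef p) in
  [/\ [/\ (exists M : ratmodule p q, case1 M) <-> cond1,
          forall M : ratmodule p q, case1 M ->
            is_ld (ss_series (Sser M)) 1 /\ is_power_series (Sser M)
        & cond1 -> unique_in_each_dim case1],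
      [/\ (exists M : ratmodule p q, case2 M) <-> cond2,
          forall M : ratmodule p q, case2 M ->
            is_power_series (Sser M) /\
            ss_series (Sser M) 1 = (p.[alpha] / q.[alpha]) *: \1%VF
        & cond2 -> unique_in_each_dim case2]
    & [/\ (exists M : ratmodule p q, case3 M) <-> cond3,
          forall M : ratmodule p q, case3 M ->
            is_ld (ss_series (Sser M)) (-1)
        & cond3 -> unique_in_each_dim case3]].
Proof.
move=> case1 case2 case3 cond1 cond2 cond3.
have neq0_mul (x y : R[i]) : (x != 0 /\ y != 0) <-> x * y != 0.
  by rewrite mulf_eq0 negb_or; split=> [[-> ->]|/andP].
have pq00 := coprime_horner_neq0 pq_coprime 0.
have sP M := case1P p_neq0 q_neq0 pq_coprime alpha_neq0 M.
have tP M : case2 M <-> positive_ld ('X%:F - alpha%:A) M /\ True.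
  by have [h1 h2] := case2_translate p_neq0 q_neq0 pq_coprime M alpha_neq0;
    split=> [/h1|[/h2]].
have iP M := case3P p_neq0 q_neq0 pq_coprime alpha_neq0 M.
split; split.
- have := generator_exists p_neq0 q_neq0 pq00 (ratder_gen p q_neq0)
    (@gen_transcendental _) (@gen_fractions _) sP.
  by rewrite neq0_mul.
- by move=> M; exact: case1_regular.
- by move=> [/neq0_mul h]; exact: (generator_unique (ratder_gen p q_neq0)
    (@gen_transcendental _) (@gen_fractions _) sP).
- have := generator_exists (translate_neq0 alpha p_neq0) (translate_neq0 alpha q_neq0)
    (coprime_translate pq_coprime alpha) (ratder_translate p q_neq0 alpha)
    (@translate_transcendental _ alpha) (@translate_gen _ alpha) tP.
  rewrite !horner_translate neq0_mul => -[h1 h2].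
  by split=> [/h1[]|h] //; apply: h2.
- by move=> M; exact: case2_regular.
- move=> /neq0_mul h; apply: (generator_unique (ratder_translate p q_neq0 alpha)
    (@translate_transcendental _ alpha) (@translate_gen _ alpha) tP) => //.
  by rewrite !horner_translate.
- have := generator_exists (inverse_num_neq0 q p_neq0) (inverse_den_neq0 p q_neq0)
    (inverse_num_den0 p_neq0 q_neq0) (ratder_inverse p_neq0 q_neq0)
    (@inverse_transcendental _) (@inverse_gen _) iP.
  by rewrite (inverse_num_den_neq0 p_neq0 q_neq0).
- by move=> M; exact: case3_ld.
- move=> [/(inverse_num_den_neq0 p_neq0 q_neq0) h].
  exact: (generator_unique (ratder_inverse p_neq0 q_neq0)
    (@inverse_transcendental _) (@inverse_gen _) iP h).
Qed.
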